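(* Let $A\in\mathrm{Mat}_{m,n}$ and $\tau\in(0,\infty)\setminus\mathcal E_{m,n}$. For every $c>0$, $$\dim_H D_A(c\psi_\tau)=\liminf_{T\to\infty}\frac{\displaystyle\int_1^T r_{A,\tau}(S)\,\frac{dS}{S}-\log\mathcal N_A(T^{-\tau},T)}{(1+\tau)\log T}.$$ In particular, this dimension is independent of $c$. Its common value is continuous as a function of $\tau$ on each connected component of $(0,\infty)\setminus\mathcal E_{m,n}$. Moreover, if $\psi:\mathbb R_+\to\mathbb R_+$ is continuous, strictly decreasing to zero, and $$\lim_{T\to\infty}\frac{\log\psi(T)^{-1}}{\log T}=\tau,$$ then, for every $c>0$, $\dim_H D_A(c\psi)=\dim_H D_A(\psi_\tau)$, so the right-hand side of the displayed formula above also equals $\dim_H D_A(c\psi)$.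
   Context: Let $m,n\in\mathbb N$, $d=m+n$, $\mathbb R_+=(0,\infty)$, and let $\mathrm{Mat}_{m,n}$ be the set of real $m\times n$ matrices. $|\cdot|$ is the supremum norm. $\mathbb T^m=\mathbb R^m/\mathbb Z^m$ carries the quotient supremum metric, and $\dim_H$ is Hausdorff dimension. For a function $\psi:\mathbb R_+\to\mathbb R_+$, $D_A(\psi)$ is the set of $\mathbf b\in\mathbb T^m$ such that for every sufficiently large real $T$ there is $(\mathbf p,\mathbf q)\in\mathbb Z^m\times\mathbb Z^n$ with $|A\mathbf q-\mathbf p-\mathbf b|\le\psi(T)$ and $|\mathbf q|\le T$. $\psi_\tau(T):=T^{-\tau}$, and $c\psi$ is $T\mapsto c\psi(T)$. $\mathcal E_{m,n}:=\{b/a: a,b\in\mathbb N,\ 1\le a\le m,\ 1\le b\le n\}$. $u_A=\begin{pmatrix}I_m&A\\0&I_n\end{pmatrix}$, $a_t=\mathrm{diag}(e^{t/m}I_m,e^{-t/n}I_n)$. For a lattice $\Lambda\subset\mathbb R^d$, $\lambda_i(\Lambda)$ is its $i$-th successive minimum relative to $[-1,1]^d$ (the infimum of $\lambda>0$ such that $\lambda[-1,1]^d\cap\Lambda$ contains $i$ linearly independent vectors), and $\lambda_i(t):=\lambda_i(a_tu_A\mathbb Z^d)$. For $R,Q>0$, $$t_{R,Q}:=\frac{mn}{d}\log\frac QR,\qquad \mathcal N_A(R,Q):=\prod_{i=1}^d\max\left\{\frac{Q^{n/d}R^{m/d}}{\lambda_i(t_{R,Q})},1\right\}.$$ Finally $$r_{A,\tau}(T):=\#\left\{1\le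 i\le d:\ \lambda_i\left(\tfrac{mn(1+\tau)}{d}\log T\right)<T^{(n-m\tau)/d}\right\}.$$ *)

(* Defs.v *)
From HB Require Import structures.
From mathcomp Require Import all_boot all_order all_algebra.
From mathcomp Require Import all_classical all_reals all_analysis.

Set Implicit Arguments.
Unset Strict Implicit.
Unset Printing Implicit Defensive.

Import Order.TTheory GRing.Theory Num.Theory.
Import numFieldNormedType.Exports.

Local Open Scope classical_set_scope.
Local Open Scope quotient_scope.
Local Open Scope ring_scope.

(* The norm `|x| of MathComp-Analysis on matrices is the supremum norm. *)

Section Torus.
Context (R : realType) (m : nat).
Implicit Types x y z : 'cV[R]_m.

Definition int_vec (n : nat) (p : 'cV[int]_n) : 'cV[R]_n :=
  map_mx (fun k : int => k%:~R) p.

Definition torus_eqv x y : bool := `[< exists p : 'cV[int]_m, x - y = int_vec p >].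

Lemma torus_eqv_is_equiv : equiv_class_of torus_eqv.
Proof.
split=> [x|x y|y x z].
- by apply/asboolP; exists 0; rewrite /int_vec raddf0 subrr.
- apply/asboolP/asboolP=> -[p xyp]; exists (- p);
    by rewrite /int_vec raddfN /= -/(int_vec p) -xyp opprB.
- move=> /asboolP[p xyp] /asboolP[q yzq]; apply/asboolP; exists (p + q).
  by rewrite /int_vec raddfD /= -/(int_vec p) -/(int_vec q) -xyp -yzq addrA subrK.
Qed.

Canonical torus_equiv := EquivRelPack torus_eqv_is_equiv.

Definition torus := {eq_quot torus_eqv}.
HB.instance Definition _ := Choice.copy torus {eq_quot torus_eqv}.
HB.instance Definition _ := EqQuotient.copy torus {eq_quot torus_eqv}.

Lemma torus_piP x y :
  (\pi_torus x = \pi_torus y) <-> exists p : 'cV[int]_m, x - y = int_vec p.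
Proof.
split=> [/eqmodP/asboolP//|xy]; by apply/eqmodP/asboolP.
Qed.

Definition torus_dists (a b : torus) : set R :=
  [set r | exists x y, [/\ \pi_torus x = a, \pi_torus y = b & r = `|x - y| ]].

Definition torus_dist (a b : torus) : R := inf (torus_dists a b).

Lemma torus_dists_lbound a b : lbound (torus_dists a b) 0.
Proof. by move=> r [x [y [_ _ ->]]]. Qed.

Lemma torus_dists_has_inf a b : has_inf (torus_dists a b).
Proof.
split; last by exists 0; exact: torus_dists_lbound.
by exists `|repr a - repr b|, (repr a), (repr b); rewrite !reprK.
Qed.

Lemma torus_dist_ge0 a b : 0 <= torus_dist a b.
Proof.
by apply: lb_le_inf; [case: (torus_dists_has_inf a b)|exact: torus_dists_lbound].
Qed.

Lemma torus_dist_le x y : torus_dist (\pi_torus x) (\pi_torus y) <= `|x - y|.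
Proof.
apply: ge_inf; first by case: (torus_dists_has_inf (\pi_torus x) (\pi_torus y)).
by exists x, y.
Qed.

Lemma torus_dist_adherent a b x e : \pi_torus x = a -> 0 < e ->
  exists2 y, \pi_torus y = b & `|x - y| < torus_dist a b + e.
Proof.
move=> xa e0.
have [r [x' [y' [x'a y'b ->]]] lte] := inf_adherent e0 (torus_dists_has_inf a b).
exists (y' + (x - x')); last by rewrite opprD addrA [x - y' - _]addrAC subKr.
rewrite -y'b; apply/torus_piP.
have /torus_piP[p xx'] : \pi_torus x = \pi_torus x' by rewrite xa x'a.
by exists p; rewrite addrC addKr xx'.
Qed.

Lemma torus_distxx a : torus_dist a a = 0.
Proof.
apply/eqP; rewrite eq_le torus_dist_ge0 andbT -[a]reprK.
by apply: le_trans (torus_dist_le _ _) _; rewrite subrr normr0.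
Qed.

Lemma torus_dist_sym a b : torus_dist a b = torus_dist b a.
Proof.
congr inf; apply/seteqP; split=> r [x [y [xa yb ->]]];
  by exists y, x; split=> //; rewrite distrC.
Qed.

Lemma torus_dist_triangle b a c :
  torus_dist a c <= torus_dist a b + torus_dist b c.
Proof.
apply/ler_addgt0Pr => e e0.
have e20 : 0 < e / 2 by rewrite divr_gt0.
have [y yb xy] := torus_dist_adherent b (reprK a) e20.
have [z zc yz] := torus_dist_adherent c yb e20.
rewrite -{1}[a]reprK -{1}zc; apply: le_trans (torus_dist_le _ _) _.
apply: le_trans (ler_distD y _ _) _.
by rewrite [e in leRHS]splitr addrACA; apply: lerD; exact: ltW.
Qed.

Lemma int_vec_small (p : 'cV[int]_m) : `|int_vec p| < 1 -> p = 0.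
Proof.
move=> p1; apply/matrixP => i j; rewrite [RHS]mxE.
have : `|int_vec p i j| < 1.
  apply: le_lt_trans p1.
  rewrite [leRHS]/Num.norm/= mx_normrE.
  by apply: (le_bigmax _ (fun ij : 'I_m * 'I_1 => `|int_vec p ij.1 ij.2|) (i, j)).
by rewrite mxE -intr_norm ltrz1 -[1]add0r ltzD1 normr_le0 => /eqP.
Qed.

Lemma torus_dist_eq0 a b : torus_dist a b = 0 -> a = b.
Proof.
move=> ab0.
have near0 e : 0 < e -> exists2 y, \pi_torus y = b & `|repr a - y| < e.
  by move=> /(torus_dist_adherent b (reprK a)); rewrite ab0 add0r.
have [y yb ay] : exists2 y, \pi_torus y = b & `|repr a - y| < 1 / 2.
  by apply: near0; rewrite divr_gt0.
rewrite -[a]reprK -yb; congr (\pi_torus _).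
apply/subr0_eq/normr0_eq0/eqP; rewrite eq_le normr_ge0 andbT.
apply/ler_addgt0Pl => e e0; rewrite addr0.
have [z zb] : exists2 z, \pi_torus z = b & `|repr a - z| < Num.min e (1 / 2).
  by apply: near0; rewrite lt_min e0 divr_gt0.
rewrite lt_min => /andP[aze az].
have /torus_piP[p yzp] : \pi_torus y = \pi_torus z by rewrite yb zb.
suff -> : y = z by exact: ltW.
apply/subr0_eq; rewrite yzp (@int_vec_small p) /int_vec ?raddf0 // -/(int_vec p) -yzp.
apply: le_lt_trans (ler_distD (repr a) _ _) _.
by rewrite [ltRHS](splitr 1) distrC; apply: ltrD.
Qed.

HB.instance Definition _ := isMetric.Build R torus
  torus_distxx torus_dist_eq0 torus_dist_sym torus_dist_triangle.

End Torus.

Section HausdorffDimension.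
Context (R : realType) (X : metricType R).
Implicit Types (E U : set X) (s delta : R).
Local Open Scope ereal_scope.

Definition diam U : \bar R := ereal_sup [set (mdist x y)%:E | x in U & y in U].

(* The empty set contributes 0 also when s = 0, where 0 `^ 0 = 1. *)
Definition diam_pow s U : \bar R := if U == set0 then 0 else diam U `^ s.

Definition hausdorff_premeasure s delta E : \bar R :=
  ereal_inf [set \sum_(0 <= k <oo) diam_pow s (U k) | U in
    [set U : (set X)^nat |
      E `<=` \bigcup_k U k /\ forall k, diam (U k) <= delta%:E]].

Definition hausdorff_measure s E : \bar R :=
  ereal_sup [set hausdorff_premeasure s delta E | delta in [set delta | (0 < delta)%R]].

Definition hausdorff_dim E : \bar R :=
  ereal_inf [set s%:E | s in [set s | (0 <= s)%R /\ hausdorff_measure s E = 0]].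

End HausdorffDimension.

(* A function on (0, +oo) is represented by a function on R; only its values at
   positive arguments matter. *)
Definition psi_pow (R : realType) (tau : R) : R -> R := fun T => T `^ (- tau).

(* D_A(psi). The choice of the representative of b is immaterial since p ranges
   over all of Z^m. *)
Definition uniform_approx (R : realType) (m n : nat) (A : 'M[R]_(m, n))
    (psi : R -> R) : set (torus R m) :=
  [set b | \forall T \near +oo, exists (p : 'cV[int]_m) (q : 'cV[int]_n),
    `|A *m int_vec R q - int_vec R p - repr b| <= psi T /\ `|int_vec R q| <= T].

Definition exceptional_exponents (R : realType) (m n : nat) : set R :=
  [set x | exists a b : nat,
    [/\ (1 <= a <= m)%N, (1 <= b <= n)%N & x = b%:R / a%:R]].
Arguments exceptional_exponents : clear implicits.

Definition regular_exponents (R : realType) (m n : nat) : set R :=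
  `]0, +oo[ `\` exceptional_exponents R m n.
Arguments regular_exponents : clear implicits.

Definition successive_minimum (R : realType) (d : nat) (L : set 'cV[R]_d)
    (i : nat) : R :=
  inf [set l | 0 < l /\ exists X : i.-tuple 'cV[R]_d,
    free X /\ forall v, v \in X -> L v /\ `|v| <= l].

Section Flow.
Context (R : realType) (m n : nat) (A : 'M[R]_(m, n)).
Implicit Types t T Q tau : R.

Definition unipotent_mx : 'M[R]_(m + n) := block_mx 1%:M A 0 1%:M.

Definition flow_mx t : 'M[R]_(m + n) :=
  block_mx (expR (t / m%:R))%:M 0 0 (expR (- t / n%:R))%:M.

Definition flow_lattice t : set 'cV[R]_(m + n) :=
  [set flow_mx t *m (unipotent_mx *m int_vec R z) | z in [set: 'cV[int]_(m + n)]].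

(* i ranges over 'I_(m + n), so the i-th minimum below is lambda_(i+1)(t). *)
Definition flow_minimum t (i : 'I_(m + n)) : R :=
  successive_minimum (flow_lattice t) i.+1.

Local Notation d := (m + n)%:R.

Definition box_time r Q : R := (m * n)%:R / d * ln (Q / r).

(* N_A(r, Q) *)
Definition box_count r Q : R :=
  \prod_(i < m + n)
    Num.max (Q `^ (n%:R / d) * r `^ (m%:R / d) / flow_minimum (box_time r Q) i) 1.

(* r_{A, tau}(T) *)
Definition small_minima_count tau T : nat :=
  #|[set i : 'I_(m + n) |
      flow_minimum ((m * n)%:R * (1 + tau) / d * ln T) i
        < T `^ ((n%:R - m%:R * tau) / d)]%SET|.

Definition dim_formula tau : \bar R :=
  limf_einf (fun T : R =>
    ((\int[lebesgue_measure]_(S in `[1, T]) ((small_minima_count tau S)%:R / S)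
      - ln (box_count (T `^ (- tau)) T)) / ((1 + tau) * ln T))%:E)
    (pinfty_nbhs R).

End Flow.

(* Main.v *)
(* Write s = log T and let V(s, u) be the span of the lattice vectors (p + A q, q) in the box
   |p + A q| <= e^(u - tau s), |q| <= e^(u + s). Counting lattice points one coordinate at a time
   shows that log N_A is, up to O(1), the logarithm of the number of lattice points in the box with
   u = 0. A weighted maximal minor of V selects rank V coordinates that dominate all the others on V;
   let a be the number of x-coordinates among them, which is nondecreasing in s. While V and a are
   constant, the log-count moves at speed (rank V - a) - tau a.

   Since tau is not of the form b/a, two such speeds for different ranks differ, and comparing the
   counts at u = -eta s and u = eta s shows that V(s, -eta s) = V(s, eta s) outside a set of times s
   of arbitrarily small upper density. Off these times the numerator of the formula grows by
   (1 + tau) h a over a window of length h, up to a small error, and nearby exponents see the same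
   windows, which gives continuity in tau.

   Over such a window the points reachable from a ball of radius e^(-tau s) are, up to constants,
   e^(tau h a) balls of radius e^(-tau (s + h)): the a dominating x-coordinates can be chosen freely,
   and they determine the rest. Covering by these balls bounds the dimension from above, and the tree
   of lattice points that they form bounds it from below. Other functions psi and constants c are
   squeezed between exponents tau - e and tau + e. *)
Require Import Defs.
From mathcomp Require Import all_boot all_order all_algebra.
From mathcomp Require Import all_classical all_reals all_analysis.
From mathcomp Require Import finmap.
From mathcomp Require Import zify ring lra.
Import Order.TTheory GRing.Theory Num.Theory.
Import numFieldNormedType.Exports.
Set Implicit Arguments.
Unset Strict Implicit.
Unset Printing Implicit Defensive.
Local Open Scope classical_set_scope.
Local Open Scope ring_scope.

(** * Counting points of a group in boxes *)

(** No volume enters the proof. Counts are compared by covering and packing with translates, so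
    lattice volumes and Minkowski's theorems are replaced by constants that depend only on m and n.
    Such a constant is lost once per window. This dictates the order of choices: the window length h
    is taken large first, and only then the scale eta so small that the windows with a varying span
    or type are rare. The growth (1 + tau) h a is a difference of two speeds. While the span is V,
    the integral of the number of small minima grows at speed rank V and the log-count at speed
    (rank V - a) - tau a, so rank V cancels and only the quantity that governs the geometry of the
    targets survives. Spans are compared at u = -eta s and u = eta s rather than at u = 0 because a
    change of time, of exponent or of a multiplicative constant can always be paid for by a shift of
    u. Where the two spans agree, such a change does not affect the span at all. *)

Definition ncard (T : choiceType) (A : set T) : nat := #|` fset_set A|.

Section Cardinality.
Context (T : choiceType).
Implicit Types A B : set T.

Lemma ncard_le A B : finite_set B -> A `<=` B -> (ncard A <= ncard B)%N.
Proof.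
move=> finB AB; apply: fsubset_leq_card.
by rewrite -fset_set_sub//; exact: sub_finite_set finB.
Qed.

Lemma ncard_inj (T' : choiceType) A (A' : set T') (f : T -> T') :
  finite_set A -> finite_set A' -> {in A &, injective f} ->
  (forall x, A x -> A' (f x)) -> (ncard A <= ncard A')%N.
Proof.
move=> finA finB fI fAB; rewrite /ncard.
rewrite -(@card_in_imfset imfset_key _ _ f (mem (fset_set A))) /=; last first.
  by move=> x y /=; rewrite !in_fset_set//; exact: fI.
apply: fsubset_leq_card; apply/fsubsetP => y /imfsetP[x /=].
by rewrite !in_fset_set// => /set_mem Ax ->; exact/mem_set/fAB.
Qed.

Lemma ncard_fibers A N (f : T -> 'I_N) : finite_set A ->
  ncard A = (\sum_(c < N) ncard (A `&` [set x | f x = c]))%N.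
Proof.
move=> finA; rewrite /ncard card_fset_sum1 (partition_big f predT)//=.
apply: eq_bigr => c _; rewrite card_fset_sum1 -big_filter.
apply: perm_big; apply: uniq_perm; rewrite ?filter_uniq ?fset_uniq//.
have finC : finite_set (A `&` [set x | f x = c]) by exact: finite_setIl.
move=> x; rewrite mem_filter !in_fset_set//; apply/andP/idP.
  by move=> [/eqP fx /set_mem Ax]; apply/mem_set.
by move=> /set_mem[Ax /= ->]; split=> //; exact/mem_set.
Qed.

Lemma ncard_gt0 A x : finite_set A -> A x -> (0 < ncard A)%N.
Proof.
move=> finA Ax; rewrite /ncard cardfs_gt0; apply/fset0Pn; exists x.
by rewrite in_fset_set//; exact/mem_set.
Qed.

End Cardinality.

Section BoxCount.
Context (R : realType) (T : zmodType) (r : nat) (G : set T) (Y : 'I_r -> T -> R).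
Implicit Types w : 'I_r -> R.
Hypothesis GB : forall x y, G x -> G y -> G (x - y).
Hypothesis YB : forall j x y, Y j (x - y) = Y j x - Y j y.

Definition cbox w := [set z | G z /\ forall j, `|Y j z| <= w j].
Hypothesis finbox : forall w, finite_set (cbox w).

Definition tbox x w := [set z | G z /\ forall j, `|Y j z - x j| <= w j].

Definition upd w j (v : R) : 'I_r -> R := fun i => if i == j then v else w i.

Let YD j x y : Y j (x + y) = Y j x + Y j y.
Proof.
have Y0 : Y j 0 = 0 by rewrite -{1}(subrr 0) YB subrr.
by rewrite -{1}[y]opprK YB -[- y]add0r YB Y0 sub0r opprK.
Qed.

Let GD x y : G x -> G y -> G (x + y).
Proof.
move=> Gx Gy; rewrite -[y]opprK; apply: GB => //.
by rewrite -[- y]add0r -(subrr y); apply: GB => //; exact: GB.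
Qed.

Lemma tbox_fin x w : finite_set (tbox x w).
Proof.
apply: sub_finite_set (finbox (fun j => w j + `|x j|)) => z [Gz zw]; split=> // j.
by rewrite -[Y j z](subrK (x j)) (le_trans (ler_normD _ _))// lerD.
Qed.

(** Subtracting one fixed point of the translate moves all the others into the centred box of twice
    the widths. *)
Lemma tbox_half x w : (ncard (tbox x (fun j => w j / 2)) <= ncard (cbox w))%N.
Proof.
have [->|/set0P[z0 [Gz0 z0w]]] := eqVneq (tbox x (fun j => w j / 2)) set0.
  by rewrite /ncard fset_set0.
apply: (@ncard_inj _ _ _ _ (fun z => z - z0)) => //; first exact: tbox_fin.
  by move=> z z' _ _; exact: addIr.
move=> z [Gz zw]; split=> [|j]; first exact: GB.
have := zw j; have := z0w j; rewrite YB !ler_norml => /andP[? ?] /andP[? ?].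
by apply/andP; split; lra.
Qed.

(** The interval of half-width [v] in coordinate [j] is cut into at most [v / w j + 1] intervals of
    half-width [w j], and each slab is a translated box to which the bound [B] applies. *)
Lemma tbox_upd w j (v B : R) : 0 < w j -> 0 <= v ->
  (forall x, (ncard (tbox x w))%:R <= B :> R) ->
  forall x, (ncard (tbox x (upd w j v)))%:R <= (v / w j + 1) * B.
Proof.
move=> w0 v0 wB x.
have B0 : 0 <= B by apply: le_trans (wB x).
pose f z := Num.floor ((Y j z - x j + v) / (2 * w j)).
set M := `|Num.floor (v / w j)|%N.
have M0 : (0 <= Num.floor (v / w j)) by rewrite floor_ge0 divr_ge0// ltW.
rewrite (@ncard_fibers _ _ M.+1 (fun z => inord `|f z|%N)); last exact: tbox_fin.
have MM : M.+1%:R <= v / w j + 1.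
  rewrite -natr1 lerD2r /M natr_absz ger0_norm//; exact: floor_le.
rewrite natr_sum; apply: (@le_trans _ _ (\sum_(c < M.+1) B)); last first.
  by rewrite sumr_const card_ord -mulr_natl ler_wpM2r.
apply: ler_sum => c _.
apply: le_trans (wB (upd x j (x j - v + (2 * c%:R + 1) * w j))).
rewrite ler_nat; apply: ncard_le; first exact: tbox_fin.
move=> z [[Gz zw] /= zc]; split=> // i.
have := zw i; rewrite /upd; case: eqP => [-> {i}|//] zj.
have fz0 : 0 <= f z.
  rewrite floor_ge0; apply: divr_ge0; last by rewrite mulr_ge0// ltW.
  by move: zj; rewrite ler_norml => /andP[]; lra.
have fzM : f z <= Num.floor (v / w j).
  apply: le_floor; rewrite ler_pdivrMr ?mulr_gt0//.
  rewrite (_ : v / w j * _ = 2 * v); last by field; rewrite gt_eqF.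
  by move: zj; rewrite ler_norml => /andP[]; lra.
have fzc : f z = c%:Z.
  rewrite -zc inordK ?gez0_abs// ltnS /M.
  by rewrite -lez_nat !gez0_abs.
have := floor_itv ((Y j z - x j + v) / (2 * w j)); rewrite -/(f z) fzc.
rewrite ler_pdivlMr ?mulr_gt0// ltr_pdivrMr ?mulr_gt0//.
rewrite -pmulrn intrD -pmulrn => /andP[h1 h2].
by rewrite ler_norml; apply/andP; split; nra.
Qed.

(** Induction that changes the widths one coordinate at a time; [s] lists the coordinates already
    moved from [w] to [w']. *)
Lemma big_upd (P : seq 'I_r -> ('I_r -> R) -> Prop) w w' :
  P [::] w ->
  (forall s w1 j, j \notin s -> w1 = (fun i => if i \in s then w' i else w i) ->
     P s w1 -> P (j :: s) (upd w1 j (w' j))) ->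
  P (index_enum 'I_r) w'.
Proof.
move=> P0 PS.
have H s : uniq s -> P s (fun i => if i \in s then w' i else w i).
  elim: s => [|j s IH] /=; first by [].
  move=> /andP[js us]; have := PS s _ j js erefl (IH us).
  congr P; apply/funext => i; rewrite /upd in_cons.
  by case: eqP => [->|].
have := H (index_enum 'I_r) (index_enum_uniq _).
by congr P; apply/funext => i; rewrite mem_index_enum.
Qed.

(** The coordinatewise step needs a bound valid for every translate. Starting from the widths
    [w / 2] provides one, and is the origin of the factor 2. *)
Lemma cbox_upper w w' : (forall j, 0 < w j) -> (forall j, 0 <= w' j) ->
  (ncard (cbox w'))%:R <= \prod_j (2 * w' j / w j + 1) * (ncard (cbox w))%:R :> R.
Proof.
move=> w0 w'0.
pose w2 j := w j / 2.
have w20 j : 0 < w2 j by rewrite divr_gt0.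
pose P s w1 := forall x, (ncard (tbox x w1))%:R <=
  \prod_(j <- s) (2 * w' j / w j + 1) * (ncard (cbox w))%:R :> R.
have : P (index_enum 'I_r) w'.
  apply: (@big_upd P w2) => [x|s w1 j js w1E Pw1 x].
    by rewrite big_nil mul1r ler_nat; exact: tbox_half.
  have w1j : w1 j = w2 j by rewrite w1E (negbTE js).
  rewrite big_cons -mulrA (_ : 2 * w' j / w j = w' j / w1 j).
    by apply: tbox_upd => //; rewrite w1j.
  by rewrite w1j /w2; field; rewrite gt_eqF.
move=> /(_ (fun=> 0)); congr (_%:R <= _).
by congr ncard; apply/seteqP; split=> z [Gz H]; split=> // j; have := H j; rewrite subr0.
Qed.

(** The covering radius of the image of [G] is at most [D] in the norm whose unit ball has
    half-widths [w]. *)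
Definition spread (D : R) w :=
  forall x : 'I_r -> R, exists2 z, G z & forall j, `|Y j z - x j| <= D * w j.

Lemma spread_le D w w' : 0 <= D -> (forall j, w j <= w' j) -> spread D w -> spread D w'.
Proof.
move=> D0 ww' sw x; have [z Gz zx] := sw x; exists z => // j.
by apply: le_trans (zx j) _; rewrite ler_wpM2l.
Qed.

(** Packing: for each multiple of [L * w j] up to [v], some group element is close to it in
    coordinate [j] and close to 0 in the others. The translates of the small box by these elements
    are disjoint and stay in the enlarged box inflated by [D + 2]. *)
Lemma cbox_lower1 (D : R) w j (v : R) : 1 <= D -> (forall i, 0 < w i) -> w j <= v -> spread D w ->
  (v / w j) * (ncard (cbox w))%:R
    <= (2 * D + 3) * (ncard (cbox (fun i => (D + 2) * upd w j v i)))%:R.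
Proof.
move=> D1 w0 wv sw; have w0j := w0 j; have v0 : 0 < v by exact: lt_le_trans wv.
(* In coordinate [j] a translate stays within [(D + 1) * w j] of its multiple of [L * w j]. Since
   [L > 2 * (D + 1)], a [floor] recovers the multiple, and this is the fibre map used below. *)
set L := 2 * D + 3; have L0 : 0 < L by rewrite /L; lra.
set M := `|Num.floor (v / (L * w j))|%N.
have Lw0 : 0 < L * w j by rewrite mulr_gt0.
have M0 : 0 <= Num.floor (v / (L * w j)) by rewrite floor_ge0 divr_ge0// ltW.
have ME : M%:R = (Num.floor (v / (L * w j)))%:~R :> R by rewrite /M natr_absz ger0_norm.
set A := cbox (fun i => (D + 2) * upd w j v i).
have finA : finite_set A by exact: finbox.
rewrite (@ncard_fibers _ A M.+1 (fun z =>
  inord `|Num.floor ((Y j z + (D + 1) * w j) / (L * w j))|%N))//.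
rewrite natr_sum.
apply: (@le_trans _ _ (L * (M.+1%:R * (ncard (cbox w))%:R))).
  rewrite mulrA ler_wpM2r// ler_pdivrMr//.
  rewrite (_ : L * _ * _ = M.+1%:R * (L * w j)); last by ring.
  rewrite -ler_pdivrMr// -natr1 ME; have := floorD1_gt (v / (L * w j)).
  by rewrite intrD => /ltW.
rewrite ler_wpM2l ?(ltW L0)// mulr_natl -[M.+1 in leLHS]card_ord -sumr_const.
apply: ler_sum => c _; rewrite ler_nat.
have [g Gg gc] := sw (fun i => if i == j then c%:R * (L * w j) else 0).
have cM : c%:R * (L * w j) <= v.
  rewrite -ler_pdivlMr//; apply: le_trans (floor_le _); rewrite -ME ler_nat.
  by rewrite -ltnS.
have cw0 : 0 <= c%:R * (L * w j) by rewrite mulr_ge0// ltW.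
have Dwv : D * w j <= D * v by rewrite ler_wpM2l// (le_trans ler01).
apply: (@ncard_inj _ _ _ _ (fun z => z + g)) => //.
- by apply: finite_setIl.
- by move=> z z' _ _; exact: addIr.
move=> z [Gz zw]; split; first split=> [|i]; first exact: GD.
  rewrite YD /upd; have := gc i; have := zw i; have := w0 i; case: eqP => [->|_] wi zi gi.
    move: zi gi; rewrite !ler_norml => /andP[? ?] /andP[? ?].
    by rewrite mulrDl; apply/andP; split; lra.
  by rewrite mulrDl; move: zi gi; rewrite !ler_norml => /andP[? ?] /andP[? ?]; apply/andP; split; nra.
apply: val_inj => /=; have := gc j; rewrite eqxx => gj; have := zw j => zj.
suff -> : Num.floor ((Y j (z + g) + (D + 1) * w j) / (L * w j)) = c%:Z.
  by rewrite absz_nat inordK.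
apply/floor_def; rewrite ler_pdivlMr// ltr_pdivrMr// intrD -!pmulrn YD.
have LE : L * w j = 2 * (D * w j) + 3 * w j by rewrite /L; ring.
clearbody L; move: zj gj; rewrite !ler_norml !mulrDl !mul1r => /andP[? ?] /andP[? ?].
by apply/andP; split; lra.
Qed.

Lemma cbox_scale w c : (forall i, 0 < w i) -> 0 <= c ->
  (ncard (cbox (fun i => c * w i)))%:R <= (2 * c + 1) ^+ r * (ncard (cbox w))%:R :> R.
Proof.
move=> w0 c0; apply: le_trans (cbox_upper w0 _) _.
  by move=> j; rewrite mulr_ge0// ltW.
rewrite (eq_bigr (fun=> 2 * c + 1)); last first.
  by move=> j _; rewrite mulrA mulfK// gt_eqF.
by rewrite prodr_const card_ord.
Qed.

(** Each coordinate step inflates the box by [D + 2]; [cbox_scale] undoes this before the next step,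
    at the price seen in the constant. *)
Lemma cbox_lower D w w' : 1 <= D -> (forall i, 0 < w i) -> (forall i, w i <= w' i) ->
  spread D w ->
  \prod_j (w' j / w j) * (ncard (cbox w))%:R
    <= ((2 * D + 3) * (2 * (D + 2) + 1) ^+ r) ^+ r * (ncard (cbox w'))%:R.
Proof.
move=> D1 w0 ww' sw; set C := (2 * D + 3) * _.
have C0 : 0 <= C by rewrite /C mulr_ge0 ?exprn_ge0//; lra.
pose P s w1 := \prod_(j <- s) (w' j / w j) * (ncard (cbox w))%:R
    <= C ^+ size s * (ncard (cbox w1))%:R.
have : P (index_enum 'I_r) w'.
  apply: (@big_upd P w); first by rewrite /P big_nil expr0.
  move=> s w1 j js w1E Pw1; rewrite /P big_cons /= exprS.
  have w1j : w1 j = w j by rewrite w1E (negbTE js).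
  have ww1 i : w i <= w1 i by rewrite w1E; case: ifP.
  have w10 i : 0 < w1 i by exact: lt_le_trans (ww1 i).
  have w'0 i : 0 < w' i by exact: lt_le_trans (ww' i).
  have sw1 : spread D w1 by exact: spread_le (le_trans ler01 D1) ww1 sw.
  rewrite -mulrA; apply: (@le_trans _ _ (w' j / w j * (C ^+ size s * (ncard (cbox w1))%:R))).
    by rewrite ler_wpM2l// divr_ge0// ltW.
  rewrite [leLHS]mulrCA -[leRHS]mulrA [leRHS]mulrCA ler_wpM2l ?exprn_ge0//.
  have := @cbox_lower1 D w1 j (w' j) D1 w10; rewrite w1j => /(_ (ww' j) sw1) H.
  apply: le_trans H _; rewrite /C -mulrA ler_wpM2l//; first lra.
  apply: cbox_scale; last lra.
  by move=> i; rewrite /upd; case: eqP.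
by rewrite /P /index_enum /= -enumT size_enum_ord.
Qed.

Definition compare_const (D : R) := ((2 * D + 3) * (2 * (D + 2) + 1) ^+ r) ^+ r * 3 ^+ r.

(** The two families of widths are not ordered, so both boxes are compared with the one of widths
    max(w, w'): by packing from [w'], by covering from [w]. *)
Lemma cbox_compare D w w' : 1 <= D ->
  (forall i, 0 < w i) -> (forall i, 0 < w' i) -> spread D w' ->
  (ncard (cbox w'))%:R <= compare_const D * \prod_j (w' j / w j) * (ncard (cbox w))%:R.
Proof.
move=> D1 w0 w'0 sw'; rewrite /compare_const.
set C1 := ((2 * D + 3) * (2 * (D + 2) + 1) ^+ r) ^+ r.
have C11 : 1 <= C1.
  apply: exprn_ege1; rewrite -[1]mulr1; apply: ler_pM => //; first lra.
  by apply: exprn_ege1; lra.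
pose h j := Num.max (w j) (w' j).
have h0 j : 0 < h j by rewrite lt_max w0.
have hp : 0 < \prod_j (h j / w' j) by apply: prodr_gt0 => j _; rewrite divr_gt0.
rewrite -(ler_pM2l hp); apply: le_trans (cbox_lower D1 w'0 _ sw') _.
  by move=> i; rewrite le_max lexx orbT.
rewrite -/C1 -!mulrA mulrCA ler_wpM2l ?(le_trans ler01)//.
apply: le_trans (cbox_upper w0 (fun j => ltW (h0 j))) _.
rewrite [leRHS](_ : _ = (\prod_j (h j / w' j) * (3 ^+ r * \prod_j (w' j / w j)))
  * (ncard (cbox w))%:R); last by ring.
rewrite ler_wpM2r// -[in 3 ^+ r](card_ord r) -prodr_const -!big_split /=.
apply: ler_prod => j _; apply/andP; split.
  by rewrite addr_ge0 ?divr_ge0 ?mulr_ge0 ?(ltW (h0 j)) ?(ltW (w0 j)).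
rewrite (_ : h j / w' j * _ = 3 * (h j / w j)); last by field; rewrite !gt_eqF.
rewrite -mulrA.
suff : 1 <= h j / w j by lra.
by rewrite ler_pdivlMr// mul1r le_max lexx.
Qed.

End BoxCount.

(** * Dominating coordinates of a subspace *)

Section Minors.
Context (R : realType) (r d : nat) (B : 'M[R]_(r, d)).
Hypothesis Bfree : row_free B.
Implicit Types f : {ffun 'I_r -> 'I_d}.

Definition minor f : R := \det (mxsub id f B).

Lemma minor_exists : exists f, minor f != 0.
Proof.
have Bfull : row_full B^T by rewrite /row_full mxrank_tr.
exists [ffun j => fullrankfun Bfull j].
have := fullrowsub_unit Bfull; rewrite -unitmx_tr unitmxE unitfE.
rewrite /minor (_ : mxsub _ _ B = (rowsub (fullrankfun Bfull) B^T)^T)//.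
by apply/matrixP => i j; rewrite !mxE ffunE.
Qed.

Lemma minor_inj f : minor f != 0 -> injective f.
Proof.
move=> f0 i j fij; apply/eqP; apply: contraNT f0 => ij.
rewrite /minor -det_tr; apply/eqP; apply: (determinant_alternate ij) => k.
by rewrite !mxE fij.
Qed.

Lemma minor_coord f (x : 'I_r -> R) : minor f != 0 ->
  exists2 v : 'rV[R]_d, (v <= B)%MS & forall j, v 0 (f j) = x j.
Proof.
move=> f0; pose M := mxsub id f B.
have Mu : M \in unitmx by rewrite unitmxE unitfE.
exists ((\row_j x j) *m invmx M *m B); first exact: submxMl.
move=> j; have -> : ((\row_j x j) *m invmx M *m B) 0 (f j) = ((\row_j x j) *m invmx M *m M) 0 j.
  by rewrite !mxE; apply: eq_bigr => k _; rewrite !mxE.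
by rewrite mulmxKV// mxE.
Qed.

Definition replace f j i : {ffun 'I_r -> 'I_d} :=
  [ffun k => if k == j then i else f k].

(** Cramer's rule on the row space. The coefficients are kept as ratios of minors, so that
    maximality of a minor bounds them. *)
Lemma minor_cramer f i (v : 'rV[R]_d) : minor f != 0 -> (v <= B)%MS ->
  v 0 i = \sum_j v 0 (f j) * (minor (replace f j i) / minor f).
Proof.
move=> f0 /submxP[x vE]; pose M := mxsub id f B.
have Mu : M \in unitmx by rewrite unitmxE unitfE.
have vf : x *m M = \row_j v 0 (f j).
  by apply/rowP => j; rewrite !mxE vE !mxE; apply: eq_bigr => k _; rewrite !mxE.
have xE : x = (\row_j v 0 (f j)) *m invmx M by rewrite -vf mulmxK.
rewrite {1}vE {1}xE -mulmxA mxE; apply: eq_bigr => j _; rewrite mxE; congr (_ * _).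
rewrite mxE /invmx Mu [minor (replace f j i)](expand_det_col _ j) mulr_suml.
apply: eq_bigr => k _; rewrite !mxE -/M ffunE eqxx -/(minor f) mulrAC mulrC.
rewrite [in LHS]mulrCA [in LHS]mulrC; congr (_ / _); rewrite mulrC; congr (_ * _).
rewrite /cofactor; congr (_ * \det _); apply/matrixP => a b; rewrite !mxE ffunE.
by rewrite eq_sym (negbTE (neq_lift _ _)).
Qed.

(** Maximality of the weighted minor bounds every weighted Cramer coefficient by 1. *)
Lemma minor_dominates f (om : 'I_d -> R) (v : 'rV[R]_d) i : (forall k, 0 < om k) ->
  minor f != 0 ->
  (forall f', `|minor f'| * \prod_j om (f' j) <= `|minor f| * \prod_j om (f j)) ->
  (v <= B)%MS -> `|v 0 i| * om i <= \sum_j `|v 0 (f j)| * om (f j).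
Proof.
move=> om0 f0 fmax vB; rewrite (minor_cramer i f0 vB).
rewrite -ler_pdivlMr//; apply: le_trans (ler_norm_sum _ _ _) _.
rewrite mulr_suml; apply: ler_sum => j _; rewrite !normrM -!mulrA ler_wpM2l//.
rewrite normfV ler_pdivlMr// mulrAC ler_pdivrMr ?normr_gt0// [leRHS]mulrC.
have := fmax (replace f j i).
rewrite (bigD1 j)//= [in leRHS](bigD1 j)//= ffunE eqxx.
rewrite (eq_bigr (fun k => om (f k))); last by move=> k kj; rewrite ffunE (negbTE kj).
set P := \prod_(k | k != j) _; have P0 : 0 < P by apply: prodr_gt0.
by rewrite !mulrA ler_pM2r// mulrC.
Qed.

End Minors.

Section Types.
Context (R : realType) (m n r : nat) (B : 'M[R]_(r, m + n)).
Hypothesis Bfree : row_free B.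
Implicit Types (f : {ffun 'I_r -> 'I_(m + n)}) (th : R).

Definition xdim f : nat := #|[pred j | (f j < m)%N]|.

(** Absolute value of the minor after the x-columns of [B] have been scaled by [th]. *)
Definition score th f : R := `|minor B f| * th ^+ xdim f.

Definition optimal th f := forall f', score th f' <= score th f.

Lemma optimal_exists th : exists f, optimal th f.
Proof.
have [f0 _] := minor_exists Bfree.
case: (@arg_maxP _ _ _ f0 predT (score th) erefl) => f _ fmax.
by exists f => f'; exact: fmax.
Qed.

Lemma optimal_neq0 th f : 0 < th -> optimal th f -> minor B f != 0.
Proof.
move=> th0 fmax; have [g g0] := minor_exists Bfree.
have : 0 < score th f.
  by apply: lt_le_trans (fmax g); rewrite /score mulr_gt0 ?normr_gt0 ?exprn_gt0.
by rewrite /score; apply: contraTneq => ->; rewrite normr0 mul0r ltxx.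
Qed.

(** Multiplying the two optimality inequalities cancels the minors and leaves a comparison of powers
    of [th] and [th']. *)
Lemma optimal_xdim_le th th' f f' : 0 < th -> th < th' ->
  optimal th f -> optimal th' f' -> (xdim f <= xdim f')%N.
Proof.
move=> th0 tt' fo fo'; have th'0 : 0 < th' by exact: lt_trans tt'.
have /= := fo f'; have /= := fo' f; rewrite /score leqNgt.
have := optimal_neq0 th0 fo; have := optimal_neq0 th'0 fo'; rewrite -!normr_gt0.
set D := `|_|; set D' := `|_| => D0 D'0 h1 h2; apply/negP => af.
have H : th' ^+ xdim f * th ^+ xdim f' <= th' ^+ xdim f' * th ^+ xdim f.
  rewrite -(ler_pM2l D0) -(ler_pM2l D'0).
  have := ler_pM _ _ h1 h2.
  rewrite !mulr_ge0 ?exprn_ge0 ?(ltW D0) ?(ltW D'0) ?(ltW th0) ?(ltW th'0)// => /(_ isT isT).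
  by congr (_ <= _); ring.
move: H; rewrite leNgt => /negP; apply.
rewrite -(subnKC (ltnW af)) !exprD mulrA [ltRHS]mulrAC.
rewrite ltr_pM2l ?mulr_gt0 ?exprn_gt0//.
by rewrite ltrXn2r// ?(ltW th0)// subn_eq0 -ltnNge.
Qed.

(** With equal numbers of x-coordinates the powers of the weight cancel: the minor of [f] is at
    least as large as that of [f'], whatever the weight. *)
Lemma optimal_same th th' f f' : 0 < th -> 0 < th' ->
  optimal th f -> optimal th' f' -> xdim f = xdim f' -> optimal th' f.
Proof.
move=> th0 th'0 fo fo' af g; apply: le_trans (fo' g) _.
have := fo f'; rewrite /score af ler_pM2r ?exprn_gt0// => h.
by rewrite ler_wpM2r// exprn_ge0// ltW.
Qed.

Lemma optimal_dominates th f (v : 'rV[R]_(m + n)) i : 0 < th -> optimal th f ->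
  (v <= B)%MS ->
  `|v 0 i| * (if (i < m)%N then th else 1) <=
    \sum_j `|v 0 (f j)| * (if (f j < m)%N then th else 1).
Proof.
move=> th0 fo vB; apply: (@minor_dominates _ _ _ B f (fun i => if (i < m)%N then th else 1)) => //.
- by move=> k; case: ifP.
- exact: optimal_neq0 fo.
move=> f'; have := fo f'; rewrite /score /xdim.
by rewrite -2!prodr_const -!big_mkcond.
Qed.

Lemma xdim_le f : minor B f != 0 -> (xdim f <= m)%N /\ (r - xdim f <= n)%N.
Proof.
move=> f0; have fI := minor_inj f0; split.
  rewrite /xdim -(card_imset _ fI) -[leqRHS]card_ord.
  rewrite -(card_imset _ (@lshift_inj m n)); apply: subset_leq_card.
  apply/fintype.subsetP => i /imsetP[j /= jm ->]; apply/imsetP; exists (Ordinal jm) => //.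
  exact: val_inj.
have -> : (r - xdim f = #|[pred j | ~~ (f j < m)%N]|)%N.
  rewrite -[X in (X - _)%N](card_ord r) -(cardC [pred j | (f j < m)%N]) addKn.
  by apply: eq_card => j; rewrite !inE.
rewrite -(card_imset _ fI) -[leqRHS]card_ord.
rewrite -(card_imset _ (@rshift_inj m n)); apply: subset_leq_card.
apply/fintype.subsetP => i /imsetP[j /=]; rewrite inE -leqNgt => jm ->.
have jn : (f j - m < n)%N by rewrite ltn_subLR.
apply/imsetP; exists (Ordinal jn) => //.
by apply: val_inj => /=; rewrite subnKC.
Qed.

End Types.

(** * Spans of sets of vectors, represented by canonical matrices *)

Section Span.
Context (R : realType) (d : nat).
Implicit Types (S : set 'rV[R]_d).

(** A maximal free family of elements of [S] itself. For the lattice vectors of a box this keeps the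
    basis inside the box. *)
Lemma span_basis S : exists r (B : 'M[R]_(r, d)),
  [/\ row_free B, forall i, S (row i B) & forall v, S v -> (v <= B)%MS].
Proof.
pose P r := `[< exists B : 'M[R]_(r, d), row_free B /\ forall i, S (row i B) >].
have P0 : exists r, P r.
  exists 0%N; apply/asboolP; exists 0; split; last by case.
  by rewrite /row_free mxrank0.
have Pd r : P r -> (r <= d)%N.
  by move=> /asboolP[B [Bf _]]; rewrite -(eqP Bf) rank_leq_col.
case: (ex_maxnP P0 Pd) => r /asboolP[B [Bf SB]] rmax; exists r, B; split=> // v Sv.
apply: contrapT => /negP vB; have := rmax (1 + r)%N; rewrite ltnn.
apply/implyP; apply/asboolP; exists (col_mx v B); split; last first.
  move=> i; case: (split_ordP i) => k ->.
    by rewrite rowKu ord1 row_id.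
  by rewrite rowKd.
apply: inj_row_free => x; rewrite -[x]hsubmxK mul_row_col => /eqP.
rewrite addr_eq0 [lsubmx x]mx11_scalar mul_scalar_mx.
have [-> |a0] := eqVneq (lsubmx x 0 0) 0.
  rewrite scale0r -mulNmx eq_sym => /eqP xB.
  have : - rsubmx x *m B = 0 *m B by rewrite mul0mx.
  move/(row_free_inj Bf)/eqP; rewrite oppr_eq0 => /eqP ->.
  by rewrite raddf0 row_mx0.
move=> /eqP av; case/negP: vB; rewrite -(eqmx_scale v a0) av -mulNmx.
exact: submxMl.
Qed.

Lemma span_mx_subproof S : exists V : 'M[R]_d, <<V>>%MS = V /\
  exists r (B : 'M[R]_(r, d)), [/\ row_free B, forall i, S (row i B),
    forall v, S v -> (v <= B)%MS & (B :=: V)%MS].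
Proof.
have [r [B [Bf SB BS]]] := span_basis S.
by exists <<B>>%MS; split; [rewrite genmx_id|exists r, B; split=> //; exact/eqmx_sym/genmxE].
Qed.

(** Normalised by [genmx], so that equal spans are equal matrices: selections of coordinates depend
    on the matrix through the type ['I_(\rank V)] and through [row_base V]. *)
Definition span_mx S : 'M[R]_d := sval (cid (span_mx_subproof S)).

Lemma span_mx_basis S : exists B : 'M[R]_(\rank (span_mx S), d),
  [/\ row_free B, forall i, S (row i B) & (B :=: span_mx S)%MS].
Proof.
rewrite /span_mx; case: cid => V [_ [r [B [Bf SB BS BV]]]] /=.
have rE : r = \rank V by rewrite -BV (eqP Bf).
by rewrite -rE; exists B.
Qed.

Lemma sub_span_mx S v : S v -> (v <= span_mx S)%MS.
Proof.
by rewrite /span_mx; case: cid => V [_ [r [B [Bf SB BS <-]]]] /=; exact: BS.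
Qed.

Lemma span_mx_sub S p (W : 'M[R]_(p, d)) :
  (forall v, S v -> (v <= W)%MS) -> (span_mx S <= W)%MS.
Proof.
move=> SW; have [B [_ SB <-]] := span_mx_basis S.
by apply/row_subP => i; exact/SW/SB.
Qed.

Lemma span_mx_le S S' : S `<=` S' -> (span_mx S <= span_mx S')%MS.
Proof. by move=> SS'; apply: span_mx_sub => v /SS'; exact: sub_span_mx. Qed.

Lemma span_mx_eq S S' : (span_mx S :=: span_mx S')%MS -> span_mx S = span_mx S'.
Proof.
have idg T : <<span_mx T>>%MS = span_mx T by rewrite /span_mx; case: cid => V [].
by move=> /eqmxP/genmxP; rewrite !idg.
Qed.

Lemma span_mx_rank_eq S S' : S `<=` S' ->
  \rank (span_mx S) = \rank (span_mx S') -> span_mx S = span_mx S'.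
Proof.
move=> SS' rE; apply/span_mx_eq/eqmxP; rewrite -mxrank_leqif_eq ?rE//.
exact: span_mx_le.
Qed.

End Span.

(** * Lattice points in boxes *)

Lemma cV_norm_le (R : realType) k (x : 'cV[R]_k) (l : R) :
  `|x| <= l <-> 0 <= l /\ forall i, `|x i 0| <= l.
Proof.
rewrite {1}/Num.norm/= mx_normrE; split=> [xl|[l0 xl]].
  split=> [|i]; first by apply: le_trans xl; exact: bigmax_ge_id.
  by apply: le_trans xl; exact: (le_bigmax _ (fun ij : 'I_k * 'I_1 => `|x ij.1 ij.2|) (i, 0)).
by apply: bigmax_le => // -[i j] _ /=; rewrite ord1.
Qed.

Lemma sum_le_const (R : realType) (I : finType) (F : I -> R) (c : R) :
  (forall i, F i <= c) -> \sum_i F i <= #|I|%:R * c.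
Proof.
move=> Fc; apply: (@le_trans _ _ (\sum_(i : I) c)); first by apply: ler_sum.
by rewrite sumr_const mulr_natl.
Qed.

Section Lattice.
Context (R : realType) (m n : nat) (A : 'M[R]_(m, n)).
Implicit Types (z : 'cV[int]_(m + n)) (s u tau : R).

Definition latv z : 'rV[R]_(m + n) := (unipotent_mx A *m int_vec R z)^T.

Lemma int_vecD k (z z' : 'cV[int]_k) : int_vec R (z + z') = int_vec R z + int_vec R z'.
Proof. by rewrite /int_vec raddfD. Qed.

Lemma int_vecZ k a (z : 'cV[int]_k) : int_vec R (a *: z) = a%:~R *: int_vec R z.
Proof. by apply/matrixP => i j; rewrite !mxE intrM. Qed.

Lemma latvD z z' : latv (z + z') = latv z + latv z'.
Proof. by rewrite /latv int_vecD mulmxDr linearD. Qed.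

Lemma latvZ a z : latv (a *: z) = a%:~R *: latv z.
Proof. by rewrite /latv int_vecZ -scalemxAr linearZ. Qed.

Lemma latv0 : latv 0 = 0.
Proof. by rewrite -(scale0r (0 : 'cV[int]_(m + n))) latvZ scale0r. Qed.

Lemma latvB z z' : latv (z - z') = latv z - latv z'.
Proof. by rewrite latvD -scaleN1r latvZ scaleN1r. Qed.

Lemma latv_sum k (a : 'I_k -> int) (z : 'I_k -> 'cV[int]_(m + n)) :
  latv (\sum_j a j *: z j) = \sum_j (a j)%:~R *: latv (z j).
Proof.
rewrite (big_morph latv latvD latv0); apply: eq_bigr => j _; exact: latvZ.
Qed.

Lemma unipotent_unit : unipotent_mx A \in unitmx.
Proof. by rewrite unitmxE det_ublock !det1 mulr1 unitr1. Qed.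

Lemma latv_eq0 z : latv z = 0 -> z = 0.
Proof.
move=> /(congr1 trmx); rewrite trmxK trmx0 => z0.
have : int_vec R z = 0 by rewrite -[int_vec R z](mulKmx unipotent_unit) z0 mulmx0.
move=> /matrixP zi; apply/matrixP => i j; apply/eqP.
by have := zi i j; rewrite !mxE => /eqP; rewrite intr_eq0.
Qed.

Lemma latv_box_finite (w : 'I_(m + n) -> R) :
  finite_set [set z | forall i, `|latv z 0 i| <= w i].
Proof.
pose b := \sum_i \sum_j (`|invmx (unipotent_mx A) i j| * `|w j|).
pose N := `|Num.floor b|%N.
have zN z i : (forall i, `|latv z 0 i| <= w i) -> `|z i 0| <= N%:Z.
  move=> zw; have zE : int_vec R z = invmx (unipotent_mx A) *m (latv z)^T.
    by rewrite /latv trmxK mulKmx// unipotent_unit.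
  have b0 : 0 <= b by do 2 (apply: sumr_ge0 => ? _); rewrite mulr_ge0.
  have zb : `|z i 0|%:~R <= b.
    rewrite intr_norm; have -> : (z i 0)%:~R = int_vec R z i 0 by rewrite mxE.
    rewrite zE mxE; apply: le_trans (ler_norm_sum _ _ _) _.
    rewrite /b [leRHS](bigD1 i)//=.
    apply: (@le_trans _ _ (\sum_j `|invmx (unipotent_mx A) i j| * `|w j|)).
      apply: ler_sum => j _; rewrite normrM ler_wpM2l// mxE.
      by apply: le_trans (zw j) (ler_norm _).
    by rewrite lerDl; do 2 (apply: sumr_ge0 => ? _); rewrite mulr_ge0.
  by rewrite /N gez0_abs ?floor_ge0// floor_ge_int.
pose F (g : {ffun 'I_(m + n) -> 'I_(N + N).+1}) : 'cV[int]_(m + n) :=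
  \col_i ((g i)%:Z - N%:Z).
apply: (@sub_finite_set _ _ (F @` setT)); last exact/finite_image/finite_finset.
move=> z zw /=.
exists [ffun i => inord (absz (z i 0 + N%:Z))] => //.
apply/matrixP => i j; rewrite !mxE ffunE (ord1 j); have := zN z i zw.
rewrite ler_norml => /andP[z1 z2].
rewrite inordK; last by lia.
by lia.
Qed.

(* Logarithmic coordinates: s stands for log T, and the box with u = 0 is
   |x| <= T^(-tau), |y| <= T. *)
Definition wt tau s u (i : 'I_(m + n)) : R :=
  expR (u + if (i < m)%N then - (tau * s) else s).

Lemma wt_gt0 tau s u i : 0 < wt tau s u i. Proof. exact: expR_gt0. Qed.

Definition inbox tau s u : set 'cV[int]_(m + n) :=
  [set z | forall i, `|latv z 0 i| <= wt tau s u i].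

Lemma inbox_finite tau s u : finite_set (inbox tau s u).
Proof. exact: latv_box_finite. Qed.

Lemma inbox_gt0 tau s u : (0 < ncard (inbox tau s u))%N.
Proof.
apply: (@ncard_gt0 _ _ 0); first exact: inbox_finite.
by move=> i; rewrite latv0 mxE normr0 ltW// wt_gt0.
Qed.

(** Moving in time costs at most [(1 + tau) * |s' - s|] in [u], and moving the exponent costs
    [|(tau' - tau) * s'|]. Every comparison of spans at different times or exponents pays this
    price. *)
Lemma inbox_mono tau tau' s s' u u' : 0 <= tau -> 
  u + (1 + tau) * `|s' - s| + `|(tau' - tau) * s'| <= u' ->
  inbox tau s u `<=` inbox tau' s' u'.
Proof.
move=> tau0 h z zw i; apply: le_trans (zw i) _; rewrite /wt ler_expR.
have a0 : 0 <= `|s' - s| by [].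
have h1 := ler_norm (s' - s); have := ler_norm (- (s' - s)); rewrite normrN => h2.
have h3 := ler_norm ((tau' - tau) * s').
have h4 : tau * (s' - s) <= tau * `|s' - s| by rewrite ler_wpM2l.
have h5 := normr_ge0 ((tau' - tau) * s').
have h6 : 0 <= tau * `|s' - s| by rewrite mulr_ge0.
by case: ifP => _; nra.
Qed.

Definition Vsp tau s u : 'M[R]_(m + n) := span_mx (latv @` inbox tau s u).

Lemma inbox_Vsp tau s u z : inbox tau s u z -> (latv z <= Vsp tau s u)%MS.
Proof. by move=> zB; apply: sub_span_mx; exists z. Qed.

Lemma Vsp_sub tau s u p (W : 'M[R]_(p, m + n)) :
  (forall z, inbox tau s u z -> (latv z <= W)%MS) -> (Vsp tau s u <= W)%MS.
Proof. by move=> H; apply: span_mx_sub => _ [z zB <-]; exact: H. Qed.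

Lemma Vsp_le tau tau' s s' u u' : inbox tau s u `<=` inbox tau' s' u' ->
  (Vsp tau s u <= Vsp tau' s' u')%MS.
Proof. by move=> H; apply: Vsp_sub => z /H; exact: inbox_Vsp. Qed.

Lemma Vsp_anti tau tau' s s' u u' : (Vsp tau s u <= Vsp tau' s' u')%MS ->
  (Vsp tau' s' u' <= Vsp tau s u)%MS -> Vsp tau s u = Vsp tau' s' u'.
Proof. by move=> h1 h2; apply: span_mx_eq; apply/eqmxP/andP. Qed.

(** The coefficients of [v] in a basis taken from the box are rounded down; each of the at most
    [m + n] basis vectors contributes an error of at most one box. *)
Lemma spread_box tau s u (v : 'rV[R]_(m + n)) : (v <= Vsp tau s u)%MS ->
  exists2 z, (latv z <= Vsp tau s u)%MS &
    forall i, `|latv z 0 i - v 0 i| <= (m + n)%:R * wt tau s u i.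
Proof.
have [B [_ SB BV]] := span_mx_basis (latv @` inbox tau s u).
rewrite -/(Vsp tau s u) in B SB BV *; rewrite -{1}BV => /submxP[c vE].
have SB' i : exists z, inbox tau s u z /\ latv z = row i B.
  by have [z zB <-] := SB i; exists z.
pose zz i := sval (cid (SB' i)).
have zzB i : inbox tau s u (zz i) by rewrite /zz; case: cid => ? [].
have zzE i : latv (zz i) = row i B by rewrite /zz; case: cid => ? [].
exists (\sum_i Num.floor (c 0 i) *: zz i).
  by rewrite latv_sum; apply: summx_sub => j _; exact/scalemx_sub/inbox_Vsp.
move=> i; rewrite latv_sum vE summxE mxE -sumrB.
apply: le_trans (ler_norm_sum _ _ _) _.
have rd : (\rank (Vsp tau s u))%:R <= (m + n)%:R :> R by rewrite ler_nat rank_leq_col.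
apply: (@le_trans _ _ ((\rank (Vsp tau s u))%:R * wt tau s u i)); last first.
  by rewrite ler_wpM2r// ltW// wt_gt0.
rewrite -[in leRHS](card_ord (\rank _)); apply: sum_le_const => j.
have -> : B j i = latv (zz j) 0 i by rewrite zzE mxE.
rewrite mxE -mulrBl normrM -[leRHS]mul1r; apply: ler_pM => //; last exact: zzB.
have /andP[h1] := floor_itv (c 0 j); rewrite intrD => /ltW h2.
by rewrite ler_norml; apply/andP; split; lra.
Qed.

Section SubspaceCount.
Context (V : 'M[R]_(m + n)) (f : {ffun 'I_(\rank V) -> 'I_(m + n)}).
Hypothesis f0 : minor (row_base V) f != 0.

Let G : set 'cV[int]_(m + n) := [set z | (latv z <= V)%MS].
Let Y (j : 'I_(\rank V)) z := latv z 0 (f j).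

Let GB z z' : G z -> G z' -> G (z - z').
Proof. by rewrite /G /= latvB => h h'; rewrite addmx_sub// eqmx_opp. Qed.

Let YB j z z' : Y j (z - z') = Y j z - Y j z'.
Proof. by rewrite /Y latvB !mxE. Qed.

Let finGY w : finite_set (cbox G Y w).
Proof.
pose b i := \sum_j (w j * `|minor (row_base V) (replace f j i) / minor (row_base V) f|).
apply: sub_finite_set (latv_box_finite b) => z [Gz zw] i.
have zV : (latv z <= row_base V)%MS by rewrite eq_row_base.
rewrite (minor_cramer i f0 zV); apply: le_trans (ler_norm_sum _ _ _) _.
by apply: ler_sum => j _; rewrite normrM ler_wpM2r//; exact: zw.
Qed.

(** Only the coordinates selected by [f] are constrained; on [V] they determine the others. *)
Definition cnt w := ncard (cbox G Y w).

Lemma cnt_compare D w w' : 1 <= D -> (forall j, 0 < w j) -> (forall j, 0 < w' j) ->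
  (forall v : 'rV_(m + n), (v <= V)%MS -> exists2 z, (latv z <= V)%MS &
     forall j, `|latv z 0 (f j) - v 0 (f j)| <= D * w' j) ->
  (cnt w')%:R <= compare_const (\rank V) D * \prod_j (w' j / w j) * (cnt w)%:R.
Proof.
move=> D1 w0 w'0 sp; apply: cbox_compare => // x.
have [v] := minor_coord x f0; rewrite eq_row_base => vV vx.
have [z zV zv] := sp v vV; exists z => // j; rewrite -vx; exact: zv.
Qed.

Lemma cnt_scale c w : (forall j, 0 < w j) -> 0 <= c ->
  (cnt (fun j => c * w j))%:R <= (2 * c + 1) ^+ (\rank V) * (cnt w)%:R :> R.
Proof. by move=> w0 c0; apply: cbox_scale. Qed.

Lemma cnt_ge (S : set 'cV[int]_(m + n)) w :
  (forall z, S z -> (latv z <= V)%MS /\ forall j, `|latv z 0 (f j)| <= w j) ->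
  (ncard S <= cnt w)%N.
Proof. by move=> Sw; apply: ncard_le. Qed.

Lemma cnt_le (S : set 'cV[int]_(m + n)) w : finite_set S ->
  (forall z, (latv z <= V)%MS -> (forall j, `|latv z 0 (f j)| <= w j) -> S z) ->
  (cnt w <= ncard S)%N.
Proof. by move=> finS Sw; apply: ncard_le => // z [zV zw]; apply: Sw. Qed.

End SubspaceCount.

(** Ratio of the y-width to the x-width of the box: weighting the x-coordinates by it turns the box
    into a cube. *)
Definition theta tau s : R := expR ((1 + tau) * s).

Lemma theta_gt0 tau s : 0 < theta tau s. Proof. exact: expR_gt0. Qed.

Lemma wt_theta tau s u i :
  wt tau s u i * (if (i < m)%N then theta tau s else 1) = expR (u + s).
Proof.
rewrite /wt /theta; case: ifP => _; last by rewrite mulr1.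
by rewrite -expRD; congr expR; ring.
Qed.

(** In the weighted coordinates all widths are equal, and each coordinate is at most the sum of the
    at most [m + n] selected ones. *)
Lemma dominated_coords tau s u (V : 'M[R]_(m + n)) (f : {ffun 'I_(\rank V) -> 'I_(m + n)})
    (v : 'rV[R]_(m + n)) c : optimal (row_base V) (theta tau s) f ->
  (v <= V)%MS -> 0 <= c -> (forall j, `|v 0 (f j)| <= c * wt tau s u (f j)) ->
  forall i, `|v 0 i| <= (m + n)%:R * c * wt tau s u i.
Proof.
move=> fo vV c0 vf i; have t0 := theta_gt0 tau s.
pose om (i : 'I_(m + n)) := if (i < m)%N then theta tau s else 1.
have om0 k : 0 < om k by rewrite /om; case: ifP.
rewrite -(ler_pM2r (om0 i)); apply: (@le_trans _ _ (\sum_j `|v 0 (f j)| * om (f j))).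
  by apply: optimal_dominates => //; rewrite ?row_base_free ?eq_row_base.
apply: (@le_trans _ _ (\sum_(j < \rank V) c * expR (u + s))).
  apply: ler_sum => j _; rewrite -(wt_theta tau s u (f j)) -/(om _) mulrA.
  by rewrite ler_pM2r//; exact: vf.
rewrite sumr_const card_ord -[leLHS]mulr_natl -!mulrA -/(om i) wt_theta.
by rewrite ler_wpM2r ?mulr_ge0 ?expR_ge0// ler_nat rank_leq_col.
Qed.

(** A sum over all ranks, to have a single constant above each of them. *)
Definition count_const : R :=
  \sum_(r < (m + n).+1)
    compare_const r (m + n).+1%:R * (2 * (m + n).+1%:R + 1) ^+ r.

Lemma compare_const_gt0 r (D : R) : 1 <= D -> 0 < compare_const r D.
Proof.
by move=> D1; rewrite /compare_const !(mulr_gt0, exprn_gt0)//; lra.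
Qed.

Lemma count_const_ge r : (r <= m + n)%N ->
  compare_const r (m + n).+1%:R * (2 * (m + n).+1%:R + 1) ^+ r <= count_const.
Proof.
move=> rd; rewrite /count_const (bigD1 (Ordinal (rd : (r < (m + n).+1)%N)))//= lerDl.
apply: sumr_ge0 => j _; rewrite mulr_ge0 ?exprn_ge0//.
by rewrite ltW// compare_const_gt0// ler1n.
Qed.

Lemma count_const_ge1 : 1 <= count_const.
Proof.
apply: le_trans (count_const_ge (leq0n _)).
by rewrite expr0 mulr1 /compare_const !expr0 mulr1.
Qed.

(** The points of the box at [(s', u')] are counted by their selected coordinates, and that count
    changes by at most a constant times the ratio of volumes. Since [f] is optimal at time [s],
    bounds on the selected coordinates alone then give back points of the box at [(s, u)]. Thus the
    span is taken at [s'] and optimality at [s]. *)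
Lemma slope_count tau s u s' u' (f : {ffun 'I_(\rank (Vsp tau s' u')) -> 'I_(m + n)}) :
  optimal (row_base (Vsp tau s' u')) (theta tau s) f ->
  (ncard (inbox tau s' u'))%:R <= count_const *
    expR ((xdim f)%:R * ((u' - tau * s') - (u - tau * s)) +
          (\rank (Vsp tau s' u') - xdim f)%:R * ((u' + s') - (u + s))) *
    (ncard (inbox tau s u))%:R.
Proof.
move=> fo; set V := Vsp tau s' u' in f fo *.
have f0 : minor (row_base V) f != 0.
  by apply: optimal_neq0 fo; rewrite ?row_base_free ?theta_gt0.
set D : R := (m + n).+1%:R; have D1 : 1 <= D by rewrite ler1n.
have D0 : 0 < D by exact: lt_le_trans D1.
pose w j := wt tau s u (f j); pose w' j := wt tau s' u' (f j).
have w0 j : 0 < w j by exact: wt_gt0.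
have w'0 j : 0 < w' j by exact: wt_gt0.
have h1 : (ncard (inbox tau s' u'))%:R <= (cnt f w')%:R :> R.
  rewrite ler_nat; apply: cnt_ge => // z zB; split; first exact: inbox_Vsp.
  by move=> j; exact: zB.
have h2 := @cnt_compare V f f0 D w w' D1 w0 w'0.
have {}h2 : (cnt f w')%:R <= compare_const (\rank V) D * \prod_j (w' j / w j) * (cnt f w)%:R.
  apply: h2 => v /spread_box[z zV zv]; exists z => // j.
  apply: (le_trans (zv (f j))); rewrite -/(w' j) ler_pM2r//.
  by rewrite ler_nat.
have h3 : (cnt f w)%:R <= (2 * D + 1) ^+ (\rank V) * (ncard (inbox tau s u))%:R :> R.
  have -> : w = (fun j => D * (w j / D)).
    by apply/funext => j; rewrite mulrC divfK// gt_eqF.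
  apply: (le_trans (cnt_scale f0 _ (ltW D0))) => [j|]; first by rewrite divr_gt0.
  rewrite ler_wpM2l ?exprn_ge0//; first lra.
  rewrite ler_nat; apply: cnt_le => //; first exact: inbox_finite.
  move=> z zV zw i.
  have := @dominated_coords tau s u V f (latv z) D^-1 fo zV.
  rewrite invr_ge0 (ltW D0) => /(_ isT) /(_ _ i) H.
  apply: le_trans (H _) _; first by move=> j; rewrite mulrC; exact: zw.
  by rewrite ler_piMl ?(ltW (wt_gt0 _ _ _ _))// ler_pdivrMr// mul1r ler_nat.
have pE : \prod_j (w' j / w j) = expR ((xdim f)%:R * ((u' - tau * s') - (u - tau * s)) +
          (\rank V - xdim f)%:R * ((u' + s') - (u + s))).
  transitivity (\prod_j expR (if (f j < m)%N then (u' - tau * s') - (u - tau * s)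
                              else (u' + s') - (u + s))).
    by apply: eq_bigr => j _; rewrite /w /w' /wt -expRB; case: ifP.
  rewrite -expR_sum; congr expR; rewrite big_if !sumr_const /= !mulr_natl.
  congr (_ *+ _ + _ *+ _).
  rewrite -[X in (X - _)%N](card_ord (\rank V)) -(cardC [pred j | (f j < m)%N]).
  by rewrite addKn; apply: eq_card => j; rewrite !inE.
have : 0 <= \prod_j (w' j / w j) by rewrite pE expR_ge0.
rewrite -pE; set P := \prod_j _ in h2 * => P0.
apply: (le_trans h1); apply: (le_trans h2).
apply: (@le_trans _ _ (compare_const (\rank V) D * P *
  ((2 * D + 1) ^+ (\rank V) * (ncard (inbox tau s u))%:R))).
  by rewrite ler_wpM2l// mulr_ge0// ltW// compare_const_gt0.
rewrite mulrACA.
rewrite -[leRHS]mulrA ler_wpM2r ?mulr_ge0//; apply: count_const_ge.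
exact: rank_leq_col.
Qed.

End Lattice.

(** * Successive minima and lattice point counts *)

Section Minima.
Context (R : realType) (m n : nat) (A : 'M[R]_(m, n)).
Hypotheses (hm : (0 < m)%N) (hn : (0 < n)%N).
Implicit Types (z : 'cV[int]_(m + n)) (s u tau : R).

Lemma latv_r z j : latv A z 0 (rshift m j) = (dsubmx z j 0)%:~R.
Proof.
rewrite /latv mxE -[z in LHS]vsubmxK /int_vec map_col_mx mul_block_col.
by rewrite col_mxEd mul0mx add0r mul1mx !mxE.
Qed.

Lemma latv_l z i :
  latv A z 0 (lshift n i) = (usubmx z i 0)%:~R + (A *m int_vec R (dsubmx z)) i 0.
Proof.
rewrite /latv mxE -[z in LHS]vsubmxK /int_vec map_col_mx mul_block_col.
by rewrite col_mxEu mul1mx [in LHS]mxE; congr (_ + _); rewrite !mxE.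
Qed.

(** Open boxes: both [small_minima_count] and an infimum lying below a bound are strict conditions,
    so open boxes describe them exactly. *)
Definition obox tau s u : set 'cV[int]_(m + n) :=
  [set z | forall i, `|latv A z 0 i| < wt tau s u i].

Definition orank tau s u := \rank (span_mx (latv A @` obox tau s u)).

Lemma orank_le tau s u : (orank tau s u <= \rank (Vsp A tau s u))%N.
Proof.
apply/mxrankS/span_mx_le => _ [z zo <-]; exists z => // i; exact/ltW/zo.
Qed.

Lemma le_orank tau s u u' : u < u' -> (\rank (Vsp A tau s u) <= orank tau s u')%N.
Proof.
move=> uu'; apply/mxrankS/span_mx_le => _ [z zo <-]; exists z => // i.
by apply: le_lt_trans (zo i) _; rewrite /wt ltr_expR ltrD2r.
Qed.

(** With T = e^s, this time and the unit [flow_unit], equal to T^((n - m tau)/d), are those for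
    which the flow carries the box of [wt] to a cube. *)
Definition flow_time tau s : R := (m * n)%:R * (1 + tau) / (m + n)%:R * s.

Definition flow_unit tau s : R := expR ((n%:R - m%:R * tau) / (m + n)%:R * s).

Let e t (i : 'I_(m + n)) : R := if (i < m)%N then expR (t / m%:R) else expR (- t / n%:R).

Lemma flow_coord t (v : 'rV[R]_(m + n)) i : (flow_mx m n t *m v^T) i 0 = e t i * v 0 i.
Proof.
rewrite -[v]hsubmxK tr_row_mx /flow_mx mul_block_col !mul0mx addr0 add0r !mul_scalar_mx.
rewrite /e; case: (split_ordP i) => j ->.
  by rewrite col_mxEu row_mxEl !mxE.
by rewrite col_mxEd row_mxEr !mxE.
Qed.

Let flow_scale tau s i u : e (flow_time tau s) i * wt tau s u i = flow_unit tau s * expR u.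
Proof.
have m0 : m%:R != 0 :> R by rewrite pnatr_eq0 -lt0n.
have n0 : n%:R != 0 :> R by rewrite pnatr_eq0 -lt0n.
have d0 : m%:R + n%:R != 0 :> R by rewrite -natrD pnatr_eq0 -lt0n addn_gt0 hm.
rewrite /e /wt /flow_unit /flow_time natrM natrD.
by case: ifP => _; rewrite -!expRD; congr expR; field; rewrite ?m0 ?n0 ?d0.
Qed.

Let e_gt0 t i : 0 < e t i.
Proof. by rewrite /e; case: ifP => _; rewrite expR_gt0. Qed.

Lemma flow_lt tau s u z :
  `|flow_mx m n (flow_time tau s) *m (latv A z)^T| < flow_unit tau s * expR u
  <-> obox tau s u z.
Proof.
set v := _ *m _; set l := _ * _.
have l0 : 0 < l by rewrite mulr_gt0 ?expR_gt0.
have vi i : (`|v i 0| < l) = (`|latv A z 0 i| < wt tau s u i).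
  rewrite /v flow_coord normrM gtr0_norm ?e_gt0//.
  by rewrite /l -(flow_scale tau s i u) ltr_pM2l// e_gt0.
split=> [vl i|zo].
  rewrite -vi; apply: le_lt_trans vl.
  by have /cV_norm_le[_] := lexx `|v|.
have H : `|v| <= \big[Num.max/0]_i `|v i 0|.
  apply/cV_norm_le; split; first exact: bigmax_ge_id.
  by move=> i; apply: (le_bigmax _ (fun i => `|v i 0|)).
by apply: le_lt_trans H _; apply: bigmax_lt => // i _; rewrite vi.
Qed.

Lemma flow_unit_gt0 tau s : 0 < flow_unit tau s. Proof. exact: expR_gt0. Qed.

Let adm tau s (i : 'I_(m + n)) := [set l : R | 0 < l /\ exists X : i.+1.-tuple 'cV[R]_(m + n),
  free X /\ forall v, v \in X -> flow_lattice A (flow_time tau s) v /\ `|v| <= l].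

Let adm_ex tau s u (i : 'I_(m + n)) : (i < orank tau s u)%N ->
  exists2 l, adm tau s i l & l < flow_unit tau s * expR u.
Proof.
have [B [Bf SB _]] := span_mx_basis (latv A @` obox tau s u).
rewrite -/(orank tau s u) in B Bf SB * => ir.
set t := flow_time tau s; set lam := _ * expR u.
have lam0 : 0 < lam by rewrite mulr_gt0 ?expR_gt0.
pose w (k : 'I_i.+1) := widen_ord ir k.
pose X := [tuple flow_mx m n t *m (row (w k) B)^T | k < i.+1].
have XE (k : 'I_i.+1) : X`_k = flow_mx m n t *m (row (w k) B)^T by rewrite -tnth_nth tnth_mktuple.
have Xl (k : 'I_i.+1) : `|X`_k| < lam /\ flow_lattice A t X`_k.
  have [z zo zE] := SB (w k); rewrite XE -zE; split; first exact/flow_lt.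
  by exists z => //; rewrite /latv trmxK.
(* The default [lam / 2] makes [l] positive without exceeding [lam]. *)
pose l := \big[Num.max/lam / 2]_(k < i.+1) `|X`_k|.
have l0 : 0 < l by apply: lt_le_trans (bigmax_ge_id _ _ _ _); rewrite divr_gt0.
exists l; last first.
  apply: bigmax_lt => [|k _]; last by have [] := Xl k.
  by rewrite ltr_pdivrMr// mulr_natr mulr2n ltrDl.
split=> //; exists X; split; last first.
  move=> v /tnthP[k ->]; rewrite (tnth_nth 0); have [_ XL] := Xl k; split=> //.
  exact: (le_bigmax _ (fun k : 'I_i.+1 => `|X`_k|)).
apply/freeP => c c0 k.
have : (\row_j (if insub (j : nat) is Some k then c k else 0) : 'rV[R]_(orank tau s u)) *m B
     = 0 *m B.
  rewrite mul0mx; apply/rowP => a; rewrite [RHS]mxE.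
  have /matrixP/(_ a 0) := c0; rewrite summxE [RHS]mxE.
  under eq_bigr do rewrite mxE XE flow_coord mulrCA mxE.
  rewrite -mulr_sumr => /eqP; rewrite mulf_eq0 gt_eqF ?e_gt0//= => /eqP H.
  rewrite -{}[RHS]H mxE (bigID (fun j : 'I_(orank tau s u) => (j < i.+1)%N))/=.
  rewrite [X in _ + X]big1 ?addr0; last first.
    by move=> j ji; rewrite mxE insubF ?mul0r// (negbTE ji).
  rewrite (big_ord_narrow ir); apply: eq_bigr => j _ /=.
  by rewrite mxE valK.
move/(row_free_inj Bf)/rowP/(_ (w k)); rewrite !mxE /=.
by rewrite valK.
Qed.

(** Guarantees that the sets whose infima define the minima are nonempty. *)
Lemma orank_full tau s : exists u, orank tau s u = (m + n)%N.
Proof.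
pose D (k : 'I_(m + n)) : 'cV[int]_(m + n) := delta_mx k 0.
pose b := 1 + \sum_k \sum_i (`|latv A (D k) 0 i| / wt tau s 0 i).
have b0 : 0 < b.
  by rewrite ltr_pwDl// sumr_ge0// => k _; rewrite sumr_ge0// => i _; rewrite divr_ge0// ltW ?wt_gt0.
exists (ln b); apply/eqP; rewrite eqn_leq rank_leq_col /=.
have u1 : \rank (unipotent_mx A)^T = (m + n)%N.
  by rewrite mxrank_tr mxrank_unit// unipotent_unit.
rewrite -[leqLHS]u1; apply/mxrankS/row_subP => k.
have -> : row k (unipotent_mx A)^T = latv A (D k).
  by rewrite /latv /int_vec map_delta_mx -colE tr_col.
apply: sub_span_mx; exists (D k) => // i.
have w0 := wt_gt0 tau s 0 i.
rewrite (_ : wt tau s (ln b) i = wt tau s 0 i * b); last first.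
  by rewrite /wt add0r expRD lnK// mulrC.
rewrite mulrC -ltr_pdivrMr// /b -[ltLHS]add0r ltr_leD//.
rewrite (bigD1 k)//= (bigD1 i)//= -addrA lerDl addr_ge0//; apply: sumr_ge0 => j _.
  by rewrite divr_ge0// ltW ?wt_gt0.
by rewrite sumr_ge0// => l _; rewrite divr_ge0// ltW ?wt_gt0.
Qed.

(** The successive minima relative to the box itself instead of the cube that it becomes under the
    flow. *)
Definition rmin tau s (i : 'I_(m + n)) : R :=
  flow_minimum A (flow_time tau s) i / flow_unit tau s.

(** Turns every statement on minima into one on ranks. The index is zero-based, so [i < orank] means
    at least [i.+1] independent vectors. *)
Lemma rmin_lt tau s u i : (rmin tau s i < expR u) = (i < orank tau s u)%N.
Proof.
rewrite /rmin ltr_pdivrMr ?flow_unit_gt0// [ltRHS]mulrC.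
rewrite /flow_minimum /successive_minimum.
have hinf : has_inf (adm tau s i).
  split; last by exists 0 => l [/ltW].
  have [v vE] := orank_full tau s.
  by have [|l ? _] := @adm_ex tau s v i; [rewrite vE|exists l].
apply/idP/idP => [|io].
  move=> /(inf_lt (proj1 hinf))[l [l0 [X [/freeP Xf XL]]] ll].
  have Xk (k : 'I_i.+1) : exists2 z, obox tau s u z & X`_k = flow_mx m n (flow_time tau s) *m (latv A z)^T.
    have [[z _ zE] zl] := XL _ (mem_tnth k X); rewrite (tnth_nth 0) in zE zl.
    exists z; last by rewrite -zE /latv trmxK.
    apply/flow_lt; apply: le_lt_trans ll; rewrite /latv trmxK.
    by rewrite (_ : _ *m _ = X`_k).
  pose zz k := sval (cid2 (Xk k)).
  have zo k : obox tau s u (zz k) by rewrite /zz; case: cid2.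
  have zE (k : 'I_i.+1) : X`_k = flow_mx m n (flow_time tau s) *m (latv A (zz k))^T by rewrite /zz; case: cid2.
  pose M : 'M[R]_(i.+1, m + n) := \matrix_k latv A (zz k).
  suff Mf : row_free M.
    rewrite -(eqP Mf); apply: mxrankS; apply/row_subP => k; rewrite rowK.
    by apply: sub_span_mx; exists (zz k).
  apply: inj_row_free => c cM; apply/rowP => k; rewrite mxE.
  apply: (Xf (fun k => c 0 k)); apply/matrixP => a b; rewrite ord1 summxE mxE.
  under eq_bigr do rewrite mxE zE flow_coord mulrCA.
  rewrite -mulr_sumr; apply/eqP; rewrite mulf_eq0; apply/orP; right.
  have /rowP/(_ a) := cM; rewrite mxE [RHS]mxE => H; apply/eqP; rewrite -[RHS]H.
  by apply: eq_bigr => q _; congr (_ * _); rewrite /M [RHS]mxE.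
have [l al ll] := adm_ex io; apply: le_lt_trans ll.
by apply: ge_inf => //; case: hinf.
Qed.

(** The y-coordinates are integers of absolute value below 1, hence 0; then the x-coordinates are
    integers as well. *)
Lemma orank_small tau s u : (forall i : 'I_(m + n), wt tau s u i <= 1) -> orank tau s u = 0%N.
Proof.
move=> w1; apply/eqP; rewrite -leqn0.
have <- : \rank (0 : 'M[R]_(m + n)) = 0%N by rewrite mxrank0.
apply/mxrankS/span_mx_sub => _ [z zo <-].
have z1 i : `|latv A z 0 i| < 1 by apply: lt_le_trans (zo i) (w1 i).
suff -> : z = 0 by rewrite latv0 sub0mx.
have small (k : int) : `|k%:~R| < 1 :> R -> k = 0.
  by rewrite -intr_norm ltrz1 -[1]add0r ltzD1 normr_le0 => /eqP.
have zd : dsubmx z = 0.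
  by apply/matrixP => j k; rewrite [RHS]mxE ord1; apply: small; rewrite -latv_r.
have zu : usubmx z = 0.
  apply/matrixP => j k; rewrite [RHS]mxE ord1; apply: small.
  by have := z1 (lshift n j); rewrite latv_l zd /int_vec raddf0 mulmx0 [X in _ + X]mxE addr0.
by rewrite -[z]vsubmxK zd zu col_mx0.
Qed.

Lemma rmin_gt0 tau s i : 0 < rmin tau s i.
Proof.
pose u := - (`|tau * s| + `|s|).
have /eqP : orank tau s u = 0%N.
  apply: orank_small => j; rewrite /wt -expR0 ler_expR /u.
  have := ler_norm s; have := ler_norm (- (tau * s)); rewrite normrN.
  have := normr_ge0 s; have := normr_ge0 (tau * s); case: ifP; lra.
rewrite -leqn0 => o0; apply: lt_le_trans (expR_gt0 u) _.
by rewrite leNgt rmin_lt -leqNgt (leq_trans o0).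
Qed.

Lemma rmin_le tau s (i j : 'I_(m + n)) : (i <= j)%N -> rmin tau s i <= rmin tau s j.
Proof.
move=> ij; rewrite leNgt; apply/negP => ji.
have iE : rmin tau s i = expR (ln (rmin tau s i)) by rewrite lnK// posrE rmin_gt0.
have := ltxx (rmin tau s i); rewrite {2}iE rmin_lt.
by move: ji; rewrite {1}iE rmin_lt => /(leq_ltn_trans ij) ->.
Qed.

Lemma ncard_inbox_le tau s u u' : u <= u' ->
  (ncard (inbox A tau s u) <= ncard (inbox A tau s u'))%N.
Proof.
move=> uu'; apply: ncard_le; first exact: inbox_finite.
by move=> z zu i; apply: le_trans (zu i) _; rewrite /wt ler_expR lerD2r.
Qed.

(** At a fixed time all widths scale by the same factor, so the split of the rank into x- and
    y-coordinates disappears from the exponent. *)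
Lemma rank_count tau s u u' : (ncard (inbox A tau s u'))%:R <=
  count_const R m n * expR ((\rank (Vsp A tau s u'))%:R * (u' - u)) *
  (ncard (inbox A tau s u))%:R.
Proof.
have [f fo] := optimal_exists (row_base_free (Vsp A tau s u')) (theta tau s).
have fr : (xdim f <= \rank (Vsp A tau s u'))%N.
  by rewrite -[leqRHS]card_ord; exact: max_card.
have H := @slope_count R m n A tau s u s u' f fo.
apply: (le_trans H); rewrite le_eqVlt; apply/orP; left; apply/eqP.
congr (_ * expR _ * _); rewrite natrB//; ring.
Qed.

Definition minima_prod tau s : R := \prod_i Num.max (rmin tau s i)^-1 1.

(** One induction step below uses [rank_count] at most twice, and its unit shifts of [u] cost at
    most [2 * (m + n)] in the exponent. *)
Definition minima_const := count_const R m n ^+ 2 * expR (2 * (m + n)%:R).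

Let c1 : 1 <= count_const R m n. Proof. exact: count_const_ge1. Qed.

Lemma minima_const_ge1 : 1 <= minima_const.
Proof.
rewrite /minima_const -[1]mulr1; apply: ler_pM => //; first by rewrite exprn_ege1.
by rewrite -expR0 ler_expR mulr_ge0.
Qed.

Let M tau s u (j : 'I_(m + n)) := Num.max (expR u / rmin tau s j) 1.

Let Mge tau s u j : expR u / rmin tau s j <= M tau s u j.
Proof. by rewrite le_max lexx. Qed.

Lemma card_ltn_ord k d : (k <= d)%N -> #|[pred i : 'I_d | (i < k)%N]| = k.
Proof.
move=> kd; rewrite -sum1_card (eq_bigl (fun i : 'I_d => (i < k)%N))//.
by rewrite (big_ord_narrow kd) sum1_card card_ord.
Qed.

(** Takes the place of Minkowski's second theorem. Let [expR a] be the last of the [i.+1] minima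
    considered: below [a] the count is known by induction, and above [a] it grows with exponent
    [i.+1] by [rank_count]. *)
Lemma count_minima_step K tau s k u : 1 <= K -> minima_const <= K -> (k <= m + n)%N ->
  (forall j : 'I_(m + n), (k <= j)%N -> expR u < rmin tau s j) ->
  (ncard (inbox A tau s u))%:R <= K ^+ k * \prod_(j < m + n | (j < k)%N) M tau s u j /\
  \prod_(j < m + n | (j < k)%N) M tau s u j <= K ^+ k * (ncard (inbox A tau s u))%:R.
Proof.
move=> K1 KK; elim: k u => [|i IH] u kd uk.
  rewrite !expr0 !mul1r big_pred0//.
  have o0 : \rank (Vsp A tau s u) = 0%N.
    apply/eqP; rewrite -leqn0 leqNgt; apply/negP => r0.
    have d0 : (0 < m + n)%N by rewrite addn_gt0 hm.
    have := uk (Ordinal d0) (leq0n _); rewrite ltNge => /negP; apply.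
    rewrite -[rmin _ _ _]lnK ?posrE ?rmin_gt0// ler_expR leNgt; apply/negP => uln.
    have := le_orank tau s uln; rewrite leqNgt => /negP; apply.
    apply: leq_trans r0; rewrite ltnS leqn0 -leqn0 leqNgt.
    have := rmin_lt tau s (ln (rmin tau s (Ordinal d0))) (Ordinal d0) => /= <-.
    by rewrite lnK ?posrE ?rmin_gt0// ltxx.
  suff -> : ncard (inbox A tau s u) = 1%N by [].
  apply/eqP; rewrite eqn_leq inbox_gt0 andbT.
  apply: (@leq_trans (ncard [set 0 : 'cV[int]_(m + n)])); last by rewrite /ncard fset_set1 cardfs1.
  apply: ncard_le => // z /inbox_Vsp; move/eqP: o0; rewrite mxrank_eq0 => /eqP ->.
  by rewrite submx0 => /eqP/latv_eq0.
pose jj := Ordinal kd; pose a := ln (rmin tau s jj).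
have aE : expR a = rmin tau s jj by rewrite lnK// posrE rmin_gt0.
have M0 v j : 0 <= M tau s v j by rewrite le_max ler01 orbT.
have M1 v j : 1 <= M tau s v j by rewrite le_max lexx orbT.
have prodS v : \prod_(j < m + n | (j < i.+1)%N) M tau s v j =
    M tau s v jj * \prod_(j < m + n | (j < i)%N) M tau s v j.
  rewrite (bigD1 jj)//=; congr (_ * _); apply: eq_bigl => j.
  by rewrite -val_eqE /= ltnS ltn_neqAle andbC.
have [ua|au] := ltP u a.
  have [|h1 h2] := IH u (ltnW kd).
    move=> j; rewrite leq_eqVlt => /orP[/eqP ij|]; last exact: uk.
    by rewrite (_ : j = jj) -?aE ?ltr_expR//; exact: val_inj.
  have MJ : M tau s u jj = 1.
    by rewrite /M; apply/max_idPr; rewrite -aE -expRB -expR0 ler_expR; lra.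
  rewrite prodS MJ mul1r exprS; split; [apply: le_trans h1 _|apply: le_trans h2 _].
    by rewrite ler_wpM2r ?prodr_ge0// ler_peMl ?exprn_ge0 ?(le_trans ler01).
  by rewrite ler_wpM2r// ler_peMl ?exprn_ge0 ?(le_trans ler01).
(* [a - 1] lies strictly below the minimum of index [jj], so the induction hypothesis applies there;
   [a + 1] lies strictly above it, so the rank there is at least [i.+1]. *)
have [|h1 h2] := IH (a - 1) (ltnW kd).
  move=> j ij; apply: lt_le_trans (rmin_le tau s (i := jj) ij).
  by rewrite -aE ltr_expR; lra.
set N := fun v => (ncard (inbox A tau s v))%:R : R.
rewrite -/(N _) in h1 h2 *.
have N0 v : 0 <= N v by [].
have c0 : 0 <= count_const R m n by rewrite (le_trans ler01).
have dge j : (j <= m + n)%N -> j%:R <= (m + n)%:R :> R by rewrite ler_nat.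
pose P v := \prod_(j < m + n | (j < i)%N) (expR v / rmin tau s j).
have P0 v : 0 <= P v.
  by apply: prodr_ge0 => j _; rewrite divr_ge0 ?expR_ge0// ltW ?rmin_gt0.
have PD v x : P (v + x) = expR (i%:R * x) * P v.
  rewrite /P (eq_bigr (fun j => expR x * (expR v / rmin tau s j))); last first.
    by move=> j _; rewrite expRD [_ * expR x]mulrC mulrA.
  rewrite big_split /= prodr_const card_ltn_ord ?(ltnW kd)//.
  by rewrite -expRM_natl.
have Mlow : \prod_(j < m + n | (j < i)%N) M tau s (a - 1) j <= P a.
  apply: ler_prod => j ji; rewrite M0 /= /M ge_max.
  rewrite ler_pM2r ?invr_gt0 ?rmin_gt0// ler_expR; apply/andP; split; first lra.
  by rewrite ler_pdivlMr ?rmin_gt0// mul1r aE rmin_le// ltnW.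
have Mhigh v : P v <= \prod_(j < m + n | (j < i)%N) M tau s v j.
  apply: ler_prod => j ji; rewrite Mge andbT divr_ge0 ?expR_ge0//.
  by rewrite ltW ?rmin_gt0.
have PSE : \prod_(j < m + n | (j < i.+1)%N) M tau s u j = expR (i.+1%:R * (u - a)) * P a.
  rewrite prodS (_ : M tau s u jj = expR (u - a)); last first.
    by rewrite /M -aE -expRB; apply/max_idPl; rewrite -expR0 ler_expR; lra.
  rewrite (eq_bigr (fun j => expR u / rmin tau s j)) => [|j ji]; last first.
    rewrite /M; apply/max_idPl; rewrite ler_pdivlMr ?rmin_gt0// mul1r.
    by apply: (@le_trans _ _ (expR a)); rewrite ?ler_expR// aE rmin_le// ltnW.
  rewrite -/(P u) -{2}[u](subrKC a) PD mulrA -expRD; congr (expR _ * _).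
  by rewrite -natr1; ring.
rewrite PSE; set Q := P a in Mlow PSE *; have Q0 : 0 <= Q by exact: P0.
have rU : (\rank (Vsp A tau s u) <= i.+1)%N.
  rewrite leqNgt; apply/negP => r2.
  have id2 : (i.+1 < m + n)%N by apply: leq_trans r2 (rank_leq_col _).
  have := uk (Ordinal id2) (leqnn _); rewrite -[rmin _ _ _]lnK ?posrE ?rmin_gt0// ltr_expR.
  move=> /(le_orank tau s) /(leq_trans r2) ro.
  have := rmin_lt tau s (ln (rmin tau s (Ordinal id2))) (Ordinal id2).
  by rewrite /= ro lnK ?posrE ?rmin_gt0// ltxx.
have rA : (i.+1 <= \rank (Vsp A tau s (a + 1)))%N.
  apply: leq_trans (orank_le _ _ _); have := rmin_lt tau s (a + 1) jj => /= <-.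
  by rewrite -aE ltr_expR; lra.
have i1d : i.+1%:R <= (m + n)%:R :> R by rewrite ler_nat.
have i1E : i.+1%:R = i%:R + 1 :> R by rewrite natr1.
have i0 : 0 <= i%:R :> R by [].
have Ki0 : 0 <= K ^+ i by rewrite exprn_ge0// (le_trans ler01).
split.
  have := rank_count tau s (a - 1) u; rewrite -!/(N _) => hN; apply: (le_trans hN).
  apply: (@le_trans _ _ (count_const R m n * expR (i.+1%:R * (u - (a - 1))) * (K ^+ i * Q))).
    apply: ler_pM => //; first by rewrite mulr_ge0 ?expR_ge0.
      rewrite ler_wpM2l// ler_expR ler_wpM2r ?ler_nat//; lra.
    by apply: le_trans h1 _; rewrite ler_wpM2l.
  rewrite (_ : u - (a - 1) = (u - a) + 1); last by ring.
  rewrite mulrDr mulr1 expRD exprS.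
  rewrite [leLHS](_ : _ = (count_const R m n * expR i.+1%:R) * (K ^+ i * (expR (i.+1%:R * (u - a)) * Q)));
    last by move: (expR _) (expR _) (K ^+ i) (count_const R m n) => *; ring.
  rewrite -[leRHS]mulrA; apply: ler_wpM2r; first by rewrite !mulr_ge0 ?expR_ge0.
  apply: le_trans KK; rewrite /minima_const.
  apply: ler_pM => //; rewrite ?expR_ge0 ?ler_expR//; last lra.
  by rewrite -[leLHS]mulr1 expr2 ler_wpM2l.
have hA : Q <= expR i%:R * (K ^+ i * N (a - 1)).
  rewrite /Q -[a](subrK 1) PD mulr1 ler_wpM2l ?expR_ge0//.
  by rewrite addrK; apply: le_trans (Mhigh _) h2.
have hB : N (a - 1) <= N (a + 1) by rewrite ler_nat ncard_inbox_le//; lra.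
have hC : N (a + 1) <= count_const R m n * expR (- (i.+1%:R * (u - a))) * N (u + 1).
  apply: (le_trans (rank_count tau s (u + 1) (a + 1))); rewrite ler_wpM2r// ler_wpM2l//.
  rewrite ler_expR (_ : a + 1 - (u + 1) = - (u - a)); last by ring.
  by rewrite mulrN lerN2 ler_wpM2r ?ler_nat//; lra.
have hD : N (u + 1) <= count_const R m n * expR (m + n)%:R * N u.
  apply: (le_trans (rank_count tau s u (u + 1))); rewrite ler_wpM2r// ler_wpM2l//.
  by rewrite ler_expR addrAC subrr add0r mulr1 ler_nat rank_leq_col.
set E := expR (i.+1%:R * (u - a)).
have E0 : 0 < E by exact: expR_gt0.
have hC' : E * N (a + 1) <= count_const R m n * N (u + 1).
  apply: (@le_trans _ _ (E * (count_const R m n * expR (- (i.+1%:R * (u - a))) * N (u + 1)))).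
    by rewrite ler_wpM2l ?(ltW E0).
  rewrite expRN -/E le_eqVlt; apply/orP; left; apply/eqP.
  by move: (count_const _ _ _) (N _) => *; field; rewrite gt_eqF.
apply: (@le_trans _ _ (E * (expR i%:R * (K ^+ i * N (a + 1))))).
  rewrite ler_wpM2l ?(ltW E0)//; apply: (le_trans hA).
  by rewrite !ler_wpM2l ?expR_ge0.
have r1 (x y z w : R) : x * (y * (z * w)) = y * z * (x * w) by ring.
rewrite [leLHS]r1.
apply: (@le_trans _ _ (expR i%:R * K ^+ i * (count_const R m n *
    (count_const R m n * expR (m + n)%:R * N u)))).
  apply: ler_wpM2l; first by rewrite mulr_ge0 ?expR_ge0.
  by apply: (le_trans hC'); rewrite ler_wpM2l.
have r2 (x y c e' w : R) : x * y * (c * (c * e' * w)) = c ^+ 2 * (x * e') * (y * w) by ring.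
rewrite [leLHS]r2 [K ^+ i.+1]exprS -[leRHS]mulrA; apply: ler_wpM2r; first exact: mulr_ge0.
apply: le_trans KK; rewrite /minima_const; apply: ler_wpM2l; first exact: exprn_ge0.
rewrite -expRD ler_expR mulr_natl mulr2n lerD2r; exact: dge (ltnW kd).
Qed.

Lemma count_minima tau s :
  (ncard (inbox A tau s 0))%:R <= minima_const ^+ (m + n) * minima_prod tau s /\
  minima_prod tau s <= minima_const ^+ (m + n) * (ncard (inbox A tau s 0))%:R.
Proof.
have [j|] := @count_minima_step minima_const tau s (m + n) 0 minima_const_ge1 (lexx _) (leqnn _).
  by rewrite leqNgt ltn_ord.
rewrite (eq_bigl predT); last by move=> j; rewrite ltn_ord.
rewrite /M expR0 (_ : \prod_j _ = minima_prod tau s) => [//|].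
by apply: eq_bigr => j _; rewrite div1r.
Qed.

End Minima.

(** * Sparseness of critical times *)

Lemma count_iota_split (Q : pred nat) a b : (a <= b)%N ->
  count Q (iota 0 b) = (count Q (iota 0 a) + count Q (iota a (b - a)))%N.
Proof. by move=> ab; rewrite -count_cat -iotaD subnKC. Qed.

Section SparseSets.
Context (R : realType).

Lemma count_window (Q : pred nat) a b (w : R) : 0 <= w ->
  (forall k k', (a <= k)%N -> (k < k')%N -> (k' < b)%N -> Q k -> Q k' -> (k' - k)%:R <= w) ->
  (count Q (iota a (b - a)))%:R <= w + 1.
Proof.
move=> w0 H; have [hQ|] := boolP (has Q (iota a (b - a))); last first.
  by rewrite has_count -eqn0Ngt => /eqP ->; rewrite addr_ge0.
have [j Qj jmin] : exists2 j, (a <= j < b)%N && Q j & forall k, (a <= k < b)%N && Q k -> (j <= k)%N.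
  have /hasP[j0 j0i Qj0] := hQ; rewrite mem_iota in j0i.
  have ex : exists j, (a <= j < b)%N && Q j by exists j0; rewrite Qj0 andbT; lia.
  by case: (ex_minnP ex) => j ? ?; exists j.
have jb : (a <= j < b)%N by case/andP: Qj.
pose W := `|Num.floor w|%N.
have WE : W%:R <= w by rewrite /W natr_absz ger0_norm ?floor_ge0// floor_le.
have sub : {subset seq.filter Q (iota a (b - a)) <= iota j W.+1}.
  move=> k; rewrite mem_filter !mem_iota => /andP[Qk kab].
  have jk : (j <= k)%N by apply: jmin; rewrite Qk andbT; lia.
  rewrite jk /=; rewrite leq_eqVlt in jk; case/orP: jk => [/eqP <-|jk]; first lia.
  have : (k - j)%:R <= w by apply: H => //; [lia|lia|case/andP: Qj].
  have <- : ((k - j)%:Z)%:~R = (k - j)%:R :> R by [].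
  rewrite -floor_ge_int => h.
  have : (k - j <= W)%N by rewrite /W -lez_nat gez0_abs ?floor_ge0.
  by lia.
rewrite -size_filter; apply: (@le_trans _ _ W.+1%:R); last by rewrite -natr1 lerD2r.
rewrite ler_nat -[leqRHS](size_iota j); apply: uniq_leq_size => //.
by rewrite filter_uniq// iota_uniq.
Qed.

(* Splitting [0, K) at K / (1 + th): the upper part has diameter at most th K, hence by
   hypothesis at most th' K + c, so the count satisfies a contracting recurrence. *)
Lemma sparse_count (Q : pred nat) (th th' c eps : R) :
  0 < th -> th <= 1 -> 0 <= th' -> 0 <= c -> 0 < eps -> th' <= eps * th / 4 ->
  (forall k k', (k < k')%N -> Q k -> Q k' -> (k' - k)%:R <= th * k%:R ->
     (k' - k)%:R <= th' * k%:R + c) ->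
  exists C : R, forall K, (count Q (iota 0 K))%:R <= eps * K%:R + C.
Proof.
move=> th0 th1 th'0 c0 eps0 thth' H.
have et0 : 0 < eps * th / 4 by rewrite divr_gt0// mulr_gt0.
(* Beyond [K0] the additive errors [c + 1 + eps] are at most [eps * th / 4 * K], and [2 < K * th]
   puts the splitting point strictly below [K]. *)
pose K0 := (c + 1 + eps) / (eps * th / 4) + 1 + 2 / th.
have q0 : 0 <= (c + 1 + eps) / (eps * th / 4) by rewrite divr_ge0 ?addr_ge0// ltW.
have q1 : 0 <= 2 / th by rewrite divr_ge0// ltW.
exists K0; elim/ltn_ind => K IH.
have cK : (count Q (iota 0 K))%:R <= K%:R :> R by rewrite ler_nat -[leqRHS](size_iota 0) count_size.
have [KK0|K0K] := leP K%:R K0.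
  by apply: (le_trans cK); apply: (le_trans KK0); rewrite lerDr mulr_ge0// ltW.
have x0 : 0 <= K%:R / (1 + th) by rewrite divr_ge0// addr_ge0// ltW.
pose K' := (`|Num.floor (K%:R / (1 + th))|%N).+1.
have fE : (`|Num.floor (K%:R / (1 + th))|%N)%:R = (Num.floor (K%:R / (1 + th)))%:~R :> R.
  by rewrite natr_absz ger0_norm// floor_ge0.
have K'l : K%:R <= (1 + th) * K'%:R.
  rewrite mulrC -ler_pdivrMr; last lra.
  rewrite -natr1 fE; have := floorD1_gt (K%:R / (1 + th)); rewrite intrD; exact: ltW.
have K'u : K'%:R <= K%:R / (1 + th) + 1.
  by rewrite -natr1 lerD2r fE floor_le.
have tK : K%:R / (1 + th) <= K%:R - K%:R * (th / 2).
  rewrite ler_pdivrMr; last lra.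
  have -> : (K%:R - K%:R * (th / 2)) * (1 + th) = K%:R + K%:R * (th / 2 * (1 - th)) by field.
  by rewrite lerDl mulr_ge0// mulr_ge0 ?divr_ge0 ?subr_ge0// ltW.
have K2 : 2 < K%:R * th.
  rewrite -ltr_pdivrMr//; apply: lt_trans K0K; rewrite /K0; lra.
have KK' : (K' < K)%N.
  by rewrite -(ltr_nat R); apply: (le_lt_trans K'u); lra.
have win : (count Q (iota K' (K - K')))%:R <= th' * K%:R + c + 1.
  apply: count_window => [|k k' k1 k2 k3 Qk Qk']; first by rewrite addr_ge0// mulr_ge0.
  have kk' : (k' - k)%:R <= th * k%:R.
    rewrite natrB ?(ltnW k2)//; have : k'%:R <= K%:R :> R by rewrite ler_nat ltnW.
    have : (1 + th) * K'%:R <= (1 + th) * k%:R.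
      by rewrite ler_wpM2l ?ler_nat//; lra.
    by rewrite [(1 + th) * k%:R]mulrDl mul1r; lra.
  apply: (le_trans (H _ _ k2 Qk Qk' kk')); rewrite lerD2r ler_wpM2l// ler_nat.
  by rewrite ltnW// (ltn_trans k2).
rewrite (count_iota_split _ (ltnW KK')) natrD.
apply: (le_trans (lerD (IH _ KK') win)).
have e1 : c + 1 + eps <= eps * th / 4 * K%:R.
  by rewrite -ler_pdivrMl// mulrC; apply: le_trans (ltW K0K); rewrite /K0; lra.
have e2 : th' * K%:R <= eps * th / 4 * K%:R by rewrite ler_wpM2r.
have e3 : eps * K'%:R <= eps * (K%:R - K%:R * (th / 2) + 1).
  by rewrite ler_wpM2l ?(ltW eps0)//; lra.
have e4 : eps * (K%:R - K%:R * (th / 2) + 1) = eps * K%:R - 2 * (eps * th / 4 * K%:R) + eps by field.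
lra.
Qed.

Lemma count_cover (I : finType) (P : pred nat) (Q : I -> pred nat) (eps : R) :
  (forall k, P k -> exists i, Q i k) ->
  (forall i, exists C : R, forall K, (count (Q i) (iota 0 K))%:R <= eps * K%:R + C) ->
  exists C : R, forall K, (count P (iota 0 K))%:R <= #|I|%:R * eps * K%:R + C.
Proof.
move=> PQ HQ; pose C i := sval (cid (HQ i)).
have HC i K : (count (Q i) (iota 0 K))%:R <= eps * K%:R + C i by rewrite /C; case: cid.
exists (\sum_i C i) => K.
have h : (count P (iota 0 K) <= \sum_i count (Q i) (iota 0 K))%N.
  elim: (iota 0 K) => [|k s IH] //=; rewrite big_split /=; apply: leq_add => //.
  have [Pk|//] := boolP (P k); have [i Qik] := PQ k Pk.
  by rewrite (bigD1 i)//= Qik.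
apply: (@le_trans _ _ (\sum_i (count (Q i) (iota 0 K))%:R)).
  by rewrite -natr_sum ler_nat.
rewrite -mulrA mulr_natl -sumr_const -big_split /=.
by apply: ler_sum => i _; exact: HC.
Qed.

End SparseSets.

(** * Separation of the speeds at a regular exponent *)

Section Gap.
Context (R : realType) (m n : nat) (tau : R).
Hypothesis tau_reg : regular_exponents R m n tau.

Lemma tau_gt0 : 0 < tau.
Proof. by case: tau_reg; rewrite /= in_itv /= andbT. Qed.

(** Equal speeds mean [tau * (a2 - a1) = b2 - b1]. If [a2 <= a1] this contradicts the order of the
    ranks; otherwise [b1 < b2] because [tau > 0], and [tau] is an exceptional fraction. *)
Lemma slope_gap_pos a1 a2 b1 b2 : (a1 <= m)%N -> (a2 <= m)%N -> (b1 <= n)%N -> (b2 <= n)%N ->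
  (a1 + b1 < a2 + b2)%N -> (b2%:R - tau * a2%:R) - (b1%:R - tau * a1%:R) != 0 :> R.
Proof.
move=> a1m a2m b1n b2n ab; have t0 := tau_gt0.
apply/negP => /eqP H.
have H' : tau * (a2%:R - a1%:R) = b2%:R - b1%:R :> R by lra.
have [a21|a12] := leqP a2 a1.
  have : b2%:R <= b1%:R :> R.
    by rewrite -subr_le0 -H' mulr_ge0_le0 ?subr_le0 ?ler_nat// ltW.
  by rewrite ler_nat; lia.
have b12 : (b1 < b2)%N.
  by rewrite -(ltr_nat R) -subr_gt0 -H' mulr_gt0// subr_gt0 ltr_nat.
case: tau_reg => _; apply; exists (a2 - a1)%N, (b2 - b1)%N; split; [lia|lia|].
rewrite !natrB ?(ltnW a12) ?(ltnW b12)// -H' mulfK//.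
by rewrite subr_eq0 eqr_nat gtn_eqF.
Qed.

Lemma slope_gap : exists2 delta : R, 0 < delta &
  forall a1 a2 b1 b2, (a1 <= m)%N -> (a2 <= m)%N -> (b1 <= n)%N -> (b2 <= n)%N ->
  (a1 + b1 < a2 + b2)%N -> delta <= `|(b2%:R - tau * a2%:R) - (b1%:R - tau * a1%:R)|.
Proof.
pose F (p : ('I_m.+1 * 'I_m.+1) * ('I_n.+1 * 'I_n.+1)) : R :=
  `|(p.2.2%:R - tau * p.1.2%:R) - (p.2.1%:R - tau * p.1.1%:R)|.
exists (\big[Num.min/1]_(p : ('I_m.+1 * 'I_m.+1) * ('I_n.+1 * 'I_n.+1) | (p.1.1 + p.2.1 < p.1.2 + p.2.2)%N) F p).
  apply: lt_bigmin => [|[[a1 a2] [b1 b2]] /= ab] //.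
  by rewrite /F /= normr_gt0 slope_gap_pos// -ltnS.
move=> a1 a2 b1 b2 a1m a2m b1n b2n ab.
pose p : ('I_m.+1 * 'I_m.+1) * ('I_n.+1 * 'I_n.+1) :=
  ((Ordinal (a1m : a1 < m.+1)%N, Ordinal (a2m : a2 < m.+1)%N),
   (Ordinal (b1n : b1 < n.+1)%N, Ordinal (b2n : b2 < n.+1)%N)).
pose P (p : ('I_m.+1 * 'I_m.+1) * ('I_n.+1 * 'I_n.+1)) :=
  (p.1.1 + p.2.1 < p.1.2 + p.2.2)%N.
exact: (@bigmin_le_cond _ R _ 1 p P F).
Qed.

End Gap.

(** * Types of subspaces and logarithmic counts *)

Section TypeLemmas.
Context (R : realType) (m n : nat).
Implicit Types (V : 'M[R]_(m + n)) (th : R).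

Definition optf V th : {ffun 'I_(\rank V) -> 'I_(m + n)} :=
  sval (cid (optimal_exists (row_base_free V) th)).

Lemma optfP V th : optimal (row_base V) th (optf V th).
Proof. by rewrite /optf; case: cid. Qed.

Definition xtype V th := xdim (optf V th).

Lemma xtype_same V th th' : 0 < th -> 0 < th' -> xtype V th = xtype V th' ->
  optimal (row_base V) th' (optf V th).
Proof. by move=> t0 t'0; exact: optimal_same t0 t'0 (@optfP V th) (@optfP V th'). Qed.

Lemma xtype_le V th th' : 0 < th -> th < th' -> (xtype V th <= xtype V th')%N.
Proof.
move=> t0 tt'.
exact: (optimal_xdim_le (row_base_free V) t0 tt' (@optfP V th) (@optfP V th')).
Qed.

Lemma xtype_bounds V th : 0 < th ->
  [/\ (xtype V th <= m)%N, (\rank V - xtype V th <= n)%N & (xtype V th <= \rank V)%N].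
Proof.
move=> t0; have f0 := optimal_neq0 (row_base_free V) t0 (@optfP V th).
have [h1 h2] := xdim_le f0; split=> //.
by rewrite -[leqRHS]card_ord; exact: max_card.
Qed.

End TypeLemmas.

Section LogCount.
Context (R : realType) (m n : nat) (A : 'M[R]_(m, n)).
Hypotheses (hm : (0 < m)%N) (hn : (0 < n)%N).
Implicit Types (V : 'M[R]_(m + n)) (tau s u : R).

Definition lcount tau s u : R := ln (ncard (inbox A tau s u))%:R.

Definition lconst : R := ln (count_const R m n).

Let N0 tau s u : (0 : R) < (ncard (inbox A tau s u))%:R.
Proof. by rewrite ltr0n inbox_gt0. Qed.

Let c0 : 0 < count_const R m n.
Proof. exact: lt_le_trans (count_const_ge1 R m n). Qed.

Lemma lconst_ge0 : 0 <= lconst.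
Proof. by apply: ln_ge0; exact: count_const_ge1. Qed.

Lemma lcount_ge0 tau s u : 0 <= lcount tau s u.
Proof. by apply: ln_ge0; rewrite ler1n inbox_gt0. Qed.

Lemma lcount_le tau s u u' : u <= u' -> lcount tau s u <= lcount tau s u'.
Proof. by move=> uu'; rewrite ler_ln ?posrE// ler_nat ncard_inbox_le. Qed.

Let ln_bound tau s u s' u' x :
  (ncard (inbox A tau s' u'))%:R <= count_const R m n * expR x * (ncard (inbox A tau s u))%:R ->
  lcount tau s' u' <= lcount tau s u + x + lconst.
Proof.
move=> h; rewrite /lcount /lconst.
have -> : ln (ncard (inbox A tau s u))%:R + x + ln (count_const R m n) =
    ln (count_const R m n * expR x * (ncard (inbox A tau s u))%:R).
  rewrite lnM ?posrE ?mulr_gt0 ?expR_gt0// lnM ?posrE ?expR_gt0// expRK; ring.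
by rewrite ler_ln ?posrE ?mulr_gt0 ?expR_gt0.
Qed.

Lemma lcount_rank tau s u u' :
  lcount tau s u' <= lcount tau s u + (\rank (Vsp A tau s u'))%:R * (u' - u) + lconst.
Proof. by apply: ln_bound; exact: rank_count. Qed.

Lemma lcount_dim tau s u u' : u <= u' ->
  lcount tau s u' <= lcount tau s u + (m + n)%:R * (u' - u) + lconst.
Proof.
move=> uu'; apply: le_trans (lcount_rank _ _ u _) _; rewrite lerD2r lerD2l.
by rewrite ler_wpM2r ?subr_ge0// ler_nat rank_leq_col.
Qed.

Let slope1 tau s u s' u' V (f : {ffun 'I_(\rank V) -> 'I_(m + n)}) :
  V = Vsp A tau s' u' -> optimal (row_base V) (theta tau s) f ->
  lcount tau s' u' <= lcount tau s u + ((xdim f)%:R * ((u' - tau * s') - (u - tau * s)) +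
     (\rank V - xdim f)%:R * ((u' + s') - (u + s))) + lconst.
Proof. by move=> VE; subst V => fo; apply: ln_bound; exact: slope_count. Qed.

(** [slope_count] in both directions: equality of the types makes one selection optimal at both
    times. *)
Lemma lcount_slope tau s u s' u' V :
  V = Vsp A tau s u -> V = Vsp A tau s' u' ->
  xtype V (theta tau s) = xtype V (theta tau s') ->
  `|lcount tau s' u' - lcount tau s u -
    ((xtype V (theta tau s))%:R * ((u' - tau * s') - (u - tau * s)) +
     (\rank V - xtype V (theta tau s))%:R * ((u' + s') - (u + s)))| <= lconst.
Proof.
move=> V1 V2 xx; have t0 := theta_gt0 tau s; have t'0 := theta_gt0 tau s'.
have h1 := slope1 u V2 (@optfP _ _ _ V (theta tau s)).
have h2 := slope1 u' V1 (xtype_same t0 t'0 xx).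
set a := xdim _ in h2; set E := (X in `|_ - X|).
have {}h2 : lcount tau s u <= lcount tau s' u' - E + lconst.
  apply: (le_trans h2); rewrite lerD2r lerD2l /E -/a /xtype -/a.
  move: (a%:R) (\rank V - a)%:R => x y; rewrite le_eqVlt; apply/orP; left.
  by apply/eqP; ring.
have {}h1 : lcount tau s' u' <= lcount tau s u + E + lconst by exact: h1.
clearbody E; move: (lcount tau s u) (lcount _ _ _) lconst h1 h2 => *.
by rewrite ler_norml; apply/andP; split; lra.
Qed.

End LogCount.

Section Arith.
Context (R : realType).

Lemma oppr_le_self (x : R) : 0 <= x -> - x <= x.
Proof. lra. Qed.

(** [LA] and [LB] stand for the log-counts of the large and the small box. Their levels [alpha * s]
    and [- (alpha * s)] move with [s], so their difference drifts at speed [X + alpha * Rr] rather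
    than [X]; the condition [4 * d * alpha <= delta] leaves at least half of the gap. *)
Lemma close_pair_arith (tau alpha delta s s2 d l : R) (l0 : 0 <= l) (LA LB LA2 LB2 : R)
  (a1 b1 a2 b2 : R) :
  0 <= a1 -> 0 <= b1 -> 0 <= a2 -> 0 <= b2 ->
  0 < alpha -> 0 < s -> s <= s2 -> alpha * s2 <= 2 * (alpha * s) ->
  0 < delta -> 4 * d * alpha <= delta -> a1 + b1 <= d -> a2 + b2 <= d ->
  delta <= `|(b2 - tau * a2) - (b1 - tau * a1)| ->
  LB <= LA -> LB2 <= LA2 ->
  LA <= LB + d * (alpha * s - (- (alpha * s))) + l ->
  LA2 <= LB2 + d * (alpha * s2 - (- (alpha * s2))) + l ->
  `|LB2 - LB - (a1 * ((- (alpha * s2) - tau * s2) - (- (alpha * s) - tau * s)) +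
     b1 * ((- (alpha * s2) + s2) - (- (alpha * s) + s)))| <= l ->
  `|LA2 - LA - (a2 * ((alpha * s2 - tau * s2) - (alpha * s - tau * s)) +
     b2 * ((alpha * s2 + s2) - (alpha * s + s)))| <= l ->
  s2 - s <= 8 * d * alpha / delta * s + 6 / delta * l.
Proof.
move=> a10 b10 a20 b20 al0 s0 ss2 as2 de0 ald rd1 rd2 gp g1 g2 g3 g4.
set D := s2 - s; have D0 : 0 <= D by rewrite subr_ge0.
have -> : alpha * s2 - tau * s2 - (alpha * s - tau * s) = (alpha - tau) * D by rewrite /D; ring.
have -> : alpha * s2 + s2 - (alpha * s + s) = (alpha + 1) * D by rewrite /D; ring.
have -> : - (alpha * s2) - tau * s2 - (- (alpha * s) - tau * s) = (- alpha - tau) * D by rewrite /D; ring.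
have -> : - (alpha * s2) + s2 - (- (alpha * s) + s) = (- alpha + 1) * D by rewrite /D; ring.
set X := (_ - _) - _ in gp *.
set Rr := a1 + b1 + (a2 + b2).
have Rr0 : 0 <= Rr by rewrite !addr_ge0.
have d0 : 0 <= d by lra.
have dal : 0 <= d * (alpha * s) by rewrite mulr_ge0// mulr_ge0// ltW.
have dal2 : d * (alpha * s2) <= 2 * (d * (alpha * s)) by rewrite [leRHS]mulrCA ler_wpM2l.
have aR : alpha * Rr * D <= delta / 2 * D.
  rewrite ler_wpM2r//; apply: (@le_trans _ _ (alpha * (d + d))).
    by rewrite ler_wpM2l ?(ltW al0)//; rewrite /Rr; lra.
  by rewrite mulrDr mulrC; lra.
have aR0 : 0 <= alpha * Rr * D by rewrite !mulr_ge0// ltW.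
rewrite !ler_norml => /andP[p1 p2] /andP[p3 p4].
have E : (X + alpha * Rr) * D = (a2 * ((alpha - tau) * D) + b2 * ((alpha + 1) * D))
     - (a1 * ((- alpha - tau) * D) + b1 * ((- alpha + 1) * D)) by rewrite /X /Rr; ring.
rewrite mulrDl in E.
move: p1 p2 p3 p4 E; move: (_ + b2 * _) (_ + b1 * _) => e2 e1 p1 p2 p3 p4 E.
have XD : delta * D <= `|X * D| by rewrite normrM (ger0_norm D0) ler_wpM2r.
have q1 : alpha * s - (- (alpha * s)) = 2 * (alpha * s) by ring.
have q2 : alpha * s2 - (- (alpha * s2)) = 2 * (alpha * s2) by ring.
rewrite q1 in g3; rewrite q2 in g4; rewrite !(mulrCA d 2) in g3 g4.
have hD : delta / 2 * D = (delta * D) / 2 by field.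
rewrite hD in aR.
have fin : (delta * D) / 2 <= 3 * l + 4 * (d * (alpha * s)).
  move: (alpha * Rr * D) (X * D) (delta * D) (d * (alpha * s)) (d * (alpha * s2))
    aR aR0 E XD dal dal2 g3 g4 => aRD XDv dD q q' aR aR0 E XD dal dal2 g3 g4.
  clear -g1 g2 l0 p1 p2 p3 p4 aR aR0 E XD dal dal2 g3 g4.
  have [XD0|XD0] := leP 0 XDv.
    by rewrite (ger0_norm XD0) in XD; lra.
  by rewrite (ltr0_norm XD0) in XD; lra.
have de20 : 0 < delta / 2 by rewrite divr_gt0.
rewrite -(ler_pM2l de20) hD; apply: (le_trans fin).
rewrite mulrDr (_ : delta / 2 * (8 * d * alpha / delta * s) = 4 * (d * (alpha * s))); last first.
  by field; rewrite gt_eqF.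
rewrite (_ : delta / 2 * (6 / delta * l) = 3 * l); last by field; rewrite gt_eqF.
by rewrite addrC.
Qed.

End Arith.

Section CriticalTimes.
Context (R : realType) (m n : nat) (A : 'M[R]_(m, n)).
Hypotheses (hm : (0 < m)%N) (hn : (0 < n)%N).
Context (tau : R).
Hypothesis tau_reg : regular_exponents R m n tau.
Implicit Types (s u : R).

Local Notation W := (Vsp A tau).
Local Notation Xt V s := (xtype V (theta tau s)).

Lemma Vsp_sqz s s' u u' : u + (1 + tau) * `|s' - s| <= u' -> (W s u <= W s' u')%MS.
Proof.
move=> h; apply: Vsp_le; apply: inbox_mono; first exact/ltW/(tau_gt0 tau_reg).
by rewrite subrr mul0r normr0 addr0.
Qed.

(* If the boxes at -alpha s and alpha s have spans of different ranks and both keep their spans and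
   types from s to s2, then their log-counts drift apart at speed at least delta, while they always
   stay within O(alpha s) of each other. *)
Lemma close_pair (alpha beta delta : R) s s2 : 0 < s -> s <= s2 -> s2 <= 2 * s ->
  0 < alpha -> 4 * alpha <= beta -> (1 + tau) * (s2 - s) <= beta * s / 4 ->
  W s (- (alpha * s)) = W s (- (beta * s)) -> W s (alpha * s) = W s (beta * s) ->
  W s2 (- (alpha * s2)) = W s2 (- (beta * s2)) -> W s2 (alpha * s2) = W s2 (beta * s2) ->
  (\rank (W s (- (alpha * s))) < \rank (W s (alpha * s)))%N ->
  Xt (W s (- (alpha * s))) s = Xt (W s2 (- (alpha * s2))) s2 ->
  Xt (W s (alpha * s)) s = Xt (W s2 (alpha * s2)) s2 ->
  0 < delta -> 4 * (m + n)%:R * alpha <= delta ->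
  (forall a1 a2 b1 b2, (a1 <= m)%N -> (a2 <= m)%N -> (b1 <= n)%N -> (b2 <= n)%N ->
   (a1 + b1 < a2 + b2)%N -> delta <= `|(b2%:R - tau * a2%:R) - (b1%:R - tau * a1%:R)|) ->
  s2 - s <= 8 * (m + n)%:R * alpha / delta * s + 6 / delta * lconst R m n.
Proof.
move=> s0 ss2 s22 al0 al4 close Em Ep Em2 Ep2 rk xm xp de0 ald gap.
have t0 := tau_gt0 tau_reg.
have ds : `|s2 - s| = s2 - s by rewrite ger0_norm// subr_ge0.
have ds' : `|s - s2| = s2 - s by rewrite distrC.
have as2 : alpha * s2 <= 2 * (alpha * s).
  by rewrite mulrCA ler_wpM2l// ltW.
have bs2 : beta * s <= beta * s2 by rewrite ler_wpM2l//; lra.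
have as0 : 0 < alpha * s by rewrite mulr_gt0.
have as4 : 4 * (alpha * s) <= beta * s by rewrite mulrA ler_wpM2r// ltW.
(* The equality of the spans at levels [alpha] and [beta] provides the room: the price of moving
   from [s] to [s2] is smaller than what separates the two levels, so each span is contained in the
   other. *)
have Vm : W s (- (alpha * s)) = W s2 (- (alpha * s2)).
  apply: Vsp_anti; [rewrite Em|rewrite Em2]; apply: Vsp_sqz; rewrite ?ds ?ds'; lra.
have Vp : W s (alpha * s) = W s2 (alpha * s2).
  apply: Vsp_anti; [rewrite Ep2|rewrite Ep]; apply: Vsp_sqz; rewrite ?ds ?ds'; lra.
have t1 := theta_gt0 tau s.
have hm1 := @lcount_slope R m n A tau s (- (alpha * s)) s2 (- (alpha * s2)) _ erefl Vm.
have hp1 := @lcount_slope R m n A tau s (alpha * s) s2 (alpha * s2) _ erefl Vp.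
rewrite -Vm in xm; rewrite -Vp in xp.
have {}hm1 := hm1 xm; have {}hp1 := hp1 xp.
set V1 := W s (- _) in rk xm hm1 Vm *; set V2 := W s (_ * _) in rk xp hp1 Vp *.
have [am bm arm] := xtype_bounds V1 t1; have [ap bp arp] := xtype_bounds V2 t1.
set a1 := Xt V1 s in xm hm1 am bm arm *; set a2 := Xt V2 s in xp hp1 ap bp arp *.
set b1 := (\rank V1 - a1)%N in hm1 bm *; set b2 := (\rank V2 - a2)%N in hp1 bp *.
have gp : delta <= `|(b2%:R - tau * a2%:R) - (b1%:R - tau * a1%:R)|.
  by apply: gap => //; rewrite /b1 /b2 !subnKC.
have rd1 : a1%:R + b1%:R <= (m + n)%:R :> R.
  by rewrite -natrD /b1 subnKC// ler_nat rank_leq_col.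
have rd2 : a2%:R + b2%:R <= (m + n)%:R :> R.
  by rewrite -natrD /b2 subnKC// ler_nat rank_leq_col.
have as20 : 0 < alpha * s2 by exact: mulr_gt0 al0 (lt_le_trans s0 ss2).
have g1 := lcount_le A tau s (oppr_le_self (ltW as0)).
have g2 := lcount_le A tau s2 (oppr_le_self (ltW as20)).
have g3 := lcount_dim A tau s (oppr_le_self (ltW as0)).
have g4 := lcount_dim A tau s2 (oppr_le_self (ltW as20)).
have H := @close_pair_arith R tau alpha delta s s2 (m + n)%:R _ (lconst_ge0 R m n)
  _ _ _ _ a1%:R b1%:R a2%:R b2%:R (ler0n _ _) (ler0n _ _) (ler0n _ _) (ler0n _ _)
  al0 s0 ss2 as2 de0 ald rd1 rd2 gp g1 g2 g3 g4 hm1 hp1.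
exact: H.
Qed.

Definition critical eta s := W s (- (eta * s)) <> W s (eta * s).

(** The slack between [alpha] and [beta] is what later pays for a displacement in time. *)
Definition stable (alpha beta : R) s :=
  [/\ W s (- (alpha * s)) = W s (- (beta * s)), W s (alpha * s) = W s (beta * s)
    & (\rank (W s (- (alpha * s))) < \rank (W s (alpha * s)))%N].

Lemma Vsp_eq_rank s u u' : u <= u' -> \rank (W s u) = \rank (W s u') -> W s u = W s u'.
Proof.
move=> uu'; apply: span_mx_rank_eq => _ [z zu <-]; exists z => // i.
by apply: le_trans (zu i) _; rewrite /wt ler_expR lerD2r.
Qed.

Lemma Vsp_rank_le s u u' : u <= u' -> (\rank (W s u) <= \rank (W s u'))%N.
Proof. by move=> uu'; apply/mxrankS/Vsp_sqz; rewrite subrr normr0 mulr0 addr0. Qed.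

Lemma bounded_stalls (D : nat -> nat) d : (forall l, (D l <= D l.+1)%N) ->
  (0 < D 0)%N -> (forall l, (D l <= d)%N) -> exists2 l, (l <= d)%N & D l = D l.+1.
Proof.
move=> Dm D0 Dd; apply: contrapT => H.
have : forall l, (l <= d.+1)%N -> (l < D l)%N.
  elim=> [//|l IH] ld; have lD := IH (ltnW ld).
  have : D l <> D l.+1 by move=> E; apply: H; exists l.
  by have := Dm l; move: lD; lia.
by move=> /(_ d.+1 (leqnn _)); have := Dd d.+1; lia.
Qed.

Lemma nested_sub (p q p' q' : nat) : (q <= p)%N -> (q' <= p')%N -> (q' <= q)%N ->
  (p <= p')%N -> (p - q = p' - q')%N -> p = p' /\ q = q'.
Proof. lia. Qed.

(* Pigeonhole on the rank jump between -eta B^l s and eta B^l s, which is monotone in l. *)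
Lemma critical_stable eta B s : 0 <= s -> 0 < eta -> 1 <= B -> critical eta s ->
  exists2 l, (l <= m + n)%N & stable (eta * B ^+ l) (eta * B ^+ l.+1) s.
Proof.
move=> s0 eta0 B1 crit; pose e l := eta * B ^+ l.
have e0 l : 0 <= e l by rewrite mulr_ge0 ?(ltW eta0)// exprn_ge0// (le_trans ler01).
have eS l : e l * s <= e l.+1 * s.
  by rewrite ler_wpM2r// ler_wpM2l ?(ltW eta0)// exprS ler_peMl// exprn_ge0// (le_trans ler01).
have es0 l : 0 <= e l * s by rewrite mulr_ge0.
have rl l : (\rank (W s (- (e l * s))) <= \rank (W s (e l * s)))%N.
  exact/Vsp_rank_le/oppr_le_self.
have r1 l : (\rank (W s (- (e l.+1 * s))) <= \rank (W s (- (e l * s))))%N.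
  by apply: Vsp_rank_le; rewrite lerN2.
have r2 l : (\rank (W s (e l * s)) <= \rank (W s (e l.+1 * s)))%N by exact: Vsp_rank_le.
pose D l := (\rank (W s (e l * s)) - \rank (W s (- (e l * s))))%N.
have D0 : (0 < D 0)%N.
  rewrite subn_gt0 ltnNge; apply/negP => rr; apply: crit.
  have -> : eta = e 0 by rewrite /e expr0 mulr1.
  by apply: Vsp_eq_rank; [exact: oppr_le_self|apply/eqP; rewrite eqn_leq rr rl].
have rd l : (\rank (W s (e l * s)) <= m + n)%N by exact: rank_leq_col.
have Dm l : (D l <= D l.+1)%N.
  by rewrite /D; have := rl l; have := rl l.+1; have := r1 l; have := r2 l; lia.
have Dd l : (D l <= m + n)%N by rewrite /D; have := rd l; lia.
have [l ld DE] := bounded_stalls Dm D0 Dd; exists l => //.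
rewrite -/(e l) -/(e l.+1).
have Dl : (0 < D l)%N.
  by elim: (l) => // k IH; apply: leq_trans IH (Dm k).
have [pE qE] := nested_sub (rl l) (rl l.+1) (r1 l) (r2 l) DE; split.
- by symmetry; apply: Vsp_eq_rank; [rewrite lerN2; exact: eS|].
- by apply: Vsp_eq_rank; first exact: eS.
- by rewrite -subn_gt0.
Qed.

(** Every critical time is stable at one of finitely many scales with one of finitely many pairs of
    types. Within such a class [close_pair] supplies the hypothesis of [sparse_count]. Density is
    measured on a grid whose step [h] is given before [eta]. *)
Lemma critical_sparse (h : R) : 0 < h -> forall eps eta1 : R, 0 < eps -> 0 < eta1 ->
  exists2 eta : R, 0 < eta <= eta1 &
  exists C : R, forall K, (count (fun k => `[< critical eta (h * k%:R) >]) (iota 0 K))%:R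
    <= eps * K%:R + C.
Proof.
move=> h0 eps eta1 eps0 eta10; have t0 := tau_gt0 tau_reg.
have [delta de0 gap] := slope_gap tau_reg.
set d := (m + n)%N; pose I := ('I_d.+1 * ('I_m.+1 * 'I_m.+1))%type.
have cI : (0 < #|{: I}|)%N.
  by apply/card_gt0P; exists (ord0, (ord0, ord0)).
pose eps' := eps / #|{: I}|%:R.
have eps'0 : 0 < eps' by rewrite divr_gt0// ltr0n.
(* The ratio of consecutive scales: the 4 gives [4 * alpha <= beta] in [close_pair], and the second
   term is exactly what [th' <= eps' * th / 4] requires. *)
pose B := 4 + 128 * d%:R * (1 + tau) / (delta * eps').
have d0 : 0 <= d%:R :> R by [].
have B4 : 4 <= B.
  by rewrite /B lerDl !(mulr_ge0, divr_ge0, invr_ge0)//; try lra; rewrite ?ltW// mulr_gt0.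
have Bd : 128 * d%:R * (1 + tau) / (delta * eps') <= B by rewrite /B lerDr.
have B1 : 1 <= B by lra.
have B0 : 0 < B by lra.
have Bn0 l : 0 < B ^+ l by rewrite exprn_gt0.
(* The three bounds give [eta <= eta1], [4 * d * alpha <= delta] and [th <= 1]. Dividing by
   [B ^+ d.+1] keeps all scales in use, including the outer one at [l.+1], below [emax]. *)
pose emax := Num.min (Num.min eta1 (delta / (4 * d%:R + 1))) 1.
have emax0 : 0 < emax by rewrite !lt_min eta10 divr_gt0//= ?ltr01//; lra.
pose eta := emax / B ^+ d.+1.
have eta0 : 0 < eta by rewrite divr_gt0.
have etal l : (l <= d.+1)%N -> eta * B ^+ l <= emax.
  move=> ld; rewrite /eta -mulrA ler_piMr ?(ltW emax0)// mulrC ler_pdivrMr// mul1r.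
  by apply: ler_weXn2l.
exists eta.
  rewrite eta0 /=; have := etal 0%N isT; rewrite expr0 mulr1 => /le_trans; apply.
  by rewrite /emax !ge_min lexx.
pose al l := eta * B ^+ l.
have al0 l : 0 < al l by rewrite mulr_gt0.
have alS l : al l.+1 = B * al l by rewrite /al exprS mulrCA.
pose tm (i : I) s := Xt (W s (- (al i.1 * s))) s.
pose tp (i : I) s := Xt (W s (al i.1 * s)) s.
pose Q (i : I) (k : nat) := `[< [/\ stable (al i.1) (al i.1.+1) (h * k%:R),
   tm i (h * k%:R) = i.2.1 & tp i (h * k%:R) = i.2.2] >].
have -> : eps = #|{: I}|%:R * eps'.
  by rewrite /eps' mulrC divfK// pnatr_eq0 -lt0n.
apply: (@count_cover R I _ Q) => [k /asboolP crit|i].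
  have s0 : 0 <= h * k%:R by rewrite mulr_ge0// ltW.
  have [l ld st] := critical_stable s0 eta0 B1 crit.
  have th0 := theta_gt0 tau (h * k%:R).
  have [b1 _ _] := xtype_bounds (W (h * k%:R) (- (al l * (h * k%:R)))) th0.
  have [b2 _ _] := xtype_bounds (W (h * k%:R) (al l * (h * k%:R))) th0.
  exists (Ordinal (ld : (l < d.+1)%N), (Ordinal (b1 : (_ < m.+1)%N), Ordinal (b2 : (_ < m.+1)%N))).
  by apply/asboolP; split.
set a := al i.1; set b := al i.1.+1.
have a0 : 0 < a := al0 _; have b0 : 0 < b := al0 _.
have bB : b = B * a := alS _.
have ble1 : b <= emax by apply: etal; exact: ltn_ord.
have ale : a <= emax by apply: etal; exact: ltnW (ltn_ord i.1).
have ed : emax <= delta / (4 * d%:R + 1) by rewrite /emax !ge_min lexx orbT.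
have e1 : emax <= 1 by rewrite /emax !ge_min lexx !orbT.
have ad : 4 * d%:R * a <= delta.
  have : a <= delta / (4 * d%:R + 1) by lra.
  by rewrite ler_pdivlMr; [lra|lra].
pose th := b / (4 * (1 + tau)); pose th' := 8 * d%:R * a / delta.
have th0 : 0 < th by rewrite divr_gt0//; lra.
have th1 : th <= 1 by rewrite ler_pdivrMr; lra.
have th'0 : 0 <= th' by apply: divr_ge0; last exact: ltW; apply: mulr_ge0; last exact: ltW; exact: mulr_ge0.
pose c := 6 / delta * lconst R m n / h.
have c0 : 0 <= c by rewrite !mulr_ge0 ?lconst_ge0// ?invr_ge0// ltW.
apply: (@sparse_count R _ th th' c eps') => //.
  rewrite /th /th' bB; have : 128 * d%:R * (1 + tau) <= B * (delta * eps').
    by rewrite -ler_pdivrMr// mulr_gt0.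
  move=> H; rewrite ler_pdivrMr// (_ : eps' * _ / 4 * delta =
      B * (delta * eps') * a / (16 * (1 + tau))); last by field; lra.
  rewrite ler_pdivlMr; last lra.
  have := ler_wpM2r (ltW a0) H.
  by move: (B * _) => X; lra.
move=> k k' kk' /asboolP[[s1 s2 s3] xm xp] /asboolP[[s1' s2' s3'] xm' xp'].
rewrite natrB ?(ltnW kk')// => close.
have k0 : 0 < k%:R :> R.
  rewrite ltr0n lt0n; apply/eqP => k0; move: close; rewrite k0 mulr0 subr0.
  by rewrite lern0 => /eqP k'0; rewrite k'0 in kk'.
have kk'R : k%:R < k'%:R :> R by rewrite ltr_nat.
have := @close_pair a b delta (h * k%:R) (h * k'%:R).
rewrite mulr_gt0// ler_wpM2l ?(ltW h0) ?(ltW kk'R)// => /(_ isT isT).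
have hk2 : h * k'%:R <= 2 * (h * k%:R).
  rewrite [leRHS]mulrCA ler_pM2l//.
  have : th * k%:R <= k%:R by rewrite ler_piMl.
  by lra.
move=> /(_ hk2 a0).
have ab4 : 4 * a <= b by rewrite bB ler_pM2r.
have cl : (1 + tau) * (h * k'%:R - h * k%:R) <= b * (h * k%:R) / 4.
  rewrite -mulrBr (_ : b * _ / 4 = (1 + tau) * (h * (th * k%:R))); last first.
    by rewrite /th; field; lra.
  by rewrite !ler_wpM2l// ?(ltW h0)// addr_ge0// ltW.
move=> /(_ ab4 cl s1 s2 s1' s2' s3).
rewrite (_ : Xt (W (h * k%:R) (- (a * (h * k%:R)))) (h * k%:R) = i.2.1)//.
rewrite (_ : Xt (W (h * k'%:R) (- (a * (h * k'%:R)))) (h * k'%:R) = i.2.1)//.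
rewrite (_ : Xt (W (h * k%:R) (a * (h * k%:R))) (h * k%:R) = i.2.2)//.
rewrite (_ : Xt (W (h * k'%:R) (a * (h * k'%:R))) (h * k'%:R) = i.2.2)//.
move=> /(_ erefl erefl de0 ad gap) fin.
rewrite -(ler_pM2l h0) mulrBr; apply: (le_trans fin).
rewrite le_eqVlt; apply/orP; left; apply/eqP; rewrite /th' /c -/d.
by move: (lconst _ _ _) => L; field; lra.
Qed.

End CriticalTimes.

(** * The rank integral *)

Section RankIntegral.
Context (R : realType) (m n : nat) (A : 'M[R]_(m, n)).
Hypotheses (hm : (0 < m)%N) (hn : (0 < n)%N).
Context (tau : R).
Hypothesis tau0 : 0 <= tau.
Implicit Types (s u : R).

Lemma small_minima_orank s : small_minima_count A tau (expR s) = orank A tau s 0.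
Proof.
have od : (orank A tau s 0 <= m + n)%N by exact: rank_leq_col.
rewrite /small_minima_count -[RHS](card_ltn_ord od).
apply: eq_card => i; rewrite inE; apply/idP/idP.
  rewrite inE expRK /powR gt_eqF ?expR_gt0// expRK => H.
  rewrite -(rmin_lt A hm hn) /rmin expR0 ltr_pdivrMr ?flow_unit_gt0// mul1r.
  exact: H.
rewrite inE -(rmin_lt A hm hn) /rmin expR0 ltr_pdivrMr ?flow_unit_gt0// mul1r.
by rewrite expRK /powR gt_eqF ?expR_gt0// expRK.
Qed.

Lemma orank_mono s s' u u' : u + (1 + tau) * `|s' - s| <= u' ->
  (orank A tau s u <= orank A tau s' u')%N.
Proof.
move=> h; apply/mxrankS/span_mx_le => _ [z zo <-]; exists z => // i.
apply: lt_le_trans (zo i) _; rewrite /wt ler_expR.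
have a0 : 0 <= `|s' - s| by [].
have h1 := ler_norm (s' - s); have := ler_norm (- (s' - s)); rewrite normrN => h2.
have h4 : tau * (s' - s) <= tau * `|s' - s| by rewrite ler_wpM2l.
have h6 : 0 <= tau * `|s' - s| by rewrite mulr_ge0.
by case: ifP => _; nra.
Qed.

(** A strict inequality for the minimum leaves room that is spent on moving [s]. Openness of these
    sets makes the rank a measurable function of time. *)
Lemma orank_open (i : 'I_(m + n)) : open [set s | (i < orank A tau s 0)%N].
Proof.
rewrite openE => s /= si; rewrite /interior /=.
have := rmin_lt A hm hn tau s 0 i; rewrite si expR0 => rm.
have rm0 := rmin_gt0 A hm hn tau s i.
set l := ln (rmin A tau s i) in rm rm0.
have l0 : l < 0 by rewrite ln_lt0// rm0.
have d0 : 0 < - l / 2 / (1 + tau) by rewrite !divr_gt0// ?oppr_gt0// ltr_wpDr.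
exists (- l / 2 / (1 + tau)) => //= s' /= ss'.
apply: (leq_trans _ (@orank_mono s s' (l / 2) 0 _)).
  rewrite -(rmin_lt A hm hn) -[ltLHS]lnK ?posrE//.
  by rewrite ltr_expR -/l; lra.
rewrite distrC; have := ltW ss'; rewrite ler_pdivlMr; last by rewrite ltr_wpDr.
lra.
Qed.

Lemma orank_measurable : measurable_fun setT (fun s => (orank A tau s 0)%:R : R).
Proof.
have -> : (fun s => (orank A tau s 0)%:R : R) =
    (fun s => \sum_(i < m + n) \1_[set s | (i < orank A tau s 0)%N] s).
  apply/funext => s; have od : (orank A tau s 0 <= m + n)%N by exact: rank_leq_col.
  rewrite -{1}(card_ltn_ord od) -sum1_card natr_sum big_mkcond /=.
  apply: eq_bigr => i _; rewrite indicE inE /=.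
  by case: ltnP => io; [rewrite mem_set|rewrite memNset// => /=; apply/negP; rewrite -leqNgt].
by apply: measurable_sum => i; apply: measurable_realfun.measurable_indic; apply: measurable_realfun.open_measurable; exact: orank_open.
Qed.

Let f (S : R) : R := (small_minima_count A tau S)%:R / S.

Let fE S : 0 < S -> f S = (orank A tau (ln S) 0)%:R / S.
Proof. by move=> S0; rewrite /f -small_minima_orank lnK. Qed.

Let f_bound S : 1 <= S -> 0 <= f S <= (m + n)%:R.
Proof.
move=> S1; have S0 : 0 < S by exact: lt_le_trans S1.
rewrite fE//; apply/andP; split; first by rewrite divr_ge0// ltW.
rewrite ler_pdivrMr// -[leLHS]mulr1; apply: ler_pM => //.
by rewrite ler_nat rank_leq_col.
Qed.

Let f_integrable b : lebesgue_measure.-integrable `[1, b] (EFin \o f).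
Proof.
apply: measurable_bounded_integrable => //.
- by rewrite /= lebesgue_measure_itv /=; case: ifP => _; rewrite ?ltry.
(* On the interval the inverse is written [expR (- ln S)], which makes the integrand a combination
   of functions measurable on the whole line. *)
- apply: (@eq_measurable_fun _ _ _ _ _ (fun S => (orank A tau (ln S) 0)%:R * expR (- ln S))).
    move=> S /set_mem; rewrite /= in_itv /= => /andP[S1 _].
    have S0 : 0 < S by exact: lt_le_trans S1.
    by rewrite fE// expRN lnK.
  apply: measurable_funS (@measurableT _ _) (@subsetT _ _) _.
  apply: measurable_realfun.measurable_funM.
    by apply: (measurableT_comp orank_measurable); exact: measurable_realfun.measurable_ln.
  apply: (measurableT_comp (measurable_realfun.continuous_measurable_fun (@continuous_expR R))).
  by apply: measurableT_comp => //; exact: measurable_realfun.measurable_ln.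
- exists (m + n)%:R; split; first by rewrite num_real.
  move=> x dx S /=; rewrite in_itv /= => /andP[S1 _].
  have /andP[f0 fd] := f_bound S1.
  by rewrite ger0_norm//; apply: le_trans fd (ltW dx).
Qed.

Lemma integral_inv (a b : R) : 0 < a -> a < b ->
  \int[lebesgue_measure]_(S in `[a, b]) S^-1 = ln b - ln a.
Proof.
move=> a0 ab; have pos x : a <= x -> 0 < x by exact: lt_le_trans.
rewrite /Rintegral (@continuous_FTC2 _ (fun x => x^-1) (@ln R))//.
- apply: continuous_in_subspaceT => x /set_mem; rewrite /= in_itv /= => /andP[ax _].
  by apply: inv_continuous; rewrite gt_eqF// pos.
- split.
  + move=> x; rewrite in_itv /= => /andP[ax _].
    by have [] := is_derive1_ln (pos _ (ltW ax)).
  + by apply: cvg_at_right_filter; exact: continuous_ln.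
  + by apply: cvg_at_left_filter; apply: continuous_ln; exact: pos (ltW ab).
- move=> x; rewrite in_itv /= => /andP[ax _].
  have [dx dE] := is_derive1_ln (pos _ (ltW ax)).
  by rewrite derive1E dE.
Qed.

Definition minima_integral s : R := \int[lebesgue_measure]_(S in `[1, expR s]) f S.

Lemma minima_integral0 : minima_integral 0 = 0.
Proof. by rewrite /minima_integral expR0 set_itv1 Rintegral_set1. Qed.

Let inv_integrable (a b : R) : 0 < a -> lebesgue_measure.-integrable `[a, b] (EFin \o (fun S : R => S^-1)).
Proof.
move=> a0; apply: continuous_compact_integrable; first exact: segment_compact.
apply: continuous_in_subspaceT => x /set_mem; rewrite /= in_itv /= => /andP[ax _].
by apply: inv_continuous; rewrite gt_eqF// (lt_le_trans a0).
Qed.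

Let minima_integralB s s' : 0 <= s -> s < s' -> minima_integral s' - minima_integral s =
  \int[lebesgue_measure]_(S in `[expR s, expR s']) f S.
Proof.
move=> s0 ss'; rewrite /minima_integral.
have s1 : 1 <= expR s by rewrite -expR0 ler_expR.
have ee : expR s <= expR s' by rewrite ler_expR ltW.
rewrite Rintegral_itvB ?bnd_simp//.
rewrite Rintegral_itv_obnd_cbnd//.
apply: integrableS (f_integrable (expR s')) => //.
by apply: subset_itv; rewrite bnd_simp.
Qed.

Let sub_integrable s s' : 0 <= s -> lebesgue_measure.-integrable `[expR s, expR s'] (EFin \o f).
Proof.
move=> s0; apply: integrableS (f_integrable (expR s')) => //.
by apply: subset_itv; rewrite bnd_simp// -expR0 ler_expR.
Qed.

Lemma minima_integral_cst (c : nat) s s' : 0 <= s -> s <= s' ->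
  (forall x, s <= x <= s' -> orank A tau x 0 = c) ->
  minima_integral s' - minima_integral s = c%:R * (s' - s).
Proof.
move=> s0; rewrite le_eqVlt => /orP[/eqP ->|ss'] H; first by rewrite !subrr mulr0.
rewrite minima_integralB//.
transitivity (\int[lebesgue_measure]_(S in `[expR s, expR s']) (c%:R * S^-1)).
  apply: eq_Rintegral => S /set_mem; rewrite /= in_itv /= => /andP[sS Ss].
  have S0 : 0 < S by apply: lt_le_trans sS; exact: expR_gt0.
  rewrite fE//; congr (_%:R / _); apply: H.
  have lS : expR (ln S) = S by exact: lnK.
  by apply/andP; split; rewrite -ler_expR lS.
rewrite RintegralZl//; last exact: inv_integrable (expR_gt0 _).
by rewrite integral_inv ?expR_gt0 ?ltr_expR// !expRK.
Qed.

Lemma minima_integral_bounds s s' : 0 <= s -> s <= s' ->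
  0 <= minima_integral s' - minima_integral s <= (m + n)%:R * (s' - s).
Proof.
move=> s0; rewrite le_eqVlt => /orP[/eqP ->|ss']; first by rewrite !subrr mulr0 lexx.
have s1 : 1 <= expR s by rewrite -expR0 ler_expR.
rewrite minima_integralB//; apply/andP; split.
  apply: Rintegral_ge0 => S /=; rewrite in_itv /= => /andP[sS _].
  by have /andP[] := f_bound (le_trans s1 sS).
rewrite -[X in _ * (X - _)]expRK -[X in _ * (_ - X)]expRK.
rewrite -integral_inv ?expR_gt0 ?ltr_expR// -RintegralZl//; last exact: inv_integrable (expR_gt0 _).
apply: le_Rintegral => //; first exact: sub_integrable.
  apply: continuous_compact_integrable; first exact: segment_compact.
  apply: continuous_in_subspaceT => x /set_mem; rewrite /= in_itv /= => /andP[ax _].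
  apply: (@continuousM _ _ (fun=> (m + n)%:R) (fun S : R => S^-1)); first exact: cst_continuous.
  by apply: inv_continuous; rewrite gt_eqF// (lt_le_trans _ ax)// expR_gt0.
move=> S /=; rewrite in_itv /= => /andP[sS _].
have S0 : 0 < S by apply: lt_le_trans sS; exact: expR_gt0.
rewrite fE// ler_wpM2r ?invr_ge0 ?(ltW S0)// ler_nat; exact: rank_leq_col.
Qed.

End RankIntegral.

(** * The numerator of the formula on windows *)

Section FormulaData.
Context (R : realType) (m n : nat) (A : 'M[R]_(m, n)).
Hypotheses (hm : (0 < m)%N) (hn : (0 < n)%N).
Implicit Types (s u tau : R).

Lemma lcount_time tau s s' : 0 <= tau -> lcount A tau s' 0 <=
  lcount A tau s 0 + (m + n)%:R * ((1 + tau) * `|s' - s|) + lconst R m n.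
Proof.
move=> t0; set u := (1 + tau) * _.
have u0 : 0 <= u by rewrite mulr_ge0 ?addr_ge0.
have : lcount A tau s' 0 <= lcount A tau s u.
  rewrite /lcount ler_ln ?posrE ?ltr0n ?inbox_gt0// ler_nat; apply: ncard_le.
    exact: inbox_finite.
  by apply: inbox_mono => //; rewrite subrr mul0r normr0 addr0 add0r distrC.
move=> /le_trans; apply; apply: le_trans (lcount_dim A tau s u0) _.
by rewrite subr0.
Qed.

Lemma lcount_exponent tau tau' s : 0 <= tau -> lcount A tau s 0 <=
  lcount A tau' s 0 + (m + n)%:R * `|(tau' - tau) * s| + lconst R m n.
Proof.
move=> t0; set u := `|_|; have u0 : 0 <= u := normr_ge0 _.
have : lcount A tau s 0 <= lcount A tau' s u.
  rewrite /lcount ler_ln ?posrE ?ltr0n ?inbox_gt0// ler_nat; apply: ncard_le.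
    exact: inbox_finite.
  by apply: inbox_mono => //; rewrite subrr normr0 mulr0 !add0r.
move=> /le_trans; apply; apply: le_trans (lcount_dim A tau' s u0) _.
by rewrite subr0.
Qed.

Lemma minima_prod_ge1 tau s : 1 <= minima_prod A tau s.
Proof.
rewrite /minima_prod; elim/big_ind: _ => // [x y x1 y1|i _].
  exact: mulr_ege1.
by rewrite le_max lexx orbT.
Qed.

Definition lminima_const : R := (m + n)%:R * ln (minima_const R m n).

Lemma lminima tau s : `|ln (minima_prod A tau s) - lcount A tau s 0| <= lminima_const.
Proof.
have [h1 h2] := count_minima A hm hn tau s.
have N0 : (0 : R) < (ncard (inbox A tau s 0))%:R by rewrite ltr0n inbox_gt0.
have M0 : 0 < minima_prod A tau s by exact: lt_le_trans (minima_prod_ge1 _ _).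
have c0 : 0 < minima_const R m n by exact: lt_le_trans (minima_const_ge1 R m n).
have lE : lminima_const = ln (minima_const R m n ^+ (m + n)) by rewrite /lminima_const mulr_natl lnXn.
have c0' : 0 < minima_const R m n ^+ (m + n) by rewrite exprn_gt0.
have l1 : lcount A tau s 0 <= lminima_const + ln (minima_prod A tau s).
  by rewrite lE -lnM ?posrE// ler_ln ?posrE// mulr_gt0.
have l2 : ln (minima_prod A tau s) <= lminima_const + lcount A tau s 0.
  by rewrite lE -lnM ?posrE// ler_ln ?posrE// mulr_gt0.
by rewrite ler_norml; apply/andP; split; lra.
Qed.

(* The numerator of the dimension formula at T = e^s. *)
Definition gain tau s : R := minima_integral A tau s - ln (minima_prod A tau s).

Lemma box_countE tau s : box_count A (expR s `^ (- tau)) (expR s) = minima_prod A tau s.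
Proof.
have m0 : m%:R != 0 :> R by rewrite pnatr_eq0 -lt0n.
have n0 : n%:R != 0 :> R by rewrite pnatr_eq0 -lt0n.
have d0 : m%:R + n%:R != 0 :> R by rewrite -natrD pnatr_eq0 -lt0n addn_gt0 hm.
have rE : expR s `^ (- tau) = expR (- tau * s) by rewrite /powR gt_eqF ?expR_gt0// expRK.
rewrite /box_count rE; apply: eq_bigr => i _; congr (Num.max _ 1).
have -> : box_time m n (expR (- tau * s)) (expR s) = flow_time m n tau s.
  by rewrite /box_time /flow_time -expRB expRK natrD natrM; field.
rewrite /rmin invf_div; congr (_ / _).
rewrite /flow_unit /powR !gt_eqF ?expR_gt0// !expRK -expRD; congr expR.
by rewrite natrD; field.
Qed.

Lemma gainE tau T : 0 < T -> \int[lebesgue_measure]_(S in `[1, T]) ((small_minima_count A tau S)%:R / S)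
      - ln (box_count A (T `^ (- tau)) T) = gain tau (ln T).
Proof.
move=> T0; rewrite /gain -box_countE /minima_integral.
by rewrite lnK.
Qed.

Lemma gain_time tau s s' : 0 <= tau -> 0 <= s <= s' ->
  `|gain tau s' - gain tau s| <=
    (m + n)%:R * (2 + tau) * (s' - s) + (lconst R m n + 2 * lminima_const).
Proof.
move=> t0 /andP[s0 ss']; have b := minima_integral_bounds A hm hn t0 s0 ss'.
have h1 := lcount_time s s' t0; have h2 := lcount_time s' s t0.
rewrite distrC in h2; rewrite (ger0_norm (_ : 0 <= s' - s)) ?subr_ge0// in h1 h2.
have l1 := lminima tau s; have l2 := lminima tau s'.
have e : (m + n)%:R * ((1 + tau) * (s' - s)) + (m + n)%:R * (s' - s) = (m + n)%:R * (2 + tau) * (s' - s).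
  by ring.
rewrite -e /gain; move: b h1 h2 l1 l2; move: ((m + n)%:R * (s' - s)) ((m + n)%:R * _).
move: (minima_integral _ _ _) (minima_integral _ _ _) (ln _) (ln _) (lcount _ _ _ _) (lcount _ _ _ _).
move: (lconst R m n) lminima_const => x1 x2 x3 x4 x5 x6 x7 x8 x9 x10.
rewrite !ler_norml => /andP[? ?] ? ? /andP[? ?] /andP[? ?]; apply/andP; split; lra.
Qed.

Lemma gain_le tau s : 0 <= tau -> 0 <= s ->
  `|gain tau s| <= (m + n)%:R * (2 + tau) * s + (lconst R m n + 2 * lminima_const + `|gain tau 0|).
Proof.
move=> t0 s0; have := @gain_time tau 0 s t0; rewrite lexx s0 subr0 => /(_ isT) h.
rewrite -[gain tau s](subrK (gain tau 0)); apply: (le_trans (ler_normD _ _)).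
by rewrite addrA lerD2r.
Qed.

End FormulaData.

Lemma count_iotaS (Q : pred nat) K : count Q (iota 0 K.+1) = (count Q (iota 0 K) + Q K)%N.
Proof. by rewrite -addn1 iotaD count_cat /= addn0. Qed.

Lemma count_succ (Q : pred nat) K :
  (count (fun k => Q k.+1) (iota 0 K) <= count Q (iota 0 K.+1))%N.
Proof.
suff H : (count (fun k => Q k.+1) (iota 0 K) + Q 0 = count Q (iota 0 K.+1))%N by rewrite -H leq_addr.
elim: K => [|K IH]; first by rewrite /= addn0.
rewrite (count_iotaS (fun k => Q k.+1) K) (count_iotaS Q K.+1) -IH.
by rewrite -!addnA; congr (_ + _)%N; exact: addnC.
Qed.

(** Between two indices of [c] the sequence [a] only increases and is bounded by [d], so it jumps
    there at most [d] times. *)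
Lemma count_jumps (c : pred nat) (a : nat -> nat) (d K1 : nat) :
  (forall k, (a k <= d)%N) ->
  (forall k, (K1 <= k)%N -> ~~ c k -> ~~ c k.+1 -> (a k <= a k.+1)%N) ->
  forall K, (count (fun k => [&& (K1 <= k)%N, ~~ c k, ~~ c k.+1 & a k != a k.+1]) (iota 0 K)
    <= d * count c (iota 0 K.+1) + d)%N.
Proof.
move=> ad am; set J := fun k => _.
have Z K : (K <= K1)%N -> count J (iota 0 K) = 0%N.
  elim: K => [//|K IH] kK; rewrite count_iotaS IH ?(ltnW kK)// /J leqNgt kK//.
(* The invariant stores the jumps made since the last index of [c] in the current value [a K]. *)
have H K : (count J (iota 0 K) <= d * count c (iota 0 K.+1) + (if c K then 0 else a K))%N.
  elim: K => [//|K IH]; have [kK|/Z -> //] := leqP K1 K.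
  rewrite count_iotaS (count_iotaS c K.+1).
  set X := count c (iota 0 K.+1) in IH *; rewrite mulnDr.
  have aK := ad K; have aK1 := ad K.+1.
  have -> : J K = [&& ~~ c K, ~~ c K.+1 & a K != a K.+1] by rewrite /J kK.
  move: IH; move: (count J _) => y IH.
  have := am K kK; case: (c K) IH; case: (c K.+1) => //= IH amK; rewrite ?muln1 ?muln0 ?addn0 ?addn1.
  - by lia.
  - by lia.
  - by lia.
  - by have := amK isT isT; case: eqP => /=; lia.
move=> K; apply: leq_trans (H K) _; rewrite leq_add2l.
by case: ifP.
Qed.

(** * Windows of a grid of times at a regular exponent *)

Section Structure.
Context (R : realType) (m n : nat) (A : 'M[R]_(m, n)).
Hypotheses (hm : (0 < m)%N) (hn : (0 < n)%N).
Context (tau : R).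
Hypothesis tau_reg : regular_exponents R m n tau.
Implicit Types (s u : R).

Local Notation W := (Vsp A tau).
Local Notation d := ((m + n)%:R : R).

Let tau0 : 0 <= tau. Proof. exact/ltW/(tau_gt0 tau_reg). Qed.

(* The exponent [tau'] is allowed to differ from [tau]: this is what gives continuity in tau. *)
Lemma window_rank eta tau' s s' h : 0 <= tau' -> ~ critical A tau eta s ->
  0 <= s -> s <= s' <= s + h ->
  (1 + tau) * h + `|tau' - tau| * s' < eta * s ->
  (1 + tau') * h + `|tau' - tau| * s <= eta * s ->
  orank A tau' s' 0 = \rank (W s (eta * s)).
Proof.
move=> t'0 /contrapT ncr s0 /andP[ss' s'h] c1 c2; have s'0 : 0 <= s' by exact: le_trans ss'.
have dh : `|s' - s| <= h by rewrite ger0_norm ?subr_ge0//; lra.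
apply/eqP; rewrite eqn_leq; apply/andP; split.
  apply: (leq_trans (orank_le _ _ _ _)); apply/mxrankS/Vsp_le/inbox_mono => //.
  rewrite add0r; apply: le_trans c2; apply: lerD.
    by rewrite distrC ler_wpM2l// addr_ge0.
  by rewrite normrM (ger0_norm s0) distrC.
rewrite -ncr; pose u := - (eta * s) + (1 + tau) * h + `|tau' - tau| * s'.
have u0 : u < 0 by rewrite /u; lra.
apply: leq_trans (le_orank A tau' s' u0); apply/mxrankS/Vsp_le/inbox_mono => //.
rewrite /u normrM (ger0_norm s'0) !lerD2r lerD2l ler_wpM2l// addr_ge0//.
Qed.

Section Grid.
Context (h eta : R) (K1 : nat).
Hypotheses (h0 : 0 < h) (eta0 : 0 < eta) (K10 : (0 < K1)%N)
  (K1eta : 4 * (1 + tau) <= eta * K1%:R).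

Local Notation sk k := (h * k%:R).

Definition crit k : bool := `[< critical A tau eta (sk k) >].
Definition Vk k := W (sk k) (eta * sk k).
Definition ak k := xtype (Vk k) (theta tau (sk k)).
(* On a good window [sk k, sk k.+1] neither the span of the box nor the number of x-coordinates
   among its dominating ones changes. *)
Definition good k : bool :=
  [&& (K1 <= k)%N, ~~ crit k, ~~ crit k.+1 & ak k == ak k.+1].

Let sk0 k : 0 <= sk k. Proof. by rewrite mulr_ge0// ltW. Qed.

Let skS k : sk k.+1 = sk k + h. Proof. by rewrite -natr1 mulrDr mulr1. Qed.

(** The purpose of [K1]: from there on, moving by one window costs at most a quarter of
    [eta * sk k]. *)
Lemma large_window k : (K1 <= k)%N -> 4 * (1 + tau) * h <= eta * sk k /\ h <= sk k.
Proof.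
move=> Kk; split.
  rewrite mulrCA [leLHS]mulrC ler_pM2l//; apply: (le_trans K1eta).
  by rewrite ler_pM2l// ler_nat.
by rewrite -[leLHS]mulr1 ler_pM2l// ler1n (leq_trans K10).
Qed.

Lemma noncritE k : ~~ crit k -> W (sk k) (- (eta * sk k)) = Vk k.
Proof. by move=> /asboolP; rewrite /critical => /contrapT. Qed.

(** At a noncritical time the span equals its version at level [-eta s], and one window is too short
    to push that one beyond the version at level [eta s] of the neighbouring time. *)
Lemma Vk_next k : (K1 <= k)%N -> ~~ crit k -> ~~ crit k.+1 -> Vk k = Vk k.+1.
Proof.
move=> Kk nk nk1; have [l1 l2] := large_window Kk.
have eh : 0 < eta * h by rewrite mulr_gt0.
have t1 : 0 <= tau * h by rewrite mulr_ge0// ltW.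
have f1 : - (eta * sk k) + (1 + tau) * h <= eta * sk k + eta * h.
  have z0 : 0 <= (1 + tau) * h by rewrite mulr_ge0 ?addr_ge0// ltW.
  have := eh; have := l1; rewrite -mulrA; move: ((1 + tau) * h) z0 (eta * sk k) (eta * h) => z z0 x y l1' eh'; lra.
apply: Vsp_anti; [rewrite -/(Vk k) -(noncritE nk)|rewrite -/(Vk k.+1) -(noncritE nk1)];
  apply: (Vsp_sqz _ tau_reg); rewrite skS mulrDr.
  by rewrite (_ : sk k + h - sk k = h) ?(gtr0_norm h0)//; ring.
rewrite (_ : sk k - (sk k + h) = - h); last by ring.
rewrite normrN (gtr0_norm h0).
have z0 : 0 <= (1 + tau) * h by rewrite mulr_ge0 ?addr_ge0// ltW.
have := eh; have := l1; rewrite -mulrA; move: ((1 + tau) * h) z0 (eta * sk k) (eta * h) => z z0 x y l1' eh'; lra.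
Qed.

Lemma Vk0 k : ~~ crit k -> W (sk k) 0 = Vk k.
Proof.
move=> nk; have es : 0 <= eta * sk k by rewrite mulr_ge0// ltW.
apply: Vsp_anti; first by apply: (Vsp_sqz _ tau_reg); rewrite subrr normr0 mulr0 addr0.
rewrite -/(Vk k) -(noncritE nk); apply: (Vsp_sqz _ tau_reg).
by rewrite subrr normr0 mulr0 addr0 oppr_le0.
Qed.

Lemma ak_next_le k : (K1 <= k)%N -> ~~ crit k -> ~~ crit k.+1 -> (ak k <= ak k.+1)%N.
Proof.
move=> Kk nk nk1; rewrite /ak -(Vk_next Kk nk nk1); apply: xtype_le; first exact: theta_gt0.
by rewrite /theta ltr_expR ltr_pM2l ?skS ?ltrDl// ltr_wpDr.
Qed.

Lemma ak_le k : (ak k <= m)%N.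
Proof. by have [] := xtype_bounds (Vk k) (theta_gt0 tau (sk k)). Qed.

(** A bad window starts before [K1], has a critical end or sees the type jump; the jumps are charged
    to the critical times by [count_jumps]. *)
Lemma count_bad K : (count (fun k => ~~ good k) (iota 0 K) <=
  K1 + (2 + m) * count crit (iota 0 K.+1) + m)%N.
Proof.
pose J k := [&& (K1 <= k)%N, ~~ crit k, ~~ crit k.+1 & ak k != ak k.+1].
have hJ := count_jumps ak_le ak_next_le K.
have sub k : (~~ good k <= (k < K1)%N + crit k + crit k.+1 + J k)%N.
  rewrite /good /J ltnNge; case: (K1 <= k)%N => //; case: (crit k) => //.
  by case: (crit k.+1) => //=; case: eqP.
have h1 : (count (fun k => ~~ good k) (iota 0 K) <= count (fun k => k < K1)%N (iota 0 K) +
    count crit (iota 0 K) + count (fun k => crit k.+1) (iota 0 K) + count J (iota 0 K))%N.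
  elim: K {hJ} => [//|K IH]; rewrite !count_iotaS; have := sub K; move: IH.
  move: (count _ _) (count _ _) (count _ _) (count _ _) (count _ _) => *; lia.
have h2 : (count (fun k => k < K1)%N (iota 0 K) <= K1)%N.
  rewrite -size_filter -[leqRHS](size_iota 0); apply: uniq_leq_size.
    by rewrite filter_uniq// iota_uniq.
  by move=> k; rewrite mem_filter !mem_iota /= => /andP[].
have h3 := count_succ crit K.
have h4 : (count crit (iota 0 K) <= count crit (iota 0 K.+1))%N.
  by rewrite count_iotaS leq_addr.
apply: (leq_trans h1); rewrite -/J in hJ.
move: h2 h3 h4 hJ; move: (count _ _) (count _ _) (count _ _) (count _ _) (count _ _) => *.
nia.
Qed.

(** The integral is taken at [tau'] but the sum uses the spans at [tau]. Nearby exponents thus share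
    one main term, which cancels in [gain_exponent]. *)
Lemma integral_windows tau' : 0 <= tau' -> `|tau' - tau| <= eta / 8 -> forall K,
  `|minima_integral A tau' (sk K) - h * \sum_(k < K) (if crit k then 0 else \rank (Vk k))%:R|
    <= d * h * ((count crit (iota 0 K))%:R + K1%:R).
Proof.
move=> t'0 tt'; have dh0 : 0 <= d * h by rewrite mulr_ge0// ltW.
have H K : `|minima_integral A tau' (sk K) - h * \sum_(k < K) (if crit k then 0 else \rank (Vk k))%:R|
    <= d * h * ((count crit (iota 0 K))%:R + (count (fun k => k < K1)%N (iota 0 K))%:R).
  elim: K => [|K IH].
    by rewrite mulr0 minima_integral0 big_ord0 mulr0 subrr normr0 mulr_ge0// addr_ge0.
  rewrite (count_iotaS crit K) (count_iotaS (fun k => k < K1)%N K)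
    (natrD _ (count crit _)) (natrD _ (count _ _)) big_ord_recr /=.
  set I := minima_integral _ _ _; set I' := minima_integral A tau' (sk K) in IH.
  set S := \sum_(k < K) _ in IH *.
  have b := minima_integral_bounds A hm hn t'0 (sk0 K) (_ : sk K <= sk K.+1).
  rewrite skS lerDl ltW// -skS in b; have {}b := b isT.
  have eb : sk K.+1 - sk K = h by rewrite skS addrAC subrr add0r.
  rewrite eb -/I -/I' in b.
  have rd : (\rank (Vk K))%:R <= d by rewrite ler_nat rank_leq_col.
  have rdh : h * (\rank (Vk K))%:R <= d * h by rewrite mulrC ler_wpM2r// ltW.
  have r0 : 0 <= h * (\rank (Vk K))%:R by rewrite mulr_ge0// ltW.
  set r := (if _ then _ else _)%:R.
  have step : `|(I - I') - h * r| <= d * h * ((crit K)%:R + (K < K1)%:R).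
    have step1 : `|(I - I') - h * r| <= d * h.
      rewrite /r; case: ifP => _; rewrite ler_norml; apply/andP; move: b => /andP[]; split; lra.
    have [cK|ncK] := boolP (crit K).
      by apply: (le_trans step1); rewrite ler_peMr//= lerDl.
    have [KK|KK] := ltnP K K1.
      by apply: (le_trans step1); rewrite ler_peMr//= lerDr.
    rewrite addr0 mulr0 normr_le0 subr_eq0; apply/eqP.
    have [l1 l2] := large_window KK.
    have eh : 0 < eta * h by rewrite mulr_gt0.
    have ehs : eta * h <= eta * sk K by rewrite ler_pM2l.
    have th : 0 <= tau * h by rewrite mulr_ge0// ltW.
    have tt1 : `|tau' - tau| * sk K <= eta / 8 * sk K by rewrite ler_wpM2r.
    have tt2 : `|tau' - tau| * h <= eta / 8 * h by rewrite ler_wpM2r// ltW.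
    have tt3 : (tau' - tau) * h <= `|tau' - tau| * h by rewrite ler_wpM2r ?ler_norm// ltW.
    have E1 : eta / 8 * sk K = (eta * sk K) / 8 by field.
    have E2 : eta / 8 * h = (eta * h) / 8 by field.
    rewrite /r (negbTE ncK) mulrC.
    rewrite /I /I' (@minima_integral_cst _ _ _ A hm hn _ t'0 (\rank (Vk K)))//; last first.
    - move=> x /andP[x1 x2]; apply: (@window_rank eta tau' (sk K) x h) => //.
      + by move: ncK => /asboolP.
      + by rewrite x1 -skS.
      + have xs : `|tau' - tau| * x <= `|tau' - tau| * (sk K + h).
          by rewrite ler_wpM2l// -skS.
        by rewrite mulrDr in xs; lra.
      + lra.
    - by rewrite skS lerDl ltW.
    - by rewrite skS [sk K + h - _]addrAC subrr add0r.
  rewrite (_ : I - h * (S + r) = (I' - h * S) + ((I - I') - h * r)); last by ring.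
  apply: (le_trans (ler_normD _ _)); apply: (le_trans (lerD IH step)).
  by rewrite -mulrDr; rewrite le_eqVlt; apply/orP; left; apply/eqP; congr (_ * _); ring.
move=> K; apply: (le_trans (H K)); rewrite ler_wpM2l// lerD2l ler_nat.
rewrite -size_filter -[leqRHS](size_iota 0); apply: uniq_leq_size.
  by rewrite filter_uniq// iota_uniq.
by move=> k; rewrite mem_filter !mem_iota /= => /andP[].
Qed.

Lemma gain_exponent tau' K : 0 <= tau' -> `|tau' - tau| <= eta / 8 ->
  `|gain A tau' (sk K) - gain A tau (sk K)| <=
    2 * (d * h * ((count crit (iota 0 K))%:R + K1%:R)) + d * (`|tau' - tau| * sk K) +
    (lconst R m n + 2 * lminima_const R m n).
Proof.
move=> t'0 tt'.
have i1 := integral_windows t'0 tt' K.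
have i2 : `|tau - tau| <= eta / 8 by rewrite subrr normr0 divr_ge0// ltW.
have {}i2 := integral_windows tau0 i2 K.
have c1 := lcount_exponent A tau' (sk K) tau0.
have c2 := lcount_exponent A tau (sk K) t'0.
rewrite normrM distrC (ger0_norm (sk0 K)) in c2; rewrite normrM (ger0_norm (sk0 K)) in c1.
have l1 := lminima A hm hn tau (sk K); have l2 := lminima A hm hn tau' (sk K).
rewrite /gain; move: i1 i2 c1 c2 l1 l2.
move: (d * h * _) (d * (_ * _)) (h * \sum_(_ < _) _) (lconst _ _ _) (lminima_const _ _ _).
move: (minima_integral _ _ _) (minima_integral _ _ _) (ln _) (ln _) (lcount _ _ _ _) (lcount _ _ _ _).
move=> x1 x2 x3 x4 x5 x6 x7 x8 x9 x10 x11.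
rewrite !ler_norml => /andP[? ?] /andP[? ?] ? ? /andP[? ?] /andP[? ?]; apply/andP; split; lra.
Qed.

(** Main term of the numerator divided by [1 + tau]. Up to errors, [tau] times it is also the
    logarithm of the number of pieces, in the cover as well as in the tree. *)
Definition hsum K : R := h * \sum_(k < K) (if good k then ak k else 0)%:R.

Lemma lcount_good k : good k ->
  `|lcount A tau (sk k.+1) 0 - lcount A tau (sk k) 0
    - (h * (\rank (Vk k))%:R - (1 + tau) * (h * (ak k)%:R))| <= lconst R m n.
Proof.
move=> /and4P[Kk nk nk1 /eqP aa].
have V1 : Vk k = W (sk k) 0 by rewrite Vk0.
have V2 : Vk k = W (sk k.+1) 0 by rewrite (Vk_next Kk nk nk1) Vk0.
have aa' : xtype (Vk k) (theta tau (sk k)) = xtype (Vk k) (theta tau (sk k.+1)).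
  by rewrite {2}(Vk_next Kk nk nk1) -/(ak k.+1) -aa.
have := lcount_slope V1 V2 aa'; rewrite -/(ak k).
have [_ _ ar] := xtype_bounds (Vk k) (theta_gt0 tau (sk k)).
rewrite natrB// !sub0r !add0r skS.
congr (`|_ - _| <= _); rewrite -/(ak k); ring.
Qed.

Lemma lcount_bad k : `|lcount A tau (sk k.+1) 0 - lcount A tau (sk k) 0| <=
  d * h * (1 + tau) + lconst R m n.
Proof.
have h1 := lcount_time A (sk k) (sk k.+1) tau0; have h2 := lcount_time A (sk k.+1) (sk k) tau0.
have e : sk k.+1 - sk k = h by rewrite skS addrAC subrr add0r.
rewrite distrC e in h2; rewrite e in h1; rewrite (gtr0_norm h0) in h1 h2.
rewrite (_ : d * h * (1 + tau) = d * ((1 + tau) * h)); last by ring.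
move: h1 h2; move: (d * _) (lconst _ _ _) (lcount _ _ _ _) (lcount _ _ _ _) => x1 x2 x3 x4 h1 h2.
by rewrite ler_norml; apply/andP; split; lra.
Qed.

(** A good window adds [h * rank] to the integral and [h * rank - (1 + tau) * h * a] to the
    log-count, up to [lconst]; a window that is not good costs O(h). *)
Lemma gain_windows K : `|gain A tau (sk K) - (1 + tau) * hsum K| <=
  lconst R m n * K%:R + d * h * (3 + tau) * ((count (fun k => ~~ good k) (iota 0 K))%:R + K1%:R)
  + (lcount A tau 0 0 + lminima_const R m n).
Proof.
have dh0 : 0 <= d * h by rewrite mulr_ge0// ltW.
have L0 := lconst_ge0 R m n.
have dht : 0 <= d * h * tau by rewrite mulr_ge0.
have H : `|lcount A tau (sk K) 0 - (h * (\sum_(k < K) (if crit k then 0 else \rank (Vk k))%:R) - (1 + tau) * hsum K)|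
    <= lcount A tau 0 0 + lconst R m n * K%:R
       + d * h * (2 + tau) * (count (fun k => ~~ good k) (iota 0 K))%:R.
  elim: K => [|K IH].
    by rewrite /hsum !big_ord0 !mulr0 !subr0 !addr0 ger0_norm// lcount_ge0.
  rewrite (count_iotaS (fun k => ~~ good k) K) (natrD _ (count _ _)).
  have -> : lconst R m n * K.+1%:R = lconst R m n * K%:R + lconst R m n by rewrite -natr1 mulrDr mulr1.
  rewrite /hsum !big_ord_recr /= -/(hsum K) (mulrDr h _ (if good K then _ else _)%:R) -/(hsum K).
  set S := \sum_(k < K) _ in IH *.
  set r := (if crit K then _ else _)%:R; set g := (if good K then _ else _)%:R.
  have rd : h * (\rank (Vk K))%:R <= d * h.
    by rewrite mulrC ler_wpM2r ?ler_nat ?rank_leq_col// ltW.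
  have hr0 : 0 <= h * (\rank (Vk K))%:R by rewrite mulr_ge0// ltW.
  have step : `|lcount A tau (sk K.+1) 0 - lcount A tau (sk K) 0 - (h * r - (1 + tau) * (h * g))|
     <= lconst R m n + d * h * (2 + tau) * (~~ good K)%:R.
    rewrite /r /g; have [gK|ngK] := boolP (good K).
      have := lcount_good gK; case/and4P: gK => _ /negbTE -> _ _.
      by rewrite mulr0 addr0.
    have hr : 0 <= h * (if crit K then 0 else \rank (Vk K))%:R <= d * h.
      by case: ifP => _; rewrite ?mulr0 ?lexx ?hr0.
    have := lcount_bad K; move: hr => /andP[].
    rewrite !mulr0 /= mulr1 subr0 !mulrDr mulr1; move: dh0 dht.
    move: (h * _) (d * h * tau) (d * h) (lcount _ _ _ _) (lcount _ _ _ _) (lconst _ _ _).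
    move=> x1 x2 x3 x4 x5 x6 ? ? ? ?; rewrite !ler_norml => /andP[? ?]; apply/andP; split; lra.
  move: IH step; move: (lcount _ _ (sk K.+1) _) (lcount _ _ (sk K) _) (lcount _ _ 0 0) => x y z.
  rewrite (mulrDr (d * h * (2 + tau))) (mulrDr h S) (mulrDr (1 + tau)).
  move: (h * S) (h * r) ((1 + tau) * hsum K) ((1 + tau) * (h * g)) => x1 x2 x3 x4.
  move: (lconst R m n * K%:R) (d * h * (2 + tau) * (count _ _)%:R) (d * h * (2 + tau) * (~~ good K)%:R) (lconst R m n) => x5 x6 x7 x8.
  rewrite !ler_norml => /andP[? ?] /andP[? ?]; apply/andP; split; lra.
have i2 : `|tau - tau| <= eta / 8 by rewrite subrr normr0 divr_ge0// ltW.
have {}i2 := integral_windows tau0 i2 K.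
have l1 := lminima A hm hn tau (sk K).
have cc : (count crit (iota 0 K))%:R <= (count (fun k => ~~ good k) (iota 0 K))%:R :> R.
  rewrite ler_nat; apply: sub_count => k ck; rewrite /good ck /= andbF//.
have := ler_wpM2l dh0 cc.
have k1 : 0 <= d * h * (2 + tau) * K1%:R by rewrite mulr_ge0// mulr_ge0// addr_ge0.
rewrite /gain; move: k1 i2 l1 H.
rewrite (_ : d * h * (3 + tau) * _ = d * h * (2 + tau) * K1%:R + d * h * K1%:R +
  d * h * (2 + tau) * (count (fun k => ~~ good k) (iota 0 K))%:R +
  d * h * (count (fun k => ~~ good k) (iota 0 K))%:R); last by ring.
rewrite (mulrDr (d * h) (count crit (iota 0 K))%:R).
move: ((1 + tau) * hsum K) (h * \sum_(_ < _) _) (ln _) (minima_integral _ _ _) (lcount _ _ (sk K) _) (lcount _ _ 0 0).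
move=> y1 y2 y3 y4 y5 y6.
move: (lconst R m n * K%:R) (d * h * (2 + tau) * K1%:R) (d * h * K1%:R) (d * h * (2 + tau) * (count _ _)%:R).
move: (lminima_const _ _ _) (d * h * (count crit _)%:R) => x1 x2 x3 x4 x5 x6; move: (d * h * (count _ _)%:R) => x7.
rewrite !ler_norml => ? /andP[? ?] /andP[? ?] /andP[? ?] ?; apply/andP; split; lra.
Qed.

End Grid.

End Structure.

(** * Asymptotics of the numerator *)

Section Asymptotics.
Context (R : realType) (m n : nat) (A : 'M[R]_(m, n)).
Hypotheses (hm : (0 < m)%N) (hn : (0 < n)%N).
Context (tau : R).
Hypothesis tau_reg : regular_exponents R m n tau.
Implicit Types (s u : R).

Local Notation d := ((m + n)%:R : R).

Let tau0 : 0 <= tau. Proof. exact/ltW/(tau_gt0 tau_reg). Qed.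

Lemma structure (eps h1 : R) : 0 < eps -> 0 < h1 ->
  exists h eta : R, exists2 K1 : nat,
    [/\ h1 <= h, 0 < h, 0 < eta, (0 < K1)%N & 4 * (1 + tau) <= eta * K1%:R] &
  exists C : R, forall K : nat,
    (count (fun k => ~~ good A tau h eta K1 k) (iota 0 K))%:R <= eps * K%:R + C /\
    `|gain A tau (h * K%:R) - (1 + tau) * hsum A tau h eta K1 K| <= eps * (h * K%:R) + C.
Proof.
move=> eps0 h10; have L0 := lconst_ge0 R m n.
pose h := h1 + 2 * lconst R m n / eps.
have h1h : h1 <= h by rewrite lerDl divr_ge0 ?mulr_ge0// ltW.
have h0 : 0 < h by exact: lt_le_trans h1h.
have Lh : lconst R m n <= eps * h / 2.
  rewrite /h mulrDr [eps * (_ / eps)]mulrC divfK ?gt_eqF// mulrDl [2 * _]mulrC mulfK//.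
  by rewrite lerDr divr_ge0// mulr_ge0// ltW.
clearbody h.
pose c2 := d * h * (3 + tau).
have c20 : 0 <= c2 by rewrite !mulr_ge0 ?addr_ge0// ltW.
pose eps1 := Num.min eps (eps * h / (2 * (c2 + 1))) / (2 + m)%:R.
have c21 : 0 < c2 + 1 by rewrite ltr_wpDl.
have m20 : 0 < (2 + m)%:R :> R by rewrite ltr0n.
have eps10 : 0 < eps1.
  by rewrite divr_gt0// lt_min eps0 divr_gt0 ?mulr_gt0.
have e1 : (2 + m)%:R * eps1 <= eps.
  by rewrite /eps1 mulrC divfK ?gt_eqF// ge_min lexx.
have e2 : c2 * ((2 + m)%:R * eps1) <= eps * h / 2.
  rewrite /eps1 [_ * (_ / _)]mulrC divfK ?gt_eqF//.
  have mn0 : 0 <= eps * h / (2 * (c2 + 1)) by rewrite divr_ge0 ?mulr_ge0// ltW.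
  apply: (@le_trans _ _ ((c2 + 1) * (eps * h / (2 * (c2 + 1))))).
    apply: ler_pM; rewrite ?lerDl ?ge_min ?lexx ?orbT// le_min (ltW eps0) mn0//.
  rewrite le_eqVlt; apply/orP; left; apply/eqP; field.
  by rewrite gt_eqF// ltW.
have [eta /andP[eta0 _] [C0 HC]] := critical_sparse A hm hn tau_reg h0 eps10 ltr01.
pose K1 := (Num.truncn (4 * (1 + tau) / eta)).+1.
have K1e : 4 * (1 + tau) <= eta * K1%:R.
  rewrite [leRHS]mulrC -ler_pdivrMr// ltW//; exact: truncnS_gt.
exists h, eta, K1; first by split.
have K10 : (0 < K1)%N by [].
clearbody K1.
pose C2 := (2 + m)%:R * (eps1 + C0) + K1%:R + m%:R.
have HB K : (count (fun k => ~~ good A tau h eta K1 k) (iota 0 K))%:R <= (2 + m)%:R * eps1 * K%:R + C2.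
  have := count_bad A hm hn tau_reg h0 eta0 K10 K1e K; rewrite -(ler_nat R) (natrD _ _ m) (natrD _ K1) natrM.
  move=> /le_trans; apply; rewrite /C2.
  have := ler_wpM2l (ltW m20) (HC K.+1); rewrite -natr1 mulrDr (mulrDr eps1) (mulr1 eps1) -/(crit A tau h eta).
  move: (count _ _)%:R => x; rewrite !mulrDr; move: (2 + m)%:R => y.
  rewrite (mulrA y); move: (y * eps1 * K%:R) (y * x) => z w; lra.
exists (`|C2| + (c2 * (`|C2| + K1%:R) + (lcount A tau 0 0 + lminima_const R m n))) => K.
have lm0 : 0 <= lminima_const R m n by exact: le_trans (lminima A hm hn tau 0).
have l00 := lcount_ge0 A tau 0 0.
have ck0 : 0 <= c2 * (`|C2| + K1%:R) by rewrite mulr_ge0 ?addr_ge0.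
split.
  apply: (le_trans (HB K)); apply: lerD; first by rewrite ler_wpM2r.
  by apply: (le_trans (ler_norm _)); rewrite lerDl addr_ge0// addr_ge0.
apply: (le_trans (gain_windows A hm hn tau_reg h0 eta0 K10 K1e K)); rewrite -/c2.
have i1 : lconst R m n * K%:R <= eps * h / 2 * K%:R by rewrite ler_wpM2r.
have i2 : c2 * (count (fun k => ~~ good A tau h eta K1 k) (iota 0 K))%:R <=
    c2 * ((2 + m)%:R * eps1) * K%:R + c2 * C2.
  by rewrite -mulrA -mulrDr ler_wpM2l// HB.
have i3 : c2 * ((2 + m)%:R * eps1) * K%:R <= eps * h / 2 * K%:R by rewrite ler_wpM2r.
have i4 : c2 * C2 <= c2 * `|C2| by rewrite ler_wpM2l// ler_norm.
have e3 : eps * (h * K%:R) = eps * h / 2 * K%:R + eps * h / 2 * K%:R by field.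
rewrite e3 mulrDr (mulrDr c2 `|C2|).
have n0 : 0 <= `|C2| by [].
move: i1 i2 i3 i4 n0; move: (lconst R m n * K%:R) (eps * h / 2 * K%:R) (_ * K%:R) (c2 * _) (c2 * C2) (c2 * `|C2|).
move=> x1 x2 x3 x4 x5 x6; move: (c2 * _) `|C2| (lcount _ _ _ _) (lminima_const _ _ _) => x7 x8 x9 x10 *; lra.
Qed.

(** Windows of length 1 suffice: the log-counts are compared at the end time only, so no constant is
    lost per window. *)
Lemma gain_near (eps : R) : 0 < eps -> exists2 eta : R, 0 < eta &
  forall tau', `|tau' - tau| <= eta ->
  exists C : R, forall s, 0 <= s -> `|gain A tau' s - gain A tau s| <= eps * s + C.
Proof.
move=> eps0.
have d0 : 0 < d by rewrite ltr0n addn_gt0 hm.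
pose eps1 := eps / (3 * d).
have eps10 : 0 < eps1 by rewrite divr_gt0// mulr_gt0.
have [eta /andP[eta0 _] [C0 HC]] := critical_sparse A hm hn tau_reg ltr01 eps10 ltr01.
pose K1 := (Num.truncn (4 * (1 + tau) / eta)).+1.
have K1e : 4 * (1 + tau) <= eta * K1%:R.
  rewrite [leRHS]mulrC -ler_pdivrMr// ltW//; exact: truncnS_gt.
exists (Num.min (eta / 8) (Num.min eps1 tau)).
  by rewrite !lt_min eps10 (tau_gt0 tau_reg) divr_gt0.
move=> tau'; rewrite !le_min => /and3P[t1 t2 t3].
have t'0 : 0 <= tau' by move: t3; rewrite ler_norml => /andP[]; rewrite lerBrDr addNr.
have K10 : (0 < K1)%N by [].
clearbody K1.
pose L := lconst R m n + 2 * lminima_const R m n.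
exists (2 * (d * (C0 + K1%:R)) + L + (d * (2 + tau') + L) + (d * (2 + tau) + L)) => s s0.
pose K := Num.truncn s.
have /andP[Ks sK] := truncn_itv s0; rewrite -/K in Ks sK.
have sK1 : s - K%:R <= 1 by rewrite lerBlDl natr1 ltW.
have K0 : 0 <= K%:R :> R by [].
have g1 : `|gain A tau' s - gain A tau' K%:R| <= d * (2 + tau') + L.
  have := @gain_time R m n A hm hn tau' K%:R s t'0; rewrite K0 Ks => /(_ isT) /le_trans; apply.
  by rewrite lerD2r ler_piMr// mulr_ge0 ?addr_ge0// ltW.
have g2 : `|gain A tau s - gain A tau K%:R| <= d * (2 + tau) + L.
  have := @gain_time R m n A hm hn tau K%:R s tau0; rewrite K0 Ks => /(_ isT) /le_trans; apply.
  by rewrite lerD2r ler_piMr// mulr_ge0 ?addr_ge0// ltW.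
have := gain_exponent A hm hn tau_reg ltr01 eta0 K10 K1e K t'0 t1.
rewrite !mulr1 !mul1r -/L => g3.
have i1 : d * ((count (crit A tau 1 eta) (iota 0 K))%:R + K1%:R) <= d * (eps1 * K%:R + (C0 + K1%:R)).
  by rewrite ler_wpM2l ?(ltW d0)// addrA lerD2r; have := HC K.
have i2 : d * (`|tau' - tau| * K%:R) <= d * (eps1 * K%:R).
  by rewrite ler_wpM2l ?(ltW d0)// ler_wpM2r.
have e1 : 3 * (d * (eps1 * K%:R)) = eps * K%:R by rewrite (_ : 3 * (d * (eps1 * K%:R)) = eps1 * (3 * d) * K%:R); [rewrite /eps1 divfK// mulf_neq0// gt_eqF | ring].
have i3 : eps * K%:R <= eps * s by rewrite ler_wpM2l// ltW.
rewrite (mulrDr d (eps1 * _)) in i1.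
move: g1 g2 g3 i1 i2 e1 i3.
move: (d * (eps1 * K%:R)) (eps * K%:R) (d * (C0 + K1%:R)) (d * (_ + K1%:R)) (d * (`|_| * _)).
move: (d * (2 + tau)) (d * (2 + tau')) (eps * s) (gain A tau s) (gain A tau' s) (gain _ _ _) (gain _ _ _).
move: L => L x1 x2 x3 x4 x5 x6 x7 x8 x9 x10 x11 x12.
rewrite !ler_norml => /andP[? ?] /andP[? ?] /andP[? ?] ? ? ? ?; apply/andP; split; lra.
Qed.

End Asymptotics.

(** * The formula as a liminf in s = log T, and its dependence on the exponent *)

Section Liminf.
Context (R : realType).

Lemma liminf_pinfty (f : R -> R) (M S0 : R) : (forall T, S0 < T -> `|f T| <= M) ->
  exists x : R, [/\ limf_einf (fun T => (f T)%:E) (pinfty_nbhs R) = x%:E,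
    forall t, t < x -> exists S, forall T, S < T -> t <= f T &
    forall t, x < t -> forall S, exists2 T, S < T & f T <= t].
Proof.
move=> bf; rewrite limf_einfE; set E := [set _ | _ in _].
have E1 : forall y, E y -> (y <= M%:E)%E.
  move=> y [V [N [_ NV]] <-].
  pose T := Num.max S0 N + 1.
  have NT : N < T by rewrite /T ltr_pwDr// le_max lexx orbT.
  have ST : S0 < T by rewrite /T ltr_pwDr// le_max lexx.
  apply: (@le_trans _ _ (f T)%:E).
    by apply: ereal_inf_lbound; exists T => //; exact: NV.
  by rewrite lee_fin; apply: le_trans (bf _ ST); exact: ler_norm.
have E2 S t : (forall T, S < T -> t <= f T) -> (t%:E <= ereal_sup E)%E.
  move=> H; apply: (@le_trans _ _ (ereal_inf [set (f T)%:E | T in [set T | S < T]])).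
    by apply: le_ereal_inf_tmp => y [T ST <-]; rewrite lee_fin; exact: H.
  apply: ereal_sup_ubound; exists [set T | S < T] => //.
  by exists S; split=> //; exact: num_real.
have supM : (ereal_sup E <= M%:E)%E by exact: ge_ereal_sup.
have sup0 : ((- M)%:E <= ereal_sup E)%E.
  by apply: (E2 S0) => T /bf; rewrite ler_norml => /andP[].
have : ereal_sup E \is a fin_num.
  rewrite fin_numElt (lt_le_trans _ sup0) ?ltNyr//=.
  by rewrite (le_lt_trans supM)// ltry.
move=> /fineK Ef; exists (fine (ereal_sup E)); split=> //.
- move=> t; rewrite -lte_fin Ef => /ereal_sup_gt[y [V [N [_ NV]] <-] ty].
  exists N => T /NV VT; rewrite -lee_fin; apply: (le_trans (ltW ty)).
  by apply: ereal_inf_lbound; exists T.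
- move=> t; rewrite -lte_fin Ef => xt S; apply: contrapT => H.
  move: xt; rewrite ltNge => /negP; apply; apply: (E2 S) => T ST.
  by rewrite leNgt; apply/negP => /ltW ft; apply: H; exists T.
Qed.

End Liminf.

Section DimFormula.
Context (R : realType) (m n : nat) (A : 'M[R]_(m, n)).
Hypotheses (hm : (0 < m)%N) (hn : (0 < n)%N).
Implicit Types (s t x tau : R).

Lemma dim_formulaP tau : 0 <= tau -> exists x : R, [/\ dim_formula A tau = x%:E,
    forall t, t < x -> exists S, forall s, S < s -> t * ((1 + tau) * s) <= gain A tau s &
    forall t, x < t -> forall S, exists2 s, S < s & gain A tau s <= t * ((1 + tau) * s)].
Proof.
move=> t0; have tp : 0 < 1 + tau by rewrite ltr_pwDl.
pose f (T : R) := (\int[lebesgue_measure]_(S in `[1, T]) ((small_minima_count A tau S)%:R / S)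
      - ln (box_count A (T `^ (- tau)) T)) / ((1 + tau) * ln T).
have fE s : f (expR s) = gain A tau s / ((1 + tau) * s) by rewrite /f gainE ?expR_gt0// expRK.
pose C := lconst R m n + 2 * lminima_const R m n + `|gain A tau 0|.
have C0 : 0 <= C.
  by have := gain_le A hm hn t0 (lexx 0); rewrite mulr0 add0r; exact: le_trans.
pose M := (m + n)%:R * (2 + tau) + C.
have M0 : 0 <= M by rewrite addr_ge0// mulr_ge0// addr_ge0.
have bf T : expR 1 < T -> `|f T| <= M.
  move=> T1; have Tp : 0 < T by apply: lt_trans T1; exact: expR_gt0.
  rewrite -(lnK Tp) fE; have s1 : 1 < ln T by rewrite -ltr_expR lnK.
  move: (ln T) s1 => s s1; have s0 : 0 < s by exact: lt_trans s1.
  rewrite normrM normfV (gtr0_norm (mulr_gt0 tp s0)) ler_pdivrMr ?mulr_gt0//.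
  apply: (le_trans (gain_le A hm hn t0 (ltW s0))); rewrite -/C.
  apply: (@le_trans _ _ (M * s)); last first.
    by rewrite ler_wpM2l// ler_peMl ?(ltW s0)// lerDl.
  by rewrite mulrDl lerD2l ler_peMr// ltW.
have [x [Ex x1 x2]] := liminf_pinfty bf; exists x; split=> //.
- move=> t /x1[S HS]; exists (Num.max 0 S) => s; rewrite gt_max => /andP[s0 Ss].
  have : S < expR s by apply: (lt_le_trans Ss); apply: le_trans (expR_ge1Dx s); rewrite lerDr.
  by move=> /HS; rewrite fE ler_pdivlMr// mulr_gt0.
- move=> t /x2 H S; have [T ST fT] := H (expR (Num.max 0 S)).
  have Tp : 0 < T by apply: lt_trans ST; exact: expR_gt0.
  exists (ln T).
    by rewrite -ltr_expR lnK//; apply: le_lt_trans ST; rewrite ler_expR le_max lexx orbT.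
  have s0 : 0 < ln T.
    by rewrite -ltr_expR lnK//; apply: le_lt_trans ST; rewrite ler_expR le_max lexx.
  by move: fT; rewrite -{1}(lnK Tp) fE ler_pdivrMr// mulr_gt0.
Qed.

Lemma dim_formula_near tau (eps : R) : regular_exponents R m n tau -> 0 < eps ->
  exists2 eta : R, 0 < eta & forall tau', `|tau' - tau| <= eta -> 0 <= tau' ->
  forall x x' : R, dim_formula A tau = x%:E -> dim_formula A tau' = x'%:E -> `|x' - x| <= eps.
Proof.
move=> tau_reg eps0; have tau0 := ltW (tau_gt0 tau_reg).
have [x0 [Ex0 y1 y2]] := dim_formulaP tau0.
(* Chosen so that the change of the denominator, at most [(|x0| + eps) * |tau' - tau| * s], and the
   change [e1 * s] of the numerator together stay below [eps / 8 * s]. *)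
pose e1 := eps / (8 * (1 + `|x0| + eps)).
have D0 : 0 < 1 + `|x0| + eps by rewrite addr_gt0// ltr_wpDr.
have e10 : 0 < e1 by rewrite divr_gt0// mulr_gt0.
have [eta eta0 Heta] := gain_near A hm hn tau_reg e10.
exists (Num.min eta e1); first by rewrite lt_min eta0 e10.
move=> tau'; rewrite le_min => /andP[te te1] t'0 x x' Ex Ex'.
have xx : x0 = x by apply: EFin_inj; rewrite -Ex0 -Ex.
have [x0' [Ex0' z1 z2]] := dim_formulaP t'0.
have xx' : x0' = x' by apply: EFin_inj; rewrite -Ex0' -Ex'.
have [C HC] := Heta _ te.
have e1E : e1 * (1 + `|x0| + eps) = eps / 8 by rewrite /e1; field; rewrite gt_eqF.
have near w s : `|w - x0| <= eps -> 0 <= s ->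
    `|w * ((1 + tau') * s) - w * ((1 + tau) * s)| + e1 * s <= eps / 8 * s.
  move=> wx s0; rewrite -mulrBr -mulrBl !normrM (ger0_norm s0) mulrA -mulrDl ler_wpM2r//.
  have w1 : `|w| <= `|x0| + eps.
    by rewrite -[w](subrK x0) addrC; apply: (le_trans (ler_normD _ _)); rewrite lerD2l.
  rewrite -e1E (_ : 1 + tau' - (1 + tau) = tau' - tau); last by ring.
  rewrite (_ : e1 * _ = (`|x0| + eps) * e1 + e1); last by ring.
  by rewrite lerD2r ler_pM.
have far (c : R) : 0 < c -> exists S, 0 <= S /\ forall s, S < s -> C <= c * s.
  move=> c0; exists (`|C| / c); split=> [|s]; first by rewrite divr_ge0// ltW.
  by rewrite ltr_pdivrMr// mulrC => /ltW; apply: le_trans; exact: ler_norm.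
rewrite -xx -xx' ler_norml; have e80 : 0 < eps / 8 by rewrite divr_gt0.
have [S1 [S10 HS1]] := far _ e80.
have big s : 0 < s -> eps / 2 * s <= eps / 2 * ((1 + tau) * s).
  by move=> s0; rewrite ler_pM2l ?divr_gt0// ler_peMl ?(ltW s0)// lerDl.
apply/andP; split; rewrite leNgt; apply/negP => hx.
- have [S2 HS2] := y1 (x0 - eps / 4) (ltac:(lra)).
  have [s Ss gs] := z2 (x0 - eps / 4 - eps / 2) (ltac:(lra)) (Num.max S1 S2).
  move: Ss; rewrite gt_max => /andP[sS1 sS2].
  have s0 : 0 < s by apply: le_lt_trans sS1.
  have := HS2 _ sS2; have := HS1 _ sS1; have := HC _ (ltW s0); have := big _ s0.
  have wn : `|x0 - eps / 4 - eps / 2 - x0| <= eps by rewrite ler_norml; apply/andP; split; lra.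
  have es : 0 < eps / 8 * s by rewrite mulr_gt0.
  have := near _ _ wn (ltW s0); move: gs.
  have -> : (x0 - eps / 4) * ((1 + tau) * s) =
     (x0 - eps / 4 - eps / 2) * ((1 + tau) * s) + eps / 2 * ((1 + tau) * s) by ring.
  have -> : eps / 2 * s = 4 * (eps / 8 * s) by field.
  move: (eps / 8 * s) es (eps / 2 * _) => a es b.
  move: (_ * ((1 + tau') * s)) (_ * ((1 + tau) * s)) (e1 * s) (gain _ _ _) (gain _ _ _) => p q r u v.
  have n1 := ler_norm (p - q); have n2 := ler_norm (q - p); rewrite distrC in n2.
  have n3 := ler_norm (u - v); have n4 := ler_norm (v - u); rewrite distrC in n4.
  rewrite ?(distrC v u); move: n1 n2 n3 n4; move: `|p - q| `|u - v| => N N' n1 n2 n3 n4 h1 h2 h3 h4 h5 h6.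
  lra.
- have [S2 HS2] := z1 (x0 + eps / 4 + eps / 2) (ltac:(lra)).
  have [s Ss gs] := y2 (x0 + eps / 4) (ltac:(lra)) (Num.max S1 S2).
  move: Ss; rewrite gt_max => /andP[sS1 sS2].
  have s0 : 0 < s by apply: le_lt_trans sS1.
  have := HS2 _ sS2; have := HS1 _ sS1; have := HC _ (ltW s0); have := big _ s0.
  have wn : `|x0 + eps / 4 + eps / 2 - x0| <= eps by rewrite ler_norml; apply/andP; split; lra.
  have es : 0 < eps / 8 * s by rewrite mulr_gt0.
  have := near _ _ wn (ltW s0); move: gs.
  have -> : (x0 + eps / 4) * ((1 + tau) * s) =
     (x0 + eps / 4 + eps / 2) * ((1 + tau) * s) - eps / 2 * ((1 + tau) * s) by ring.
  have -> : eps / 2 * s = 4 * (eps / 8 * s) by field.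
  move: (eps / 8 * s) es (eps / 2 * _) => a es b.
  move: (_ * ((1 + tau') * s)) (_ * ((1 + tau) * s)) (e1 * s) (gain _ _ _) (gain _ _ _) => p q r u v.
  have n1 := ler_norm (p - q); have n2 := ler_norm (q - p); rewrite distrC in n2.
  have n3 := ler_norm (u - v); have n4 := ler_norm (v - u); rewrite distrC in n4.
  rewrite ?(distrC v u); move: n1 n2 n3 n4; move: `|p - q| `|u - v| => N N' n1 n2 n3 n4 h1 h2 h3 h4 h5 h6.
  lra.
Qed.

End DimFormula.

(** * Covering steps *)

Lemma sub_mxE (V : zmodType) p q (X Y : 'M[V]_(p, q)) i j : (X - Y) i j = X i j - Y i j.
Proof. by rewrite !mxE. Qed.

Section Cells.
Context (R : realType) (T : choiceType) (J : finType) (Y : J -> T -> R).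

(** The box is cut into [M ^ #|J|] cells and one point of [S] is kept from each cell that meets [S].
    The representatives have to lie in [S] because they will be lattice points. *)
Lemma cells (S : set T) (c : J -> R) (L rho : R) (M : nat) : 0 < rho -> 0 <= L -> 2 * L < M%:R ->
  (forall z, S z -> forall j, `|Y j z - c j| <= L * rho) ->
  exists X : seq T, [/\ (size X <= M ^ #|J|)%N, forall x, x \in X -> S x &
    forall z, S z -> exists2 x, x \in X & forall j, `|Y j z - Y j x| <= rho].
Proof.
move=> rho0 L0 LM Sc.
case: M LM => [|M LM]; first by rewrite ltNge mulr_ge0.
pose g j z := (Y j z - c j) / rho + L.
have gE z j : S z -> 0 <= g j z < M.+1%:R.
  move=> /Sc /(_ j); rewrite ler_norml -mulNr => /andP[h1 h2]; apply/andP; split.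
    by rewrite /g -[L]opprK subr_ge0 ler_pdivlMr.
  apply: le_lt_trans LM; rewrite /g mulr_natl mulr2n lerD2r ler_pdivrMr//.
pose cell z : {ffun J -> 'I_M.+1} := [ffun j => inord (Num.truncn (g j z))].
have cellP z x : S z -> S x -> cell z = cell x -> forall j, `|Y j z - Y j x| <= rho.
  move=> Sz Sx /ffunP H j; have := H j; rewrite !ffunE => /(congr1 (@nat_of_ord _)).
  have /andP[z1 z2] := gE _ j Sz; have /andP[x1 x2] := gE _ j Sx.
  rewrite !inordK ?truncn_lt_nat// => E.
  have /andP[z3 z4] := truncn_itv z1; have /andP[x3 x4] := truncn_itv x1.
  rewrite E in z3 z4; have : `|g j z - g j x| <= 1.
    rewrite -natr1 in z4 x4; move: z3 z4 x3 x4; move: (g j z) (g j x) (_%:R) => p q r ? ? ? ?.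
    by rewrite ler_norml; apply/andP; split; lra.
  rewrite /g opprD addrACA subrr addr0 -mulrBl opprB addrA subrK normrM normfV (gtr0_norm rho0).
  by rewrite ler_pdivrMr// mul1r.
have [->|/set0P[z0 Sz0]] := eqVneq S set0; first by exists [::]; split.
pose rep h := xget z0 [set z | S z /\ cell z = h].
have repS h : S (rep h).
  by rewrite /rep; case: xgetP => [x _ []|].
exists [seq rep h | h <- enum {ffun J -> 'I_M.+1}]; split.
- by rewrite size_map -cardE card_ffun card_ord.
- by move=> x /mapP[h _ ->].
- move=> z Sz; exists (rep (cell z)); first by rewrite map_f// mem_enum.
  apply: cellP => //; rewrite /rep; case: xgetP => [x _ []//|/(_ z)].
  by case.
Qed.

End Cells.

(** * Targets on the torus and the lattice points that approximate them *)

Section Points.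
Local Open Scope quotient_scope.
Context (R : realType) (m n : nat) (A : 'M[R]_(m, n)).
Implicit Types (z : 'cV[int]_(m + n)) (x b w : 'cV[R]_m) (s tau : R).

Definition xpart z : 'cV[R]_m := A *m int_vec R (dsubmx z) + int_vec R (usubmx z).
Definition ypart z : 'cV[R]_n := int_vec R (dsubmx z).

Lemma xpartE z i : xpart z i 0 = latv A z 0 (lshift n i).
Proof. by rewrite latv_l /xpart mxE addrC [X in X + _]mxE. Qed.

Lemma ypartE z j : ypart z j 0 = latv A z 0 (rshift m j).
Proof. by rewrite latv_r /ypart mxE. Qed.

Definition reach tau s b := exists z, `|xpart z - b| <= expR (- (tau * s)) /\ `|ypart z| <= expR s.

Lemma uniform_approxP psi (b : torus R m) x : \pi_(torus R m) x = b ->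
  uniform_approx A psi b <->
  exists T0, forall T, T0 < T -> exists z, `|xpart z - x| <= psi T /\ `|ypart z| <= T.
Proof.
move=> xb; have /torus_piP[p0 Ep] : \pi_(torus R m) x = \pi_(torus R m) (repr b) by rewrite reprK.
have i1 (p p' : 'cV[int]_m) : int_vec R (p + p') = int_vec R p + int_vec R p' by exact: int_vecD.
have iN (p : 'cV[int]_m) : int_vec R (- p) = - int_vec R p.
  by apply/matrixP => i j; rewrite !mxE rmorphN.
rewrite /uniform_approx /=; split=> [[T0 [_ HT]]|[T0 HT]].
  exists T0 => T /HT[p [q [h1 h2]]]; exists (col_mx (- p + p0) q).
  rewrite /xpart /ypart col_mxKu col_mxKd; split=> //.
  rewrite i1 iN -Ep; congr (`|_| <= _): h1.
  by rewrite -!addrA; congr (_ + (_ + _)); rewrite addrCA subrr addr0.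
exists T0; split; first exact: num_real.
move=> T /HT[z [h1 h2]]; exists (p0 - usubmx z), (dsubmx z); split=> //.
congr (`|_| <= _): h1; rewrite /xpart i1 iN -Ep.
rewrite -!addrA; congr (_ + _); rewrite !opprD !opprK [in RHS]addrA.
by rewrite [RHS]addrAC addrK addrC.
Qed.

Lemma norm_xpartB z z' (l : R) : 0 <= l ->
  (forall i : 'I_(m + n), (i < m)%N -> `|latv A z 0 i - latv A z' 0 i| <= l) ->
  `|xpart z - xpart z'| <= l.
Proof.
move=> l0 H; apply/cV_norm_le; split=> // i.
by rewrite sub_mxE !xpartE; apply: H => /=.
Qed.

End Points.

Section UpperStep.
Context (R : realType) (m n : nat) (A : 'M[R]_(m, n)).
Context (tau : R).
Hypothesis tau_reg : regular_exponents R m n tau.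
Implicit Types (b w : 'cV[R]_m).

Local Notation d := ((m + n)%:R : R).

Let tau0 : 0 <= tau. Proof. exact/ltW/(tau_gt0 tau_reg). Qed.

(** [2 * d] is what [dominated_coords] gives when the selected y-coordinates differ by up to twice
    the width; the 1 is the distance from a target to its lattice point. *)
Let C1 : R := 2 * d + 1.

Let C11 : 1 <= C1. Proof. by rewrite lerDr mulr_ge0. Qed.

Context (h eta : R) (K1 M : nat).
Hypotheses (h0 : 0 < h) (eta0 : 0 < eta) (K10 : (0 < K1)%N)
  (K1eta : 4 * (1 + tau) <= eta * K1%:R) (hM : 2 * ((C1 + 1) * expR (tau * h)) < M%:R).

Local Notation sk k := (h * k%:R).
Local Notation rad k := (expR (- (tau * sk k))).

Let radS k : expR (tau * h) * rad k.+1 = rad k.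
Proof. by rewrite -expRD; congr expR; rewrite -natr1; ring. Qed.

Lemma cover_bad k w : exists X : seq 'cV[R]_m, (size X <= M ^ m)%N /\
  forall b, `|b - w| <= C1 * rad k -> exists2 w', w' \in X & `|b - w'| <= C1 * rad k.+1.
Proof.
have [||||X [sX _ HX]] := @cells R 'cV[R]_m 'I_m (fun i b => b i 0) [set b | `|b - w| <= C1 * rad k]
  (fun i => w i 0) (C1 * expR (tau * h)) (rad k.+1) M.
- exact: expR_gt0.
- by rewrite mulr_ge0 ?expR_ge0// (le_trans ler01).
- by apply: le_lt_trans hM; rewrite !ler_pM2l// ler_pM2r ?expR_gt0// lerDl.
- move=> b /= /cV_norm_le[_ H] i; rewrite -mulrA radS; apply: le_trans (H i).
  by rewrite sub_mxE.
exists X; split; first by rewrite -{2}(card_ord m).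
move=> b /HX[w' w'X H]; exists w' => //; apply: (@le_trans _ _ (rad k.+1)); last first.
  by rewrite ler_peMl// expR_ge0.
by apply/cV_norm_le; split=> [|i]; [exact: expR_ge0|rewrite sub_mxE; exact: H].
Qed.

(** The lattice points that serve targets near [w] differ by elements of the common span [V].
    Cutting only the [ak] selected x-coordinates down to the next radius therefore controls all
    x-coordinates. *)
Lemma cover_good k w : good A tau h eta K1 k -> ln (2 * (C1 + 1)) + h <= eta * sk k ->
  exists X : seq 'cV[R]_m, (size X <= M ^ ak A tau h eta k)%N /\
  forall b, `|b - w| <= C1 * rad k -> reach A tau (sk k.+1) b ->
    exists2 w', w' \in X & `|b - w'| <= C1 * rad k.+1.
Proof.
move=> gk big; have /and4P[Kk nk nk1 /eqP aa] := gk.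
pose V := Vk A tau h eta k.+1; pose f := optf V (theta tau (sk k.+1)).
have VV : Vk A tau h eta k = V by exact: (Vk_next tau_reg h0 eta0 K10 K1eta).
have fopt : optimal (row_base V) (theta tau (sk k.+1)) f by exact: optfP.
pose J : finType := {j | (f j < m)%N}.
have cJ : #|J| = ak A tau h eta k by rewrite aa card_sig.
pose S := [set z | `|xpart A z - w| <= (C1 + 1) * rad k /\ `|ypart R z| <= expR (sk k.+1)].
pose Y (j : J) z := latv A z 0 (f (val j)).
pose c (j : J) := (row_mx w^T 0 : 'rV[R]_(m + n)) 0 (f (val j)).
have Sx z (i : 'I_(m + n)) : S z -> (i < m)%N -> `|latv A z 0 i - (row_mx w^T 0 : 'rV[R]_(m + n)) 0 i| <= (C1 + 1) * rad k.
  move=> [/cV_norm_le[_ H] _]; case: (split_ordP i) => i' -> // _.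
  by rewrite -xpartE row_mxEl [_^T _ _]mxE; have := H i'; rewrite sub_mxE.
have Sy z (i : 'I_(m + n)) : S z -> (i < m)%N = false -> `|latv A z 0 i| <= expR (sk k.+1).
  move=> [_ /cV_norm_le[_ H]]; case: (split_ordP i) => i' -> // _.
  by rewrite -ypartE.
have C20 : 0 < 2 * (C1 + 1) by rewrite mulr_gt0// ltr_wpDl// (le_trans ler01).
have SV z z' : S z -> S z' -> (latv A (z - z') <= V)%MS.
  move=> Sz Sz'; rewrite -VV; apply: inbox_Vsp => i; rewrite latvB sub_mxE /wt.
  apply: (@le_trans _ _ (expR (ln (2 * (C1 + 1)) + h + (if (i < m)%N then - (tau * sk k) else sk k)))); last first.
    by rewrite ler_expR lerD2r.
  rewrite !expRD lnK ?posrE//; case: ifP => im.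
    have e1 : 1 <= expR h by rewrite -expR0 ler_expR ltW.
    rewrite -mulrA mulrCA; apply: (@le_trans _ _ (2 * (C1 + 1) * rad k)); last first.
      by rewrite ler_peMl// mulr_ge0 ?expR_ge0// ltW.
    rewrite -(subrK ((row_mx w^T 0 : 'rV[R]_(m + n)) 0 i) (latv A z 0 i)) -addrA.
    apply: (le_trans (ler_normD _ _)).
    rewrite -mulrA mulr_natl mulr2n; apply: lerD; first exact: Sx.
    by rewrite distrC; exact: Sx.
  apply: (le_trans (ler_normB _ _)).
  apply: (@le_trans _ _ (2 * expR (h + sk k))).
    have -> : h + sk k = sk k.+1 by rewrite -natr1; ring.
    by rewrite mulr_natl mulr2n; apply: lerD; exact: Sy.
  rewrite expRD -mulrA ler_wpM2r ?mulr_ge0 ?expR_ge0//.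
  by rewrite ler_peMr// lerDr (le_trans ler01).
have [||||X [sX XS HX]] := @cells R 'cV[int]_(m + n) J Y S c ((C1 + 1) * expR (tau * h)) (rad k.+1) M.
- exact: expR_gt0.
- by rewrite mulr_ge0 ?expR_ge0// addr_ge0// (le_trans ler01).
- exact: hM.
- by move=> z Sz j; rewrite -mulrA radS; apply: Sx => //; exact: valP j.
exists [seq xpart A z | z <- X]; rewrite size_map -cJ; split=> // b bw [z [zb zy]].
have Sz : S z.
  split=> //; rewrite -(subrK b (xpart A z)) -addrA; apply: (le_trans (ler_normD _ _)).
  rewrite mulrDl mul1r [leRHS]addrC; apply: lerD => //; apply: (le_trans zb).
  by rewrite -(radS k) ler_peMl ?expR_ge0// -expR0 ler_expR mulr_ge0// ltW.
have [x xX zx] := HX _ Sz; exists (xpart A x); first exact: map_f.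
have Sx' := XS _ xX.
have H : forall i, `|latv A (z - x) 0 i| <= d * 2 * wt tau (sk k.+1) 0 i.
  apply: (dominated_coords fopt) => //; first exact: SV.
  move=> j; rewrite latvB sub_mxE /wt; case: ifP => fj.
    have := zx (exist _ j fj); rewrite /Y /= => /le_trans; apply.
    by rewrite add0r ler_peMl ?expR_ge0// ler1n.
  by apply: (le_trans (ler_normB _ _)); rewrite add0r mulr_natl mulr2n; apply: lerD; exact: Sy.
rewrite -(subrK (xpart A z) b) -addrA; apply: (le_trans (ler_normD _ _)).
rewrite /C1 mulrDl mul1r [leRHS]addrC; apply: lerD; first by rewrite distrC.
apply: norm_xpartB; first by rewrite !mulr_ge0 ?expR_ge0.
move=> i im; have := H i; rewrite latvB sub_mxE /wt im add0r.
by rewrite [d * 2]mulrC.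
Qed.

End UpperStep.

(** * Hausdorff null sets *)

Section HausdorffTools.
Context (R : realType) (X : metricType R).
Implicit Types (E U : set X) (s delta : R).
Local Open Scope ereal_scope.

Lemma diam_ge0 U x : U x -> 0 <= diam U.
Proof. by move=> Ux; apply: ereal_sup_ubound; exists x => //; exists x => //; rewrite mdistxx. Qed.

Lemma diam_le U (r : R) : (forall x y, U x -> U y -> (mdist x y <= r)%R) -> diam U <= r%:E.
Proof. by move=> H; apply: ge_ereal_sup => _ [x Ux [y Uy <-]]; rewrite lee_fin H. Qed.

Lemma diam_pow_ge0 s U : 0 <= diam_pow s U.
Proof. by rewrite /diam_pow; case: ifP => // _; exact: poweR_ge0. Qed.

Lemma diam_pow_le s U (r : R) : (0 <= s)%R -> (0 <= r)%R ->
  (forall x y, U x -> U y -> (mdist x y <= r)%R) -> diam_pow s U <= (r `^ s)%:E.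
Proof.
move=> s0 r0 H; rewrite /diam_pow; case: ifPn => [_|/set0P[x Ux]].
  by rewrite lee_fin powR_ge0.
rewrite -poweR_EFin; apply: gt0_ler_poweR => //; last exact: diam_le.
  by rewrite in_itv /= leey (diam_ge0 Ux).
by rewrite in_itv /= lee_fin r0 leey.
Qed.

Lemma hausdorff_premeasure_ge0 s delta E : 0 <= hausdorff_premeasure s delta E.
Proof.
by apply: le_ereal_inf_tmp => _ [U _ <-]; apply: nneseries_ge0 => k _ _; exact: diam_pow_ge0.
Qed.

Lemma hausdorff_premeasure_le s delta E E' : E `<=` E' ->
  hausdorff_premeasure s delta E <= hausdorff_premeasure s delta E'.
Proof.
move=> EE'; apply: le_ereal_inf => _ [U [EU dU] <-]; exists U => //; split=> //.
exact: subset_trans EU.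
Qed.

Lemma hausdorff_measure_ge0 s E : 0 <= hausdorff_measure s E.
Proof.
apply: le_trans (hausdorff_premeasure_ge0 s 1 E) _.
by apply: ereal_sup_ubound; exists 1%R => //=.
Qed.

Lemma hausdorff_measure_eq0 s E :
  (forall delta e, (0 < delta)%R -> (0 < e)%R -> hausdorff_premeasure s delta E <= e%:E) ->
  hausdorff_measure s E = 0.
Proof.
move=> H; apply/eqP; rewrite eq_le hausdorff_measure_ge0 andbT.
apply: ge_ereal_sup => _ [delta /= d0 <-]; apply/lee_addgt0Pr => e e0; rewrite add0e.
exact: H.
Qed.

Lemma hausdorff_premeasure_eq0 s E delta : (0 < delta)%R -> hausdorff_measure s E = 0 ->
  hausdorff_premeasure s delta E = 0.
Proof.
move=> d0 E0; apply/eqP; rewrite eq_le hausdorff_premeasure_ge0 andbT -E0.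
by apply: ereal_sup_ubound; exists delta.
Qed.

Lemma hausdorff_measure_sub0 s E E' : E `<=` E' -> hausdorff_measure s E' = 0 ->
  hausdorff_measure s E = 0.
Proof.
move=> EE' HE'; apply: hausdorff_measure_eq0 => delta e d0 e0.
rewrite (le_trans (hausdorff_premeasure_le s delta EE'))//.
by rewrite (hausdorff_premeasure_eq0 d0 HE') lee_fin ltW.
Qed.

Lemma hausdorff_dim_le E E' : E `<=` E' -> hausdorff_dim E <= hausdorff_dim E'.
Proof.
move=> EE'; apply: le_ereal_inf => _ [s [s0 HE'] <-]; exists s => //; split=> //.
exact: hausdorff_measure_sub0 HE'.
Qed.

(** A box-counting criterion for countable unions: the set of index [i] receives total weight
    [e / 2 ^ i.+1], and a bijection of [nat] with pairs enumerates all the covers. *)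
Lemma hausdorff_null (s : R) (E : nat -> set X) : (0 <= s)%R ->
  (forall i (e : R), (0 < e)%R -> exists (N : nat) (r : R) (U : nat -> set X),
    [/\ (0 <= r)%R, (r <= e)%R, (N%:R * r `^ s <= e)%R, E i `<=` \bigcup_(j in `I_N) U j &
        forall j x y, U j x -> U j y -> (mdist x y <= r)%R]) ->
  hausdorff_measure s (\bigcup_i E i) = 0.
Proof.
move=> s0 H; apply: hausdorff_measure_eq0 => delta e d0 e0.
have e'0 i : (0 < Num.min delta (e / (2 ^ i.+1)%:R))%R.
  by rewrite lt_min d0 divr_gt0// ltr0n expn_gt0.
pose P i (G : nat -> set X) := [/\ E i `<=` \bigcup_j G j, forall j, diam (G j) <= delta%:E &
  \sum_(0 <= j <oo) diam_pow s (G j) <= (e / (2 ^ i.+1)%:R)%:E].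
have [G PG] : {G : nat -> nat -> set X & forall i, P i (G i)}.
  apply: (@choice _ _ P) => i; have [N [r [U [r0 re Nr EU HU]]]] := H i _ (e'0 i).
  move: re Nr; rewrite !le_min => /andP[rd re] /andP[_ Nr].
  (* Padding by empty sets, which [diam_pow] counts as 0 even for exponent 0. *)
  exists (fun j => if (j < N)%N then U j else set0); split.
  - by move=> x /EU[j /= jN Ux]; exists j => //; rewrite jN.
  - move=> j; apply: (@le_trans _ _ r%:E); last by rewrite lee_fin.
    by apply: diam_le => x y; case: ifP => // _; exact: HU.
  - rewrite (nneseries_split 0 N)//; last by move=> k _; exact: diam_pow_ge0.
    rewrite add0n eseries0 ?adde0; last first.
      by move=> k; rewrite leqNgt => /negbTE -> _; rewrite /diam_pow eqxx.
    apply: (@le_trans _ _ (N%:R * r `^ s)%:E); last by rewrite lee_fin.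
    rewrite big_mkord.
    apply: (@le_trans _ _ (\sum_(i0 < N) (r `^ s)%:E)).
      by apply: lee_sum => j _; rewrite ltn_ord; apply: diam_pow_le => // x y; exact: HU.
    by rewrite sumEFin sumr_const card_ord mulr_natl.
apply: le_trans (epsilon_trick0 xpredT (ltW e0)).
have /card_esym/ppcard_eqP[f] := card_nat2.
apply: (@le_trans _ _ (\sum_(k <oo) diam_pow s (G (f k).1 (f k).2))).
  apply: ereal_inf_lbound; exists (fun k => G (f k).1 (f k).2) => //; split=> [x [i _ Ex]|k].
    have [h _ _] := PG i; have [j _ Gx] := h _ Ex.
    by exists (f^-1%FUN (i, j)) => //; rewrite invK//; exact/mem_set.
  by have [_ h _] := PG (f k).1; exact: h.
have w0 p : 0 <= diam_pow s (G p.1 p.2) by exact: diam_pow_ge0.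
have t0 i : 0 <= (e / (2 ^ i.+1)%:R)%:E by rewrite lee_fin divr_ge0// ltW.
rewrite nneseries_esumT// -(reindex_esum setT setT f (fun p => diam_pow s (G p.1 p.2)))//.
rewrite (_ : setT = setT `*`` (fun=> setT)); last by apply/seteqP; split.
rewrite -(@esum_esum R nat nat _ _ (fun i j => diam_pow s (G i j))); last by move=> i j _ _; exact: (w0 (i, j)).
rewrite nneseries_esumT//.
apply: le_esum => i _; rewrite -nneseries_esumT; last by move=> j; exact: (w0 (i, j)).
by have [] := PG i.
Qed.

End HausdorffTools.

Lemma size_flatten_le (T U : eqType) (f : T -> seq U) (X : seq T) (B : nat) :
  (forall x, (size (f x) <= B)%N) -> (size (flatten [seq f x | x <- X]) <= size X * B)%N.
Proof.
by move=> fB; elim: X => //= x X IH; rewrite size_cat mulSn leq_add.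
Qed.

Section UpperCover.
Context (R : realType) (m n : nat) (A : 'M[R]_(m, n)).
Context (tau : R).
Hypothesis tau_reg : regular_exponents R m n tau.
Implicit Types (b w : 'cV[R]_m).

Local Notation d := ((m + n)%:R : R).
Local Notation C1 := (2 * d + 1).

Context (h eta : R) (K1 M : nat).
Hypotheses (h0 : 0 < h) (eta0 : 0 < eta) (K10 : (0 < K1)%N)
  (K1eta : 4 * (1 + tau) <= eta * K1%:R) (hM : 2 * ((C1 + 1) * expR (tau * h)) < M%:R).

Local Notation sk k := (h * k%:R).
Local Notation rad k := (expR (- (tau * sk k))).

(** Fixing the time from which the approximation holds allows finite covers; the projections for
    varying [k0] exhaust the set of the theorem. *)
Definition cube_targets k0 : set 'cV[R]_m :=
  [set b : 'cV[R]_m | (forall i, 0 <= b i 0 <= 1) /\ forall k, (k0 <= k)%N -> reach A tau (sk k) b].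

Definition cell_exponent k : nat := if good A tau h eta K1 k then ak A tau h eta k else m.

Lemma cover_iter k0 : (forall k, (k0 <= k)%N -> ln (2 * (C1 + 1)) + h <= eta * sk k) ->
  exists N0 : nat, forall K, (k0 <= K)%N -> exists X : seq 'cV[R]_m,
    (size X <= N0 * M ^ (\sum_(i < K) cell_exponent i))%N /\
    forall b, cube_targets k0 b -> exists2 w, w \in X & `|b - w| <= C1 * rad K.
Proof.
move=> big.
have M0 : (0 < M)%N.
  by rewrite -(ltr_nat R); apply: le_lt_trans hM; rewrite mulr_ge0// mulr_ge0 ?expR_ge0// !addr_ge0// mulr_ge0.
have step k w : (k0 <= k)%N -> exists X : seq 'cV[R]_m, (size X <= M ^ cell_exponent k)%N /\
    forall b, cube_targets k0 b -> `|b - w| <= C1 * rad k ->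
      exists2 w', w' \in X & `|b - w'| <= C1 * rad k.+1.
  move=> kk; rewrite /cell_exponent; case: ifP => gk.
    have [X [sX HX]] := cover_good tau_reg h0 eta0 K10 K1eta hM w gk (big _ kk).
    by exists X; split=> // b [_ bk] bw; apply: HX => //; apply: bk; rewrite ltnW.
  have [X [sX HX]] := cover_bad hM k w.
  by exists X; split=> // b _; exact: HX.
pose L := (rad k0)^-1.
have L0 : 0 <= L by rewrite invr_ge0 expR_ge0.
have [||||X0 [_ _ HX0]] := @cells R 'cV[R]_m 'I_m (fun i b => b i 0) (cube_targets k0)
    (fun=> 0) L (rad k0) (Num.truncn (2 * L)).+1.
- exact: expR_gt0.
- exact: L0.
- by rewrite truncnS_gt.
- move=> b [bc _] i; rewrite subr0 /L mulVf ?gt_eqF ?expR_gt0//.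
  by have /andP[b0 b1] := bc i; rewrite ger0_norm.
exists (size X0) => K; elim: K => [|K IH] kK.
  move: kK; rewrite leqn0 => /eqP k00; exists X0; rewrite big_ord0 muln1; split=> // b Eb.
  have [w wX H] := HX0 _ Eb; exists w => //; apply: (@le_trans _ _ (rad k0)); last first.
    by rewrite k00 ler_peMl ?expR_ge0// lerDr mulr_ge0.
  by apply/cV_norm_le; split=> [|i]; [exact: expR_ge0|rewrite sub_mxE; exact: H].
move: kK; rewrite leq_eqVlt => /orP[/eqP kK|]; last first.
  rewrite ltnS => kK; have [X [sX HX]] := IH kK.
  have [F HF] := @choice _ _ (fun w X => (size X <= M ^ cell_exponent K)%N /\
    forall b, cube_targets k0 b -> `|b - w| <= C1 * rad K ->
      exists2 w', w' \in X & `|b - w'| <= C1 * rad K.+1) (fun w => step K w kK).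
  exists (flatten [seq F w | w <- X]); split.
    rewrite big_ord_recr /= expnD mulnA.
    apply: (leq_trans (size_flatten_le _ (fun w => (HF w).1))).
    by rewrite leq_mul2r sX orbT.
  move=> b Eb; have [w wX bw] := HX _ Eb; have [w' w'X bw'] := (HF w).2 _ Eb bw.
  by exists w' => //; apply/flattenP; exists (F w) => //; exact: map_f.
exists X0; rewrite -kK; split=> [|b Eb].
  by rewrite leq_pmulr// expn_gt0 M0.
have [w wX H] := HX0 _ Eb; exists w => //; apply: (@le_trans _ _ (rad k0)); last first.
  by rewrite ler_peMl ?expR_ge0// lerDr mulr_ge0.
by apply/cV_norm_le; split=> [|i]; [exact: expR_ge0|rewrite sub_mxE; exact: H].
Qed.

End UpperCover.

(** * The upper bound *)

Section HsumDim.
Context (R : realType) (m n : nat) (A : 'M[R]_(m, n)).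
Hypotheses (hm : (0 < m)%N) (hn : (0 < n)%N).
Context (tau : R).
Hypothesis tau_reg : regular_exponents R m n tau.

Let tau0 : 0 <= tau. Proof. exact/ltW/(tau_gt0 tau_reg). Qed.

(** The liminf restated for [hsum] on the grid. In the last clause a time supplied by the liminf is
    replaced by the grid time before it, at bounded cost. *)
Lemma hsum_dim (x eps h1 : R) : dim_formula A tau = x%:E -> 0 < eps -> 0 < h1 ->
  exists h eta : R, exists2 K1 : nat,
    [/\ h1 <= h, 0 < h, 0 < eta, (0 < K1)%N & 4 * (1 + tau) <= eta * K1%:R] &
  [/\ exists C : R, forall K : nat,
      (count (fun k => ~~ good A tau h eta K1 k) (iota 0 K))%:R <= eps * K%:R + C,
    forall t, t < x -> exists C : R, forall K : nat,
      t * (h * K%:R) - eps * (h * K%:R) - C <= hsum A tau h eta K1 K &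
    forall t, x < t -> exists C : R, forall K0 : nat, exists2 K : nat, (K0 <= K)%N &
      hsum A tau h eta K1 K <= t * (h * K%:R) + eps * (h * K%:R) + C].
Proof.
move=> Ex eps0 h10; have p1 : 1 <= 1 + tau by rewrite lerDl.
have p0 : 0 < 1 + tau by exact: lt_le_trans p1.
have [x' [Ex' low up]] := dim_formulaP A hm hn tau0.
have {Ex'} xx : x' = x by apply: EFin_inj; rewrite -Ex -Ex'.
rewrite {}xx in low up.
have [h [eta [K1 [hh h0 eta0 K10 K1e] [C HC]]]] := structure A hm hn tau_reg eps0 h10.
exists h, eta, K1; first by split.
have C0 : 0 <= C.
  by have [_ h2] := HC 0%N; move: h2; rewrite !mulr0 add0r; apply: le_trans.
have sk0 K : 0 <= h * K%:R by rewrite mulr_ge0// ltW.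
have hs0 K : 0 <= hsum A tau h eta K1 K by rewrite /hsum mulr_ge0 ?(ltW h0)// sumr_ge0.
have HC1 K : `|gain A tau (h * K%:R) / (1 + tau) - hsum A tau h eta K1 K| <= eps * (h * K%:R) + C.
  have [_ H] := HC K; rewrite -[hsum _ _ _ _ _ _](mulKf (lt0r_neq0 p0)) [_^-1 * _]mulrC.
  rewrite -mulrBl normrM (gtr0_norm (_ : 0 < (1 + tau)^-1)) ?invr_gt0// ler_pdivrMr//.
  by apply: (le_trans H); rewrite ler_peMr// addr_ge0// mulr_ge0// ltW.
split.
- by exists C => K; have [] := HC K.
- move=> t /low[S HS].
  exists (C + `|t| * `|S|) => K; have := HC1 K; rewrite ler_norml => /andP[_ g2].
  have [Sk|kS] := ltP S (h * K%:R).
    have g1 : t * (h * K%:R) <= gain A tau (h * K%:R) / (1 + tau).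
      by rewrite ler_pdivlMr//; apply: le_trans (HS _ Sk); rewrite mulrAC -mulrA.
    have : 0 <= `|t| * `|S| by rewrite mulr_ge0.
    by move: g1 g2; move: (t * _) (eps * _) (gain _ _ _ / _) (`|t| * _) (hsum _ _ _ _ _ _) => *; lra.
  have h1' : t * (h * K%:R) <= `|t| * `|S|.
    apply: (le_trans (ler_norm _)); rewrite normrM ler_wpM2l// (ger0_norm (sk0 K)).
    by apply: (le_trans kS); exact: ler_norm.
  have := hs0 K; have : 0 <= eps * (h * K%:R) by rewrite mulr_ge0// ltW.
  move: h1' C0; move: (t * _) (eps * _) (`|t| * _) (hsum _ _ _ _ _ _) => *; lra.
- move=> t /up H.
  pose c := (m + n)%:R * (2 + tau) * h + (lconst R m n + 2 * lminima_const R m n).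
  exists (C + (`|c| + `|t| * h)) => K0.
  have [s Ss gs] := H (h * K0%:R).
  have s0 : 0 < s by apply: le_lt_trans Ss.
  pose K := Num.truncn (s / h).
  have sh0 : 0 <= s / h by rewrite divr_ge0// ltW.
  have /andP[k1 k2] := truncn_itv sh0.
  rewrite -/K ler_pdivlMr// mulrC in k1; rewrite -/K ltr_pdivrMr// mulrC in k2.
  have kk : h * K.+1%:R = h * K%:R + h by rewrite -natr1 mulrDr mulr1.
  rewrite kk in k2.
  exists K.
    by rewrite /K truncn_ge_nat// ler_pdivlMr// mulrC ltW.
  have := HC1 K; rewrite ler_norml => /andP[g2 _].
  have := @gain_time R m n A hm hn tau (h * K%:R) s tau0; rewrite k1 sk0 => /(_ isT) g3.
  have g4 : gain A tau (h * K%:R) <= t * ((1 + tau) * s) + `|c|.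
    have {}g3 : gain A tau (h * K%:R) - gain A tau s <= `|c|.
      apply: (le_trans (ler_norm _)); rewrite distrC; apply: (le_trans g3).
      apply: le_trans (ler_norm _); rewrite /c lerD2r ler_wpM2l//.
        by rewrite mulr_ge0 ?addr_ge0.
      by rewrite lerBlDl ltW.
    by move: g3 gs; move: (gain _ _ _) (gain _ _ _) (t * _) `|c| => *; lra.
  have g5 : gain A tau (h * K%:R) / (1 + tau) <= t * s + `|c|.
    rewrite ler_pdivrMr//; apply: (le_trans g4); rewrite [leRHS]mulrDl lerD//.
      by rewrite (_ : t * ((1 + tau) * s) = t * s * (1 + tau)) //; ring.
    by rewrite ler_peMr.
  have g6 : t * s <= t * (h * K%:R) + `|t| * h.
    rewrite -lerBlDl -mulrBr; apply: (le_trans (ler_norm _)); rewrite normrM ler_wpM2l//.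
    by rewrite ger0_norm ?subr_ge0// lerBlDl ltW.
  move: g2 g5 g6; move: (gain _ _ _ / _) (t * s) (t * _) `|c| (`|t| * h) (eps * _) (hsum _ _ _ _ _ _) => *; lra.
Qed.

End HsumDim.

Lemma eventually_ge (R : realType) (c h B : R) : 0 < c -> 0 < h ->
  exists K0 : nat, forall K, (K0 <= K)%N -> B <= c * (h * K%:R).
Proof.
move=> c0 h0; exists (Num.truncn (B / (c * h))).+1 => K kK.
rewrite mulrA mulrC -ler_pdivrMr ?mulr_gt0//.
apply: (le_trans (ltW (truncnS_gt _))); by rewrite ler_nat.
Qed.

(** Exponent of the cover: number of pieces times radius to the power [t]. The constant [L3] per
    window and the bad windows together eat up less than the room between [x] and [t]. *)
Lemma upper_exponent (R : realType) (tau h L3 eps gap x t mR K G B C C' l : R) :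
  0 < tau -> 0 < h -> 0 <= mR -> 0 <= K -> 0 <= G -> 0 <= B ->
  eps <= 1 -> 0 < eps -> 0 <= L3 -> L3 <= eps * h -> gap = tau * (t - x) / 4 ->
  eps * (tau + mR + (tau + 1) * mR) <= gap ->
  G <= mR * (h * K) ->
  G <= (x + t) / 2 * (h * K) + eps * (h * K) + C' -> B <= eps * K + C ->
  (tau * h + L3) * (G / h + mR * B) + t * (l - tau * (h * K)) <=
    tau * C' + (tau + 1) * mR * h * `|C| + t * l - gap * (h * K).
Proof.
move=> tau0 h0 m0 K0 G0 B0 e1 e0 L30 Lh gE eD hG G1 hB.
have s0 : 0 <= h * K by rewrite mulr_ge0// ltW.
have q1 : tau * G <= tau * ((x + t) / 2 * (h * K) + eps * (h * K) + C') by rewrite ler_pM2l.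
have q2 : L3 * (G / h) <= eps * (mR * (h * K)).
  apply: (@le_trans _ _ (eps * h * (G / h))); first by rewrite ler_wpM2r// divr_ge0// ltW.
  rewrite (_ : eps * h * (G / h) = eps * G); last by field; rewrite gt_eqF.
  by rewrite ler_pM2l.
have q3 : (tau * h + L3) * (mR * B) <= (tau + 1) * h * (mR * (eps * K + `|C|)).
  apply: ler_pM; rewrite ?mulr_ge0// ?addr_ge0 ?mulr_ge0 ?(ltW tau0) ?(ltW h0)//.
    by rewrite mulrDl mul1r lerD2l (le_trans Lh)// ger_pMl.
  by rewrite ler_wpM2l// (le_trans hB)// lerD2l ler_norm.
have q4 : eps * (tau + mR + (tau + 1) * mR) * (h * K) <= gap * (h * K) by rewrite ler_wpM2r.
have E1 : (tau * h + L3) * (G / h + mR * B) = tau * G + L3 * (G / h) + (tau * h + L3) * (mR * B).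
  by field; rewrite gt_eqF.
rewrite E1 gE; rewrite gE in q4; move: q1 q2 q3 q4.
have -> : tau * ((x + t) / 2 * (h * K) + eps * (h * K) + C') =
  tau * x * (h * K) / 2 + tau * t * (h * K) / 2 + eps * tau * (h * K) + tau * C' by field.
have -> : (tau + 1) * h * (mR * (eps * K + `|C|)) = eps * ((tau + 1) * mR) * (h * K) + (tau + 1) * mR * h * `|C|.
  by ring.
have -> : eps * (tau + mR + (tau + 1) * mR) * (h * K) =
   eps * tau * (h * K) + eps * (mR * (h * K)) + eps * ((tau + 1) * mR) * (h * K) by ring.
have -> : tau * (t - x) / 4 * (h * K) = tau * t * (h * K) / 4 - tau * x * (h * K) / 4 by field.
have -> : t * (l - tau * (h * K)) = t * l - tau * t * (h * K) by ring.
move: (tau * G) (L3 * _) ((_ + _) * (mR * B)) (tau * x * _) (tau * t * _) (t * l) (tau * C').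
move: (eps * tau * _) (eps * (mR * _)) (eps * ((tau + 1) * mR) * _) ((tau + 1) * mR * h * _) => *; lra.
Qed.

Section UpperBound.
Context (R : realType) (m n : nat) (A : 'M[R]_(m, n)).
Hypotheses (hm : (0 < m)%N) (hn : (0 < n)%N).
Context (tau : R).
Hypothesis tau_reg : regular_exponents R m n tau.

Local Open Scope quotient_scope.
Local Notation d := ((m + n)%:R : R).
Local Notation C1 := (2 * d + 1).

Lemma hsum_ge0 (h eta : R) K1 K : 0 < h -> 0 <= hsum A tau h eta K1 K.
Proof. by move=> h0; rewrite /hsum mulr_ge0 ?(ltW h0)// sumr_ge0. Qed.

Lemma hsum_le (h eta : R) K1 K : 0 < h -> hsum A tau h eta K1 K <= m%:R * (h * K%:R).
Proof.
move=> h0; rewrite /hsum mulrCA ler_pM2l//.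
apply: (@le_trans _ _ (\sum_(i < K) m%:R)); last by rewrite sumr_const card_ord mulr_natr.
by apply: ler_sum => i _; rewrite ler_nat; case: ifP => // _; exact: ak_le.
Qed.

Lemma cell_sum (h eta : R) K1 K : 0 < h ->
  (\sum_(i < K) cell_exponent A tau h eta K1 i)%:R =
  hsum A tau h eta K1 K / h + m%:R * (count (fun k => ~~ good A tau h eta K1 k) (iota 0 K))%:R.
Proof.
move=> h0; rewrite /hsum [h * _]mulrC mulfK ?gt_eqF//.
elim: K => [|K IH]; first by rewrite !big_ord0 mulr0 addr0.
rewrite (count_iotaS (fun k => ~~ good A tau h eta K1 k) K) !big_ord_recr /=.
rewrite natrD IH (natrD _ (count _ _)) mulrDr -!addrA; congr (_ + _).
rewrite addrCA; congr (_ + _); rewrite /cell_exponent; case: ifP => _ /=.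
  by rewrite mulr0 addr0.
by rewrite mulr1 add0r.
Qed.

Lemma torus_cube (b : torus R m) : exists2 x : 'cV[R]_m, \pi_(torus R m) x = b & forall i, 0 <= x i 0 <= 1.
Proof.
exists (repr b - int_vec R (\col_i Num.floor (repr b i 0))).
  rewrite -[RHS]reprK; apply/torus_piP; exists (- (\col_i Num.floor (repr b i 0))).
  rewrite addrC addKr; apply/matrixP => i j; rewrite !mxE.
  by rewrite rmorphN.
move=> i; rewrite sub_mxE !mxE subr_ge0 floor_le_tmp /=.
by rewrite lerBlDl ltW// -intrD1 floorD1_gt.
Qed.

Lemma upper_measure (x t : R) : dim_formula A tau = x%:E -> x < t -> 0 <= t ->
  hausdorff_measure t (uniform_approx A (psi_pow tau)) = 0%E.
Proof.
move=> Ex xt t0; have taup := tau_gt0 tau_reg; have tau0 := ltW taup.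
pose gap := tau * (t - x) / 4.
have gap0 : 0 < gap by rewrite divr_gt0// mulr_gt0// subr_gt0.
pose D : R := tau + m%:R + (tau + 1) * m%:R.
have D0 : 0 < D by rewrite !addr_gt0 ?mulr_gt0 ?ltr0n ?addr_gt0.
pose eps := Num.min 1 (gap / D).
have eps0 : 0 < eps by rewrite lt_min ltr01 divr_gt0.
have eps1 : eps <= 1 by rewrite ge_min lexx.
have epsD : eps * D <= gap by rewrite -ler_pdivlMr// ge_min lexx orbT.
clearbody eps.
have C10 : 0 < C1 by rewrite ltr_wpDl// mulr_ge0.
(* [M] exceeds e^(tau h) by at most a constant factor whose logarithm is [L3]; [h] is taken so large
   that [L3 <= eps * h]. *)
pose L3 := ln (2 * (C1 + 1) + 1).
have L30 : 0 <= L3 by rewrite ln_ge0// lerDr mulr_ge0// addr_ge0// ltW.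
have h10 : 0 < 1 + L3 / eps by rewrite ltr_wpDr// divr_ge0// ltW.
have [h [eta [K1 [hh h0 eta0 K10 K1e] [[C HC] _ up]]]] := hsum_dim hm hn tau_reg Ex eps0 h10.
have Lh : L3 <= eps * h.
  rewrite mulrC -ler_pdivrMr//; apply: le_trans hh; rewrite lerDr//.
pose M := (Num.truncn (2 * ((C1 + 1) * expR (tau * h)))).+1.
have hM : 2 * ((C1 + 1) * expR (tau * h)) < M%:R by exact: truncnS_gt.
have lnMle : ln M%:R <= tau * h + L3.
  rewrite addrC -ler_expR lnK ?posrE ?ltr0n// expRD /L3 lnK ?posrE; last first.
    by rewrite ltr_wpDl// mulr_ge0// addr_ge0// ltW.
  rewrite /M -natr1 [leRHS]mulrDl mul1r lerD// -?mulrA.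
    by rewrite truncn_le mulr_ge0// mulr_ge0 ?expR_ge0// addr_ge0// ltW.
  by rewrite -expR0 ler_expR mulr_ge0// ltW.
have M0 : (0 : R) < M%:R by rewrite ltr0n.
clearbody M.
have [ks Hks] := eventually_ge (ln (2 * (C1 + 1)) + h) eta0 h0.
pose E i := [set \pi_(torus R m) b | b in cube_targets A tau h (ks + i)].
apply: (@hausdorff_measure_sub0 _ _ _ _ (\bigcup_i E i)).
  move=> b bD; have [x' xb xc] := torus_cube b.
  have [T0 HT] := (uniform_approxP A (psi_pow tau) xb).1 bD.
  have [i Hi] := eventually_ge T0 ltr01 h0.
  exists i => //; exists x' => //; split=> // k kk.
  have Tk : T0 < expR (h * k%:R).
    have := Hi k (leq_trans (leq_addl _ _) kk); rewrite mul1r => /le_lt_trans; apply.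
    by apply: lt_le_trans (expR_ge1Dx _); rewrite ltrDr.
  have [z [z1 z2]] := HT _ Tk; exists z; split=> //.
  apply: (le_trans z1); rewrite /psi_pow /powR gt_eqF ?expR_gt0// expRK.
  by rewrite mulNr.
apply: hausdorff_null => // i e e0.
have cov k : (ks + i <= k)%N -> ln (2 * (C1 + 1)) + h <= eta * (h * k%:R).
  by move=> kk; apply: Hks; exact: leq_trans (leq_addr _ _) kk.
have [N0 HN0] := cover_iter A tau_reg h0 eta0 K10 K1e hM cov.
have [C' HC'] := up ((x + t) / 2) (ltac:(lra)).
pose C6 := tau * C' + (tau + 1) * m%:R * h * `|C| + t * ln (2 * C1).
pose n0 : R := N0%:R + 1.
have n00 : 0 < n0 by rewrite ltr_wpDl.
have [Ka HKa] := eventually_ge (C6 + ln (n0 / e)) gap0 h0.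
have [Kb HKb] := eventually_ge (ln (2 * C1 / e)) taup h0.
have [K kK hK] := HC' (maxn (ks + i) (maxn Ka Kb)).
move: kK; rewrite !geq_max => /and3P[k1 k2 k3].
have [X [sX HX]] := HN0 _ k1.
pose rad := expR (- (tau * (h * K%:R))).
have rad0 : 0 < rad by exact: expR_gt0.
have r0 : 0 < 2 * C1 * rad by rewrite mulr_gt0// mulr_gt0.
exists (size X), (2 * C1 * rad), (fun j => [set \pi_(torus R m) b | b in [set b | `|b - nth 0 X j| <= C1 * rad]]).
split.
- exact: ltW.
- have := HKb _ k3; rewrite -ler_expR lnK ?posrE ?divr_gt0 ?mulr_gt0//.
  by rewrite ler_pdivrMr// [expR _ * e]mulrC /rad expRN ler_pdivrMr ?expR_gt0.
- apply: (@le_trans _ _ (n0 * expR (C6 - gap * (h * K%:R)))); last first.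
    have : ln (n0 / e) <= gap * (h * K%:R) - C6 by rewrite lerBrDl HKa.
    rewrite -ler_expR lnK ?posrE ?divr_gt0//.
    rewrite ler_pdivrMr// (_ : C6 - gap * (h * K%:R) = - (gap * (h * K%:R) - C6)); last by rewrite opprB.
    by rewrite expRN ler_pdivrMr ?expR_gt0// mulrC.
  have -> : (2 * C1 * rad) `^ t = expR (t * (ln (2 * C1) - tau * (h * K%:R))).
    by rewrite /powR gt_eqF// lnM ?posrE ?mulr_gt0// /rad expRK.
  have sX' : (size X)%:R <= n0 * expR ((tau * h + L3) * (\sum_(i < K) cell_exponent A tau h eta K1 i)%:R).
    apply: (@le_trans _ _ (N0 * M ^ (\sum_(i < K) cell_exponent A tau h eta K1 i))%:R).
      by rewrite ler_nat.
    rewrite natrM natrX; apply: ler_pM; rewrite ?lerDl ?exprn_ge0//.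
    rewrite mulrC expRM_natl -(lnK M0) lerXn2r ?nnegrE ?expR_ge0// ler_expR//.
  apply: (@le_trans _ _ (n0 * expR ((tau * h + L3) * (\sum_(i < K) cell_exponent A tau h eta K1 i)%:R) *
     expR (t * (ln (2 * C1) - tau * (h * K%:R))))).
    by rewrite ler_wpM2r ?expR_ge0.
  rewrite -mulrA ler_pM2l// -expRD ler_expR cell_sum//.
  have hB := HC K; move: hK hB; set B := (count _ _)%:R; set G := hsum _ _ _ _ _ _.
  have hG : G <= m%:R * (h * K%:R) by exact: hsum_le.
  have B0 : 0 <= B by []; have G0 : 0 <= G by exact: hsum_ge0.
  by move=> hK hB; apply: upper_exponent hK hB.
- move=> b [b' /HX[w wX bw] <-]; exists (index w X); first by rewrite /= index_mem.
  by exists b' => //=; rewrite nth_index.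
- move=> j _ _ [b1 /= h1 <-] [b2 /= h2 <-].
  apply: (le_trans (torus_dist_le b1 b2)).
  rewrite -(subrK (nth 0 X j) b1) -addrA; apply: (le_trans (ler_normD _ _)).
  by rewrite -mulrA mulr_natl mulr2n lerD// distrC.
Qed.

End UpperBound.

(** * Trees escaping small families *)

Section NestedLimit.
Context (R : realType) (m : nat).

(** In each coordinate the intervals of half-width [2 * r k] around [x k] are nested; the limit is
    the supremum of their left ends. *)
Lemma nested_limit (x : nat -> 'cV[R]_m) (r : nat -> R) : (forall k, 0 <= r k) ->
  (forall k, 2 * r k.+1 <= r k) -> (forall k, `|x k.+1 - x k| <= r k) ->
  exists b, forall k, `|b - x k| <= 2 * r k.
Proof.
move=> r0 rS xS.
have lowS i k : x k i 0 - 2 * r k <= x k.+1 i 0 - 2 * r k.+1.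
  have /cV_norm_le[_ /(_ i)] := xS k; rewrite sub_mxE ler_norml => /andP[h _].
  by have := rS k; lra.
have upS i k : x k.+1 i 0 + 2 * r k.+1 <= x k i 0 + 2 * r k.
  have /cV_norm_le[_ /(_ i)] := xS k; rewrite sub_mxE ler_norml => /andP[_ h].
  by have := rS k; lra.
have low i k k' : (k <= k')%N -> x k i 0 - 2 * r k <= x k' i 0 - 2 * r k'.
  elim: k' => [|k' IH]; first by rewrite leqn0 => /eqP ->.
  rewrite leq_eqVlt ltnS => /orP[/eqP <-//|/IH h]; exact: le_trans (lowS i k').
have up i k k' : (k <= k')%N -> x k' i 0 + 2 * r k' <= x k i 0 + 2 * r k.
  elim: k' => [|k' IH]; first by rewrite leqn0 => /eqP ->.
  rewrite leq_eqVlt ltnS => /orP[/eqP <-//|/IH h]; exact: le_trans (upS i k') h.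
have lu i k k' : x k i 0 - 2 * r k <= x k' i 0 + 2 * r k'.
  have [kk|kk] := leqP k k'.
    by apply: (le_trans (low i _ _ kk)); have := r0 k'; lra.
  by apply: le_trans (up i _ _ (ltnW kk)); have := r0 k; lra.
pose S i := [set x k i 0 - 2 * r k | k in [set: nat]].
have Sub i k : ubound (S i) (x k i 0 + 2 * r k) by move=> _ [k' _ <-]; exact: lu.
have hS i : has_sup (S i).
  by split; [exists (x 0%N i 0 - 2 * r 0%N), 0%N | exists (x 0%N i 0 + 2 * r 0%N)].
exists (\col_i sup (S i)) => k; apply/cV_norm_le; split=> [|i]; first by rewrite mulr_ge0.
rewrite sub_mxE mxE.
have h1 : sup (S i) <= x k i 0 + 2 * r k by apply: ge_sup => //; case: (hS i).
have h2 : x k i 0 - 2 * r k <= sup (S i) by apply: ub_le_sup; [case: (hS i)|exists k].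
by rewrite ler_norml; apply/andP; split; lra.
Qed.

End NestedLimit.

(* A greedy form of the mass distribution principle: [potential k z] is the mass of the pieces of
   level at least [k] meeting the ball of [z]. A piece of level above [k] meets the ball of at most
   one child of [z], so some child carries no more than the average, and the resulting branch
   avoids every piece. *)
Section Tree.
Context (R : realType) (m : nat) (T : Type) (pos : T -> 'cV[R]_m) (node : nat -> T -> Prop).
Context (N : nat -> nat) (r : nat -> R).
Hypotheses (N0 : forall k, (0 < N k)%N) (r0 : forall k, 0 < r k) (rS : forall k, 2 * r k.+1 <= r k).
Hypothesis children : forall k z, node k z -> exists ch : 'I_(N k) -> T,
  (forall i, node k.+1 (ch i) /\ `|pos (ch i) - pos z| <= r k) /\
  (forall i j, i != j -> 8 * r k.+1 <= `|pos (ch i) - pos (ch j)|).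

Definition node_mass k : R := (\prod_(i < k) N i)%:R^-1.

Lemma node_mass_gt0 k : 0 < node_mass k.
Proof. by rewrite invr_gt0 ltr0n prodn_gt0. Qed.

Lemma node_massS k : node_mass k = (N k)%:R * node_mass k.+1.
Proof.
rewrite /node_mass big_ord_recr /= natrM invfM mulrCA mulfV ?mulr1//.
by rewrite pnatr_eq0 -lt0n.
Qed.

Lemma radius_le k k' : (k <= k')%N -> r k' <= r k.
Proof.
elim: k' => [|k' IH]; first by rewrite leqn0 => /eqP ->.
rewrite leq_eqVlt ltnS => /orP[/eqP <-//|/IH]; apply: le_trans.
by apply: le_trans (rS k'); have := r0 k'.+1; lra.
Qed.

Context (U : nat -> set 'cV[R]_m) (K : nat -> nat).
Hypothesis diamU : forall j x y, U j x -> U j y -> `|x - y| <= r (K j).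

(** All descendants of [z] stay within [2 * r k] of it, because the radii at least halve from level
    to level. *)
Definition hit j k z := `[< exists2 x, U j x & `|x - pos z| <= 2 * r k >].
Definition hit_mass j k z : R := if (k <= K j)%N && hit j k z then node_mass (K j) else 0.
Definition potential k z : \bar R := (\sum_(0 <= j <oo) (hit_mass j k z)%:E)%E.

Lemma hit_mass_ge0 j k z : 0 <= hit_mass j k z.
Proof. by rewrite /hit_mass; case: ifP => // _; exact/ltW/node_mass_gt0. Qed.

(** If a piece hit two children, their positions would be within 2 + 1 + 2 = 5 radii of level
    [k.+1], against a separation of 8. *)
Lemma hit_mass_children k z (ch : 'I_(N k) -> T) j :
  (forall i, `|pos (ch i) - pos z| <= r k) ->
  (forall i j, i != j -> 8 * r k.+1 <= `|pos (ch i) - pos (ch j)|) ->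
  \sum_i hit_mass j k.+1 (ch i) <= hit_mass j k z.
Proof.
move=> near far.
have [[i /andP[kK /asboolP[x Ux xi]]]|none] := pselect (exists i, (k.+1 <= K j)%N && hit j k.+1 (ch i)); last first.
  rewrite big1 ?hit_mass_ge0// => i _; rewrite /hit_mass; case: ifP => // h.
  by exfalso; apply: none; exists i.
rewrite (bigD1 i)//= big1 ?addr0 => [|i' ii']; last first.
  rewrite /hit_mass; case: ifP => // /andP[_ /asboolP[y Uy yi]].
  have h1 := far _ _ ii'; have h2 := diamU Uy Ux; have h3 := radius_le kK; have h4 := r0 k.+1.
  have d1 := ler_distD y (pos (ch i')) (pos (ch i)); have d2 := ler_distD x y (pos (ch i)).
  by rewrite distrC in yi; lra.
rewrite /hit_mass kK (ltnW kK) /=.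
have -> : hit j k.+1 (ch i) by apply/asboolP; exists x.
have -> // : hit j k z.
apply/asboolP; exists x => //; rewrite -(subrK (pos (ch i)) x) -addrA.
apply: (le_trans (ler_normD _ _)); have := near i; have := rS k; move: xi.
by move: `|x - _| `|pos (ch i) - pos z| => *; lra.
Qed.

Lemma potential_step k z : node k z -> (potential k z < (node_mass k)%:E)%E ->
  exists z', [/\ node k.+1 z', `|pos z' - pos z| <= r k & (potential k.+1 z' < (node_mass k.+1)%:E)%E].
Proof.
move=> kz pz; have [ch [ch1 ch2]] := children kz; apply: contrapT => H.
have ge i : ((node_mass k.+1)%:E <= potential k.+1 (ch i))%E.
  rewrite leNgt; apply/negP => lt; apply: H; exists (ch i).
  by have [? ?] := ch1 i; split.
move: pz; rewrite ltNge => /negP; apply; rewrite node_massS.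
apply: (@le_trans _ _ (\sum_(i < N k) potential k.+1 (ch i))%E).
  apply: (@le_trans _ _ (\sum_(i < N k) (node_mass k.+1)%:E)%E); last exact: lee_sum.
  by rewrite sumEFin sumr_const card_ord mulr_natl.
rewrite /potential -nneseries_sum; last by move=> i j _; rewrite lee_fin hit_mass_ge0.
apply: lee_nneseries => [j _ _|j _].
  by rewrite sume_ge0// => i _; rewrite lee_fin hit_mass_ge0.
rewrite sumEFin lee_fin; apply: hit_mass_children => // i; by have [] := ch1 i.
Qed.

Lemma tree_escape z0 : node 0 z0 -> (\sum_(0 <= j <oo) (node_mass (K j))%:E < 1)%E ->
  exists b, [/\ forall k, exists2 z, node k z & `|b - pos z| <= 2 * r k,
    `|b - pos z0| <= 2 * r 0%N & forall j, ~ U j b].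
Proof.
move=> z0n s1; pose P k z := node k z /\ (potential k z < (node_mass k)%:E)%E.
have P0 : P 0%N z0.
  split=> //; apply: (@le_lt_trans _ _ (\sum_(0 <= j <oo) (node_mass (K j))%:E)%E).
    apply: lee_nneseries => j _; rewrite lee_fin ?hit_mass_ge0//.
    by rewrite /hit_mass; case: ifP => // _; exact/ltW/node_mass_gt0.
  by rewrite /node_mass big_ord0 invr1.
have [g Hg] : {g : nat * T -> T & forall kz, P kz.1 kz.2 -> P kz.1.+1 (g kz) /\ `|pos (g kz) - pos kz.2| <= r kz.1}.
  apply: (@choice _ _ (fun kz z' => P kz.1 kz.2 -> P kz.1.+1 z' /\ `|pos z' - pos kz.2| <= r kz.1)).
  move=> [k z] /=; have [Pz|nPz] := pselect (P k z); last by exists z.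
  have [z' [h1 h2 h3]] := potential_step Pz.1 Pz.2.
  by exists z'.
pose zs := fix zs k := if k is k'.+1 then g (k', zs k') else z0.
have Pzs k : P k (zs k) by elim: k => [//|k IH] /=; exact: (Hg (k, zs k) IH).1.
have dzs k : `|pos (zs k.+1) - pos (zs k)| <= r k by exact: (Hg (k, zs k) (Pzs k)).2.
have [b Hb] := nested_limit (fun k => ltW (r0 k)) rS dzs.
exists b; split.
- by move=> k; exists (zs k); [exact: (Pzs k).1 | exact: Hb].
- exact: (Hb 0%N).
- move=> j Ub; have [_] := Pzs (K j); rewrite ltNge => /negP; apply.
  (* A piece containing [b] would be hit at its own level and alone contribute the whole mass of the
     node. *)
  have hj : hit_mass j (K j) (zs (K j)) = node_mass (K j).
    rewrite /hit_mass leqnn /=; have -> // : hit j (K j) (zs (K j)).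
    by apply/asboolP; exists b.
  rewrite -hj; apply: (@le_trans _ _ (\sum_(0 <= i < j.+1) (hit_mass i (K j) (zs (K j)))%:E)%E).
    rewrite big_nat_recr//= leeDr// sume_ge0// => i _; by rewrite lee_fin hit_mass_ge0.
  apply: nneseries_lim_ge => i _ _; by rewrite lee_fin hit_mass_ge0.
Qed.

End Tree.

(** * Children of a lattice point *)

Section LowerStep.
Context (R : realType) (m n : nat) (A : 'M[R]_(m, n)).
Context (tau : R).
Hypothesis tau_reg : regular_exponents R m n tau.

Local Notation d := ((m + n)%:R : R).

Let tau0 : 0 <= tau. Proof. exact/ltW/(tau_gt0 tau_reg). Qed.

Context (h eta : R) (K1 M : nat).
Hypotheses (h0 : 0 < h) (eta0 : 0 < eta) (h4 : 4 <= expR h)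
  (hM : d * (8 * expR (- (tau * h)) * M%:R) <= 4^-1).

Local Notation sk k := (h * k%:R).
Local Notation rad k := (expR (- (tau * sk k))).

Let radS k : expR (- (tau * h)) * rad k = rad k.+1.
Proof. by rewrite -expRD; congr expR; rewrite -natr1; ring. Qed.

Let rad_le k : rad k.+1 <= rad k.
Proof. by rewrite -(radS k) ger_pMl ?expR_gt0// -expR0 ler_expR oppr_le0 mulr_ge0// ltW. Qed.

Let ek k : 4 * expR (sk k) <= expR (sk k.+1).
Proof.
by rewrite (_ : sk k.+1 = h + sk k) ?expRD ?ler_pM2r ?expR_gt0//; rewrite -natr1; ring.
Qed.

Definition branching k : nat := if good A tau h eta K1 k then (M ^ ak A tau h eta k)%N else 1%N.

(** Half of the allowed size leaves room for the displacement added in passing to a child. *)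
Definition is_node k (z : 'cV[int]_(m + n)) : Prop := `|ypart R z| <= expR (sk k) / 2.

Lemma node_children k z : d * expR (- (eta * sk k.+1)) <= expR (- (tau * h)) / 8 ->
  is_node k z -> exists ch : 'I_(branching k) -> 'cV[int]_(m + n),
  (forall i, is_node k.+1 (ch i) /\ `|xpart A (ch i) - xpart A z| <= rad k.+1 / 2) /\
  (forall i j, i != j -> 8 * (rad k.+2 / 2) <= `|xpart A (ch i) - xpart A (ch j)|).
Proof.
move=> small zk; rewrite /branching; case: ifP => gk; last first.
  exists (fun=> z); split=> [_|i j]; last by rewrite !ord1 eqxx.
  split; last by rewrite subrr normr0 divr_ge0// expR_ge0.
  apply: (le_trans zk); rewrite ler_pM2r ?invr_gt0//; apply: le_trans (ek k).
  by rewrite ler_peMl ?expR_ge0// ler1n.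
have /and4P[Kk nk nk1 /eqP aa] := gk.
pose V := Vk A tau h eta k.+1; pose f := optf V (theta tau (sk k.+1)).
have VV : Vsp A tau (sk k.+1) (- (eta * sk k.+1)) = V by exact: noncritE.
have fopt : optimal (row_base V) (theta tau (sk k.+1)) f by exact: optfP.
have f0 := optimal_neq0 (row_base_free V) (theta_gt0 tau (sk k.+1)) fopt.
pose J : finType := {j | (f j < m)%N}.
have cJ : #|{ffun J -> 'I_M}| = (M ^ ak A tau h eta k)%N by rewrite card_ffun card_ord aa card_sig.
pose sg := 8 * rad k.+2.
have sg0 : 0 < sg by rewrite mulr_gt0// expR_gt0.
have err (g : {ffun J -> 'I_M}) : exists z',
  (forall j : J, `|latv A z' 0 (f (val j)) - sg * (g j : nat)%:R| <= rad k.+2 / 8) /\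
  (forall i : 'I_(m + n), `|latv A z' 0 i| <= if (i < m)%N then rad k.+1 / 2 else 3 / 8 * expR (sk k.+1)).
  (* The default 0 is the value given to the selected y-coordinates. *)
  pose x j := if insub j is Some j' then sg * (g (j' : J) : nat)%:R else 0.
  have [v vV vx] := minor_coord x f0.
  have {}vV : (v <= V)%MS by rewrite -(eq_row_base V).
  pose c := 8 * expR (- (tau * h)) * M%:R.
  have c0 : 0 <= c by rewrite !mulr_ge0 ?expR_ge0.
  have vb : forall i, `|v 0 i| <= d * c * wt tau (sk k.+1) 0 i.
    apply: (dominated_coords fopt) => // j; rewrite vx /x; case: insubP => [j' fj vj|_].
      rewrite /= in fj; rewrite /wt fj add0r normrM (gtr0_norm sg0) ger0_norm//.
      rewrite /c /sg -(radS k.+1) (_ : 8 * _ * M%:R * _ = 8 * (expR (- (tau * h)) * rad k.+1) * M%:R); last by ring.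
      by rewrite ler_wpM2l ?ler_nat 1?ltnW// mulr_ge0// mulr_ge0 ?expR_ge0.
    by rewrite normr0 mulr_ge0// ltW// wt_gt0.
  rewrite -VV in vV; have [z' _ zv] := spread_box vV.
  have zv' i : `|latv A z' 0 i - v 0 i| <= if (i < m)%N then rad k.+2 / 8 else expR (sk k.+1) / 8.
    apply: (le_trans (zv i)); rewrite /wt expRD mulrA.
    apply: (le_trans (ler_wpM2r (expR_ge0 _) small)); rewrite mulrAC; case: ifP => _.
      by rewrite radS.
    rewrite ler_pM2r ?invr_gt0// ger_pMl ?expR_gt0// -expR0 ler_expR oppr_le0 mulr_ge0//.
    exact: ltW.
  exists z'; split=> [j|i].
    have := zv' (f (val j)); rewrite (valP j) vx /x; congr (`|_ - _| <= _).
    by rewrite insubT ?(valP j)// => fj; congr (sg * (g _ : nat)%:R); apply: val_inj.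
  have := zv' i; have := vb i; have := rad_le k.+1; have e0 := expR_gt0 (sk k.+1).
  have r1 := expR_gt0 (- (tau * sk k.+1)).
  have := ler_wpM2r (ltW (wt_gt0 tau (sk k.+1) 0 i)) hM; rewrite -/c.
  have := ler_normD (latv A z' 0 i - v 0 i) (v 0 i); rewrite subrK /wt; case: ifP => _; rewrite add0r.
    move: (d * c * _) => q; move: (rad k.+2) (rad k.+1) r1; move: `|latv A z' 0 i - v 0 i| `|v 0 i| `|latv A z' 0 i|.
    by move=> *; lra.
  move: (d * c * _) => q; move: (rad k.+2) (rad k.+1) (expR (sk k.+1)) e0 r1.
  move: `|latv A z' 0 i - v 0 i| `|v 0 i| `|latv A z' 0 i|.
  by move=> *; lra.
have [F HF] := @choice _ _ _ err.
exists (fun i => z + F (enum_val (cast_ord (esym cJ) i))); split=> [i|i i' ii'].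
  have [_ H] := HF (enum_val (cast_ord (esym cJ) i)); move: (F _) H => z' H; split.
    apply/cV_norm_le; split=> [|j]; first by rewrite divr_ge0// expR_ge0.
    rewrite (ypartE A) latvD mxE -(ypartE A z); apply: (le_trans (ler_normD _ _)).
    have /cV_norm_le[_ /(_ j)] := zk; have := H (rshift m j); rewrite /= ltnNge leq_addr /=.
    have := ek k; move: (expR _) (expR _) `|_| `|_| => *; lra.
  apply/cV_norm_le; split=> [|j]; first by rewrite divr_ge0// expR_ge0.
  rewrite sub_mxE !xpartE latvD mxE addrAC subrr add0r.
  by have := H (lshift n j); rewrite /= ltn_ord.
pose g := enum_val (cast_ord (esym cJ) i); pose g' := enum_val (cast_ord (esym cJ) i').
have [j gj] : exists j, g j != g' j.
  apply: contrapT => H; move: ii' => /negP; apply; apply/eqP.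
  apply: (can_inj (cast_ordKV cJ)); apply: enum_val_inj; apply/ffunP => j.
  by apply/eqP; apply: contrapT => /negP gj; apply: H; exists j.
have [H _] := HF g; have [H' _] := HF g'; have {}H := H j; have {}H' := H' j.
have fj := valP j; rewrite /= in fj.
have far : sg <= `|sg * (g j : nat)%:R - sg * (g' j : nat)%:R|.
  rewrite -mulrBr normrM (gtr0_norm sg0) ler_peMr ?(ltW sg0)//.
  have : (g j != g' j :> nat) by [].
  rewrite neq_ltn => /orP[lt|lt].
    by rewrite distrC -natrB 1?ltnW// ger0_norm// ler1n subn_gt0.
  by rewrite -natrB 1?ltnW// ger0_norm// ler1n subn_gt0.
apply: (@le_trans _ _ `|latv A (F g) 0 (f (val j)) - latv A (F g') 0 (f (val j))|).
  have d1 := ler_distD (latv A (F g) 0 (f (val j))) (sg * (g j : nat)%:R) (sg * (g' j : nat)%:R).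
  have d2 := ler_distD (latv A (F g') 0 (f (val j))) (latv A (F g) 0 (f (val j))) (sg * (g' j : nat)%:R).
  rewrite distrC in H; have rp : 0 < rad k.+2 by exact: expR_gt0.
  by move: far d1 d2 H H'; rewrite /sg; move: `|_| `|_| `|_| `|_| `|_| => *; lra.
move: (f (val j)) fj => i0; case: (split_ordP i0) => i1 -> // _.
rewrite -!xpartE.
have -> : xpart A (F g) i1 0 - xpart A (F g') i1 0 = (xpart A (z + F g) - xpart A (z + F g')) i1 0.
  by rewrite sub_mxE !xpartE !latvD !mxE opprD addrACA subrr add0r.
by have /cV_norm_le[_] := lexx `|xpart A (z + F g) - xpart A (z + F g')|; apply.
Qed.

End LowerStep.

(** * The lower bound *)

Section TorusLocal.
Context (R : realType) (m : nat).
Local Open Scope quotient_scope.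

(** A representative of the class of [y] closer to [x] than [y] would differ from [y] by an integer
    vector of norm below 1/2, hence by 0. *)
Lemma torus_dist_local (x y : 'cV[R]_m) : `|x - y| <= 4^-1 ->
  `|x - y| <= torus_dist (\pi_(torus R m) x) (\pi_(torus R m) y).
Proof.
move=> xy; rewrite leNgt; apply/negP => lt; have := lt; rewrite -subr_gt0 => e0.
have [y' y'E xy'] := torus_dist_adherent (\pi_(torus R m) y) (erefl (\pi_(torus R m) x)) e0.
rewrite addrCA subrr addr0 in xy'.
have /torus_piP[p Ep] : \pi_(torus R m) y = \pi_(torus R m) y' by rewrite y'E.
have p0 : p = 0.
  apply: (@int_vec_small R); rewrite -Ep.
  have d1 := ler_distD x y y'; rewrite [ `|y - x|]distrC in d1.
  by move: d1 xy xy'; move: `|x - y| `|x - y'| `|y - y'| => *; lra.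
move: xy'; rewrite (_ : y' = y) ?ltxx//.
by apply/esym/subr0_eq; rewrite Ep p0 /int_vec raddf0.
Qed.

End TorusLocal.

Section LevelChoice.
Context (R : realType) (r mass : nat -> R) (Ks : nat) (t t2 : R).
Hypotheses (r0 : forall k, 0 < r k) (r1 : forall k, r k <= 1) (rS : forall k, r k.+1 <= r k)
  (rlim : forall e, 0 < e -> exists k, r k < e)
  (t0 : 0 <= t) (tt2 : t <= t2) (t20 : 0 < t2)
  (massr : forall k, (Ks <= k)%N -> mass k <= r k.+1 `^ t2).

Lemma level_small_mass (e : R) : 0 < e -> exists K, mass K <= e.
Proof.
move=> e0; have [k rk] := rlim (powR_gt0 t2^-1 e0).
pose K := maxn Ks k; exists K.
have rle i j : (i <= j)%N -> r j <= r i.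
  elim: j => [|j IH]; first by rewrite leqn0 => /eqP ->.
  by rewrite leq_eqVlt ltnS => /orP[/eqP <-//|/IH]; apply: le_trans.
apply: (le_trans (massr (leq_maxl _ _ : Ks <= K)%N)).
rewrite -[leRHS](powRr1 (ltW e0)) -(mulVf (lt0r_neq0 t20)) powRrM.
apply: ge0_ler_powR; rewrite ?nnegrE ?powR_ge0 ?(ltW t20) ?(ltW (r0 _))//.
by apply: le_trans (ltW rk); apply: rle; apply: leq_trans (leqnSn _); exact: leq_maxr.
Qed.

(** The level is the one with [r K.+1 < delta <= r K], which is why the mass bound is stated with
    the next radius. For [delta = 0] no such level exists, and one of mass at most [e] is taken
    instead. *)
Lemma level_choice (delta e : R) : 0 <= delta -> delta <= r Ks -> 0 < e ->
  exists K, delta <= r K /\ mass K <= delta `^ t + e.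
Proof.
rewrite le_eqVlt => /orP[/eqP <- _|d0 dK] e0.
  have [K HK] := level_small_mass e0; exists K; split; first exact: ltW.
  by apply: (le_trans HK); rewrite lerDr powR_ge0.
have ex : exists k, (Ks <= k)%N && (r k.+1 < delta).
  have [k rk] := rlim d0; exists (maxn Ks k); rewrite leq_maxl /=.
  apply: le_lt_trans rk; have : (k <= (maxn Ks k).+1)%N by apply: leq_trans (leq_maxr _ _) _.
  elim: (_.+1) => [|j IH]; first by rewrite leqn0 => /eqP ->.
  by rewrite leq_eqVlt ltnS => /orP[/eqP <-//|/IH]; apply: le_trans.
case: (ex_minnP ex) => K /andP[KK rK] Kmin; exists K; split.
  rewrite leNgt; apply/negP => lt; case: K KK rK Kmin lt => [|K] KK rK Kmin lt.
    by move: KK; rewrite leqn0 => /eqP K0; move: dK; rewrite K0 leNgt lt.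
  move: KK; rewrite leq_eqVlt => /orP[/eqP KK|KK].
    by move: dK; rewrite KK leNgt lt.
  have := Kmin K; rewrite -ltnS KK lt => /(_ isT).
  by rewrite ltnn.
apply: (le_trans (massr KK)); apply: (@le_trans _ _ (delta `^ t)); last by rewrite lerDl ltW.
apply: (@le_trans _ _ (r K.+1 `^ t)).
  by rewrite /powR gt_eqF// ler_expR; apply: ler_wnM2r => //; exact: ln_le0.
by apply: ge0_ler_powR; rewrite ?nnegrE ?(ltW d0) ?(ltW (r0 _))// ltW.
Qed.

End LevelChoice.

Lemma lower_exponent (R : realType) (tau h eps t2 t3 mR K k0 G C lM gap : R) :
  0 < tau -> 0 < h -> 0 <= mR -> 0 <= K -> 0 <= k0 -> 0 <= G -> 0 < eps -> eps <= tau ->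
  tau * h - eps * h <= lM -> gap = tau * (t3 - t2) / 2 -> eps * (tau + mR) <= gap ->
  G <= mR * (h * K) -> t3 * (h * K) - eps * (h * K) - C <= G ->
  t2 * (tau * (h * K)) + gap * (h * K) - tau * C - lM * (mR * k0) <= lM * (G / h - mR * k0).
Proof.
move=> tau0 h0 m0 K0 k00 G0 e0 et lMh gE eD hG hB.
have q1 : (tau * h - eps * h) * (G / h) <= lM * (G / h) by rewrite ler_wpM2r// divr_ge0// ltW.
have E1 : (tau * h - eps * h) * (G / h) = tau * G - eps * G by field; rewrite gt_eqF.
have q2 : tau * (t3 * (h * K) - eps * (h * K) - C) <= tau * G by rewrite ler_pM2l.
have q3 : eps * G <= eps * (mR * (h * K)) by rewrite ler_pM2l.
have q4 : eps * (tau + mR) * (h * K) <= gap * (h * K) by rewrite ler_wpM2r// mulr_ge0// ltW.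
rewrite mulrBr lerD2r -/(_ - _) lerBlDr; rewrite E1 in q1; move: q1 q2 q3 q4.
have -> : gap * (h * K) = t3 * (tau * (h * K)) / 2 - t2 * (tau * (h * K)) / 2 by rewrite gE; field.
have -> : tau * (t3 * (h * K) - eps * (h * K) - C) =
  t3 * (tau * (h * K)) - eps * tau * (h * K) - tau * C by ring.
have -> : eps * (tau + mR) * (h * K) = eps * tau * (h * K) + eps * (mR * (h * K)) by ring.
move: (t3 * _) (t2 * _) (eps * tau * _) (eps * (mR * _)) (tau * C) (eps * G) (tau * G) (lM * _) => *; lra.
Qed.

Section LowerBound.
Context (R : realType) (m n : nat) (A : 'M[R]_(m, n)).
Hypotheses (hm : (0 < m)%N) (hn : (0 < n)%N).
Context (tau : R).
Hypothesis tau_reg : regular_exponents R m n tau.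
Local Open Scope quotient_scope.
Local Notation d := ((m + n)%:R : R).

(** Starting the tree at level [k0] gives up at most [m] per skipped window. *)
Lemma branching_sum (h eta : R) K1 (M k0 K : nat) : 0 < h -> (0 < M)%N ->
  ln (M%:R : R) * (hsum A tau h eta K1 (K + k0) / h - m%:R * k0%:R) <=
  ln ((\prod_(i < K) branching A tau h eta K1 M (i + k0))%:R : R).
Proof.
move=> h0 M0; have lM0 : 0 <= ln (M%:R : R) by rewrite ln_ge0// ler1n.
pose e k : nat := if good A tau h eta K1 k then ak A tau h eta k else 0.
have bE k : branching A tau h eta K1 M k = (M ^ e k)%N.
  by rewrite /branching /e; case: ifP.
have -> : (\prod_(i < K) branching A tau h eta K1 M (i + k0) = M ^ \sum_(i < K) e (i + k0))%N.
  by rewrite expn_sum; apply: eq_bigr => i _; rewrite bE.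
rewrite natrX lnXn ?ltr0n// -[leRHS]mulr_natr ler_wpM2l// lerBlDr.
rewrite /hsum [h * _]mulrC mulfK ?gt_eqF//.
have -> : \sum_(k < K + k0) (if good A tau h eta K1 k then ak A tau h eta k else 0)%:R =
   (\sum_(k < K + k0) e k)%:R :> R by rewrite natr_sum.
rewrite -natrM -natrD ler_nat [leqRHS]addnC [(K + k0)%N]addnC big_split_ord /=.
apply: leq_add.
  apply: (@leq_trans (\sum_(i < k0) m)%N); last by rewrite sum_nat_const card_ord mulnC.
  by apply: leq_sum => i _; rewrite /e; case: ifP => // _; exact: ak_le.
by apply: leq_sum => i _; rewrite addnC.
Qed.

(** If the measure vanished, some cover would have weight below 1/2. A branch of the tree escapes
    that cover, yet its limit lies in the covered set. *)
Lemma lower_measure (x t : R) : dim_formula A tau = x%:E -> 0 <= t -> t < x ->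
  hausdorff_measure t (uniform_approx A (psi_pow tau)) <> 0%E.
Proof.
move=> Ex t0 tx H0; have taup := tau_gt0 tau_reg; have tau0 := ltW taup.
have d0 : 0 < d by rewrite ltr0n addn_gt0 hm.
(* [t2] is positive even if [t = 0], so masses tend to 0. The room between [t2] and [t3] absorbs all
   errors, and [t3 < x] allows the lower bound from the liminf. *)
pose t2 := (t + x) / 2; pose t3 := (t2 + x) / 2.
have [tt2 t23 t3x] : [/\ t < t2, t2 < t3 & t3 < x] by rewrite /t3 /t2; split; lra.
have t20 : 0 < t2 by exact: le_lt_trans tt2.
pose gap := tau * (t3 - t2) / 2.
have gap0 : 0 < gap by rewrite divr_gt0// mulr_gt0// subr_gt0.
clearbody t3; clearbody t2.
have D0 : 0 < tau + m%:R by rewrite addr_gt0// ltr0n.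
pose eps := Num.min tau (gap / (tau + m%:R)).
have eps0 : 0 < eps by rewrite lt_min taup divr_gt0.
have epst : eps <= tau by rewrite ge_min lexx.
have epsD : eps * (tau + m%:R) <= gap by rewrite -ler_pdivlMr// ge_min lexx orbT.
clearbody eps.
(* The factor [32 * d] in [E] makes the bound 1/4 of [hM] exact, and rounding [E] to [M] loses at
   most a factor 2; hence 64. *)
pose L := ln (64 * d).
have d1 : 1 <= d by rewrite ler1n addn_gt0 hm.
have d64 : 1 <= 64 * d by move: (d) d1 => D' ?; lra.
have L0 : 0 <= L by rewrite ln_ge0.
pose h1 := ln 4 + (ln 2 + L) / tau + L / eps + 1.
have l20 : 0 <= ln (2 : R) by rewrite ln_ge0// ler1n.
have l40 : 0 <= ln (4 : R) by rewrite ln_ge0// ler1n.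
have [Lt Le] : 0 <= (ln 2 + L) / tau /\ 0 <= L / eps by split; rewrite divr_ge0 ?addr_ge0// ltW.
have h10 : 0 < h1 by rewrite ltr_wpDl// !addr_ge0.
have [h [eta [K1 [hh h0 eta0 K10 K1e] [_ low _]]]] := hsum_dim hm hn tau_reg Ex eps0 h10.
have h4 : 4 <= expR h.
  by rewrite -[leLHS](@lnK R) ?posrE// ler_expR; apply: le_trans hh; rewrite /h1 -!addrA lerDl !addr_ge0.
have hL2 : ln 2 + L <= tau * h.
  by rewrite mulrC -ler_pdivrMr//; apply: le_trans hh; rewrite /h1; lra.
have hLe : L <= eps * h.
  by rewrite mulrC -ler_pdivrMr//; apply: le_trans hh; rewrite /h1; lra.
pose E := expR (tau * h) / (32 * d).
have E2 : 2 <= E.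
  rewrite ler_pdivlMr ?mulr_gt0// (_ : 2 * (32 * d) = 64 * d); last by ring.
  by rewrite -[leLHS](@lnK R) ?posrE ?mulr_gt0// ler_expR; apply: le_trans hL2; rewrite lerDr.
pose M := Num.truncn E.
have E0 : 0 <= E by apply: le_trans E2.
have /andP[ME EM] := truncn_itv E0; rewrite -/M in ME EM.
have M2 : E / 2 <= M%:R by rewrite -natr1 in EM; lra.
have M0 : (0 < M)%N by rewrite -(ltr_nat R); apply: lt_le_trans M2; rewrite divr_gt0// (lt_le_trans _ E2).
have lM : tau * h - eps * h <= ln (M%:R : R).
  apply: (@le_trans _ _ (tau * h - L)); first by rewrite lerB.
  rewrite -ler_expR [leRHS]lnK ?posrE ?ltr0n//; apply: le_trans M2.
  rewrite expRB /L lnK ?posrE ?mulr_gt0// /E; rewrite le_eqVlt; apply/orP; left; apply/eqP.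
  by move: (d) d0 => D' D'0; field; rewrite gt_eqF.
have hM : d * (8 * expR (- (tau * h)) * M%:R) <= 4^-1.
  apply: (@le_trans _ _ (d * (8 * expR (- (tau * h)) * E))).
    by rewrite ler_pM2l// ler_pM2l// mulr_gt0// expR_gt0.
  rewrite /E expRN le_eqVlt; apply/orP; left; apply/eqP.
  have := expR_gt0 (tau * h); move: (d) d0 (expR _) => D' D'0 e e0; field.
  by rewrite !gt_eqF.
clearbody M.
pose s k : R := h * k%:R.
pose rad k := expR (- (tau * s k)).
have [ka Hka] := eventually_ge (ln (8 * d * expR (tau * h))) eta0 h0.
have [kb Hkb] := eventually_ge (ln (8 : R)) taup h0.
pose k0 := maxn ka kb.
(* A node of level [k] has to approximate the limit for all T up to the next grid time, so [2 * r k]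
   is the radius of that next time. *)
pose r k := rad (k + k0).+1 / 2.
have r0 k : 0 < r k by rewrite divr_gt0// expR_gt0.
have rS k : 2 * r k.+1 <= r k.
  rewrite /r mulrC divfK// ler_pdivlMr// /rad /s.
  rewrite (_ : - (tau * (h * (k + k0).+1%:R)) = tau * h - (tau * (h * (k.+1 + k0).+1%:R))); last first.
    by rewrite -(natr1 (k.+1 + k0)) addSn; ring.
  rewrite [leRHS]expRD mulrC ler_pM2r ?expR_gt0//.
  by rewrite -[leLHS](@lnK R) ?posrE// ler_expR; apply: le_trans hL2; rewrite lerDl.
(* The ball of radius [2 * r 0] around the root then has diameter at most 1/4, which is where
   [torus_dist_local] applies. *)
have r01 : r 0%N <= 16^-1.
  have : rad k0.+1 <= 8^-1.
    rewrite /rad expRN lef_pV2 ?posrE ?expR_gt0// -[leLHS](@lnK R) ?posrE// ler_expR.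
    by apply: Hkb; apply: leq_trans (leq_maxr _ _) (leqnSn _).
  by rewrite /r add0n => ?; lra.
pose N k := branching A tau h eta K1 M (k + k0).
have N0 k : (0 < N k)%N by rewrite /N /branching; case: ifP => // _; rewrite expn_gt0 M0.
pose node k (z : 'cV[int]_(m + n)) := is_node h (k + k0) z.
have children k z : node k z -> exists ch : 'I_(N k) -> 'cV[int]_(m + n),
  (forall i, node k.+1 (ch i) /\ `|xpart A (ch i) - xpart A z| <= r k) /\
  (forall i j, i != j -> 8 * r k.+1 <= `|xpart A (ch i) - xpart A (ch j)|).
  move=> zk; have small : d * expR (- (eta * (h * (k + k0).+1%:R))) <= expR (- (tau * h)) / 8.
    have := Hka (k + k0).+1; rewrite (leq_trans (leq_maxl ka kb)); last by rewrite leqW// leq_addl.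
    move=> /(_ isT); rewrite -ler_expR lnK ?posrE ?mulr_gt0 ?expR_gt0// => q.
    rewrite !expRN ler_pdivrMr ?expR_gt0//.
    have e1 := expR_gt0 (tau * h); move: q; move: (expR (tau * h)) e1 => e1 e10; move: (expR _) => e2 q.
    rewrite (_ : e1^-1 / 8 * e2 = e2 / (8 * e1)); last by field; rewrite gt_eqF.
    by rewrite ler_pdivlMr ?mulr_gt0// mulrCA mulrA.
  exact: (node_children A tau_reg K1 h0 h4 hM small zk).
have lM0 : 0 <= ln (M%:R : R) by rewrite ln_ge0// ler1n.
have [C HC] := low _ t3x.
(* The bounded terms of the mass estimate: [r k.+1] belongs to a time two windows later and carries
   a factor 1/2, [C] comes from [hsum], and the last term from the skipped levels. *)
pose B := 2 * (t2 * (tau * h)) + t2 * ln 2 + tau * C + ln (M%:R : R) * (m%:R * k0%:R).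
have [Ks HKs] := eventually_ge B gap0 h0.
have massr k : (Ks <= k)%N -> node_mass R N k <= r k.+1 `^ t2.
  move=> kK; rewrite /powR gt_eqF// /r (ln_div) ?posrE ?expR_gt0// /rad expRK.
  have P0 : (0 : R) < (\prod_(i < k) N i)%:R by rewrite ltr0n prodn_gt0.
  rewrite /node_mass -(lnK P0) -expRN ler_expR.
  have b1 := branching_sum eta K1 k0 k h0 M0.
  have b2 := @lower_exponent R tau h eps t2 t3 m%:R (k + k0)%:R k0%:R _ C (ln M%:R) gap taup h0
    (ler0n _ _) (ler0n _ _) (ler0n _ _) (hsum_ge0 A tau eta K1 (k + k0) h0) eps0 epst lM erefl epsD
    (hsum_le A tau eta K1 (k + k0) h0) (HC (k + k0)%N).
  have b3 := HKs _ (leq_trans kK (leq_addr k0 k)).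
  have {b1 b2} b4 := le_trans b2 b1; rewrite -/N in b4.
  rewrite -/(s _) (_ : t2 * (- (tau * s (k.+1 + k0).+1) - ln 2) =
    - (t2 * (tau * (h * (k + k0)%:R)) + 2 * (t2 * (tau * h)) + t2 * ln 2)); last first.
    by rewrite /s addSn -(natr1 (k + k0).+1) -(natr1 (k + k0)); ring.
  rewrite lerN2; apply: le_trans b4; move: b3; rewrite /B; clear.
  move: (t2 * (tau * (h * _))) (t2 * (tau * h)) (t2 * ln 2) (tau * C) (ln _ * _) (gap * _) => *; lra.
have rS' k : r k.+1 <= r k by have := rS k; have := r0 k.+1; move: (r k) (r k.+1) => *; lra.
have r1 k : r k <= 1.
  elim: k => [|k IH]; last exact: le_trans IH.
  by apply: (le_trans r01); rewrite invf_le1// ler1n.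
have rlim e : 0 < e -> exists k, r k < e.
  move=> e0; have [K HK] := eventually_ge (- ln e) taup h0; exists K.
  apply: (@lt_le_trans _ _ (rad (K + k0).+1)).
    by rewrite /r ltr_pdivrMr// ltr_pMr ?expR_gt0// ltr1n.
  rewrite /rad -[leRHS]lnK ?posrE// ler_expR lerNl; apply: HK.
  by rewrite leqW// leq_addr.
have P0 : hausdorff_premeasure t (r Ks) (uniform_approx A (psi_pow tau)) = 0%E.
  exact: hausdorff_premeasure_eq0.
have : (hausdorff_premeasure t (r Ks) (uniform_approx A (psi_pow tau)) < (2^-1)%:E)%E.
  by rewrite P0 lte_fin invr_gt0.
move=> /ereal_inf_lt[_ [U [DU dU] <-] sU].
pose U' j := [set x | `|x - xpart A 0| <= 2 * r 0%N /\ U j (\pi_(torus R m) x)].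
have [Kj HK] : {Kj : nat -> nat & forall j, (forall x y, U' j x -> U' j y -> `|x - y| <= r (Kj j)) /\
    ((node_mass R N (Kj j))%:E <= diam_pow t (U j) + (4^-1 / (2 ^ j.+1)%:R)%:E)%E}.
  apply: (@choice _ _ (fun j Kj => (forall x y, U' j x -> U' j y -> `|x - y| <= r Kj) /\
    ((node_mass R N Kj)%:E <= diam_pow t (U j) + (4^-1 / (2 ^ j.+1)%:R)%:E)%E)) => j.
  (* These errors add up to 1/4, so with a cover of weight below 1/2 the total mass stays below
     1. *)
  have e0 : 0 < 4^-1 / (2 ^ j.+1)%:R :> R by rewrite divr_gt0// ltr0n expn_gt0.
  have [U0|/set0P[u Uu]] := eqVneq (U j) set0.
    have [K HKm] := level_small_mass r0 rS' rlim t20 massr e0; exists K; split.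
      by move=> v w [_]; rewrite U0.
    by rewrite /diam_pow U0 eqxx add0e lee_fin.
  have dg : (0 <= diam (U j))%E := diam_ge0 Uu.
  have df : diam (U j) \is a fin_num.
    by rewrite ge0_fin_numE// (le_lt_trans (dU j))// ltry.
  have [||K [K1' K2']] := @level_choice R r (node_mass R N) Ks t t2 r0 r1 rS' rlim t0 (ltW tt2) t20 massr (fine (diam (U j))) _ _ _ e0.
  - exact: fine_ge0.
  - by rewrite -lee_fin fineK.
  exists K; split=> [v w [vb Uv] [wb Uw]|]; last first.
    rewrite /diam_pow; case: eqP => [E'|_]; first by rewrite E' in Uu.
    by rewrite -(fineK df) poweR_EFin -EFinD lee_fin.
  apply: le_trans K1'; apply: (@le_trans _ _ (torus_dist (\pi_(torus R m) v) (\pi_(torus R m) w))).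
    apply: torus_dist_local; have d1' := ler_distD (xpart A 0) v w; rewrite [ `|xpart A 0 - w|]distrC in d1'.
    by move: d1' vb wb r01; clear; move: (r 0%N) `|_| `|_| `|_| => *; lra.
  rewrite -lee_fin fineK//; apply: ereal_sup_ubound.
  by exists (\pi_(torus R m) v) => //; exists (\pi_(torus R m) w).
have sK : (\sum_(0 <= j <oo) (node_mass R N (Kj j))%:E < 1)%E.
  apply: (@le_lt_trans _ _ (\sum_(0 <= j <oo) (diam_pow t (U j) + (4^-1 / (2 ^ j.+1)%:R)%:E))%E).
    apply: lee_nneseries => [j _ _|j _]; last by have [] := HK j.
    by rewrite lee_fin; exact/ltW/node_mass_gt0.
  apply: (@le_lt_trans _ _ (\sum_(0 <= j <oo) diam_pow t (U j) + (4^-1)%:E)%E).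
    by apply: epsilon_trick => // j; exact: diam_pow_ge0.
  apply: (@lt_le_trans _ _ ((2^-1)%:E + (4^-1)%:E)%E); first by rewrite lteD2rE.
  by rewrite -EFinD lee_fin; lra.
have z0n : node 0%N 0.
  by rewrite /node /is_node /ypart linear0 /int_vec raddf0 normr0 divr_ge0// expR_ge0.
have [b [bz b0 bU]] := tree_escape N0 r0 rS children (fun j => (HK j).1) z0n sK.
have : uniform_approx A (psi_pow tau) (\pi_(torus R m) b).
  apply: (uniform_approxP A (psi_pow tau) (erefl _)).2; exists (expR (s k0)) => T Tk.
  have T0 : 0 < T by apply: lt_trans Tk; exact: expR_gt0.
  have sT : s k0 < ln T by rewrite -ltr_expR lnK.
  have s0 : 0 <= ln T / h.
    by rewrite divr_ge0 ?(ltW h0)//; apply: le_trans (ltW sT); rewrite mulr_ge0// ltW.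
  have /andP[k1 k2] := truncn_itv s0.
  have kk : (k0 <= Num.truncn (ln T / h))%N.
    by rewrite truncn_ge_nat// ler_pdivlMr// mulrC ltW.
  rewrite ler_pdivlMr// mulrC in k1; rewrite ltr_pdivrMr// mulrC in k2.
  move: (Num.truncn _) kk k1 k2 => K kk k1 k2.
  have [z zn zb] := bz (K - k0)%N; exists z; split.
    rewrite distrC; apply: (le_trans zb); rewrite /r mulrC divfK// subnK//.
    rewrite /psi_pow /powR gt_eqF// ler_expR mulNr lerN2 ler_pM2l//; exact: ltW.
  move: zn; rewrite /node /is_node subnK// => /le_trans; apply.
  rewrite -[leRHS](lnK T0); apply: (@le_trans _ _ (expR (h * K%:R))).
    by rewrite ler_pdivrMr// ler_peMr ?expR_ge0// ler1n.
  by rewrite ler_expR.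
move=> /DU[j _ Uj]; exact: (bU j).
Qed.

End LowerBound.

(** * Continuity and general approximating functions *)

(** The speed gap between the splits (0, 0) and (a, b) bounds [|b - tau * a|] from below, which
    keeps b/a away from [tau]. *)
Lemma regular_exponents_open (R : realType) (m n : nat) (tau : R) : (0 < m)%N ->
  regular_exponents R m n tau -> exists2 e : R, 0 < e &
  forall tau', `|tau' - tau| <= e -> regular_exponents R m n tau'.
Proof.
move=> hm tau_reg; have t0 := tau_gt0 tau_reg.
have [delta de0 gap] := slope_gap tau_reg.
have m0 : 0 < m%:R :> R by rewrite ltr0n.
exists (Num.min (tau / 2) (delta / (2 * m%:R))).
  by rewrite lt_min !divr_gt0// mulr_gt0.
move=> tau'; rewrite le_min => /andP[h1 h2]; split.
  by rewrite /= in_itv /= andbT; move: h1; rewrite ler_norml => /andP[]; lra.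
move=> [a [b [/andP[a1 am] /andP[b1 bn] tE]]].
have a0 : 0 < a%:R :> R by rewrite ltr0n.
have := gap 0%N a 0%N b (leq0n _) am (leq0n _) bn; rewrite add0n ltn_addr//.
rewrite mulr0 subrr subr0 => /(_ isT).
have -> : b%:R - tau * a%:R = (tau' - tau) * a%:R :> R by rewrite tE mulrBl divfK// gt_eqF.
rewrite normrM (gtr0_norm a0) leNgt => /negP; apply.
apply: (@le_lt_trans _ _ (delta / 2)); last by rewrite ltr_pdivrMr// ltr_pMr// ltr1n.
apply: (@le_trans _ _ (delta / (2 * m%:R) * a%:R)); first by rewrite ler_wpM2r.
rewrite (_ : delta / (2 * m%:R) * a%:R = delta / 2 * (a%:R / m%:R)); last first.
  by field; rewrite gt_eqF.
by rewrite ger_pMr ?divr_gt0// ler_pdivrMr// mul1r ler_nat.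
Qed.

Lemma uniform_approx_le (R : realType) (m n : nat) (A : 'M[R]_(m, n)) (psi psi' : R -> R) (T0 : R) :
  (forall T, T0 < T -> psi T <= psi' T) -> uniform_approx A psi `<=` uniform_approx A psi'.
Proof.
move=> H b [S [_ HS]]; exists (Num.max S T0); split; first exact: num_real.
move=> T; rewrite gt_max => /andP[ST TT].
by have [p [q [h1 h2]]] := HS _ ST; exists p, q; split=> //; apply: (le_trans h1); exact: H.
Qed.

Section Final.
Context (R : realType) (m n : nat) (A : 'M[R]_(m, n)).
Hypotheses (hm : (0 < m)%N) (hn : (0 < n)%N).
Implicit Types (tau c : R) (psi : R -> R).

Lemma dim_psi_pow tau : regular_exponents R m n tau ->
  hausdorff_dim (uniform_approx A (psi_pow tau)) = dim_formula A tau.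
Proof.
move=> tau_reg; have tau0 := ltW (tau_gt0 tau_reg).
have [x [Ex _ _]] := dim_formulaP A hm hn tau0; rewrite Ex.
(* [hausdorff_dim] is an infimum over nonnegative exponents, so the value of the formula must be
   known to be nonnegative; this follows from [hsum_ge0]. *)
have x0 : 0 <= x.
  rewrite leNgt; apply/negP => x0.
  have eps0 : 0 < - x / 4 by rewrite divr_gt0// oppr_gt0.
  have [h [eta [K1 [_ h0 _ _ _] [_ _ up]]]] := hsum_dim hm hn tau_reg Ex eps0 ltr01.
  have xx : x < x / 2 by lra.
  have [C HC] := up _ xx.
  have [K0 HK0] := eventually_ge (C + 1) eps0 h0.
  have [K kK hK] := HC K0; have := HK0 _ kK.
  have := hsum_ge0 A tau eta K1 K h0; move: hK.
  rewrite (_ : x / 2 * (h * K%:R) = - 2 * (- x / 4 * (h * K%:R))); last by field.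
  by move: (hsum _ _ _ _ _ _) (- x / 4 * _) => *; lra.
apply/eqP; rewrite eq_le; apply/andP; split.
  apply/lee_addgt0Pr => e e0; rewrite -EFinD; apply: ereal_inf_lbound.
  exists (x + e) => //; split; first by rewrite addr_ge0// ltW.
  apply: (upper_measure hm hn tau_reg Ex); first by rewrite ltrDl.
  by rewrite addr_ge0// ltW.
apply: le_ereal_inf_tmp => _ [s [s0 Hs] <-]; rewrite lee_fin leNgt; apply/negP => sx.
exact: (lower_measure hm hn tau_reg Ex s0 sx).
Qed.

Lemma dim_sandwich tau psi : regular_exponents R m n tau ->
  (forall e, 0 < e -> exists T0, forall T, T0 < T -> psi_pow (tau + e) T <= psi T <= psi_pow (tau - e) T) ->
  hausdorff_dim (uniform_approx A psi) = dim_formula A tau.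
Proof.
move=> tau_reg H; have tau0 := ltW (tau_gt0 tau_reg).
have [x [Ex _ _]] := dim_formulaP A hm hn tau0; rewrite Ex.
have near eps : 0 < eps -> ((x - eps)%:E <= hausdorff_dim (uniform_approx A psi) <= (x + eps)%:E)%E.
  move=> eps0; have [e1 e10 reg1] := regular_exponents_open hm tau_reg.
  have [e2 e20 Hdim] := dim_formula_near A hm hn tau_reg eps0.
  pose e := Num.min e1 e2; have e0 : 0 < e by rewrite lt_min e10.
  have [ee1 ee2] : e <= e1 /\ e <= e2 by rewrite !ge_min !lexx orbT.
  have close tau' : `|tau' - tau| <= e ->
      exists2 x', hausdorff_dim (uniform_approx A (psi_pow tau')) = x'%:E & `|x' - x| <= eps.
    move=> te; have r' : regular_exponents R m n tau' by apply: reg1; exact: le_trans ee1.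
    have t'0 := ltW (tau_gt0 r').
    have [x' [Ex' _ _]] := dim_formulaP A hm hn t'0; exists x'; first by rewrite dim_psi_pow.
    by apply: (Hdim tau' _ t'0 x x' Ex Ex'); exact: le_trans ee2.
  have [T0 HT] := H _ e0.
  have [xp Exp] : exists2 x', hausdorff_dim (uniform_approx A (psi_pow (tau + e))) = x'%:E & `|x' - x| <= eps.
    by apply: close; rewrite addrAC subrr add0r gtr0_norm.
  have [xm Exm] : exists2 x', hausdorff_dim (uniform_approx A (psi_pow (tau - e))) = x'%:E & `|x' - x| <= eps.
    by apply: close; rewrite addrAC subrr add0r normrN gtr0_norm.
  rewrite !ler_norml => /andP[_ b2] /andP[b1 _]; apply/andP; split.
    apply: (@le_trans _ _ xp%:E); first by rewrite lee_fin; lra.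
    rewrite -Exp; apply: hausdorff_dim_le; apply: (@uniform_approx_le _ _ _ _ _ _ T0) => T /HT.
    by case/andP.
  apply: (@le_trans _ _ xm%:E); last by rewrite lee_fin; lra.
  rewrite -Exm; apply: hausdorff_dim_le; apply: (@uniform_approx_le _ _ _ _ _ _ T0) => T /HT.
  by case/andP.
apply/eqP; rewrite eq_le; apply/andP; split; apply/lee_addgt0Pr => e e0.
  by have /andP[_] := near _ e0; rewrite EFinD.
have /andP[h _] := near _ e0; rewrite EFinB in h.
by rewrite -leeBlDr.
Qed.

(** Treats constants and general functions at once: both change the logarithm of the power function
    by o(log T). *)
Lemma dim_log_equivalent tau c psi : regular_exponents R m n tau -> 0 < c ->
  (forall T, 0 < T -> 0 < psi T) ->
  (forall e, 0 < e -> exists T0, forall T, T0 < T -> `|ln (psi T)^-1 - tau * ln T| <= e * ln T) ->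
  hausdorff_dim (uniform_approx A (fun T => c * psi T)) = dim_formula A tau.
Proof.
move=> tau_reg c0 psi0 H; apply: dim_sandwich => // e e0.
have e20 : 0 < e / 2 by rewrite divr_gt0.
have [T0 HT] := H _ e20.
(* Half of [e] is spent on [psi] and half on [c]: past the second bound [|ln c|] is less than
   [e / 2 * ln T]. *)
exists (Num.max T0 (expR (Num.max 0 (`|ln c| / (e / 2))))) => T; rewrite gt_max => /andP[TT Tc].
have T1 : 0 < T by apply: lt_trans Tc; exact: expR_gt0.
have := HT _ TT; rewrite -(lnK T1) !expRK.
have : Num.max 0 (`|ln c| / (e / 2)) < ln T by rewrite -ltr_expR lnK.
rewrite lnK//; rewrite gt_max ltr_pdivrMr// => /andP[l0 lc].
have p0 := psi0 _ T1; rewrite lnV// ler_norml => /andP[h1 h2].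
rewrite /psi_pow /powR !gt_eqF//.
have E : c * psi T = expR (ln c + ln (psi T)) by rewrite expRD !lnK.
rewrite E !ler_expR; have n1 := ler_norm (ln c); have n2 := ler_norm (- ln c); rewrite normrN in n2.
have e1 : ln T * (e / 2) = e * ln T / 2 by field.
have e2 : e / 2 * ln T = e * ln T / 2 by field.
rewrite e1 in lc; rewrite e2 in h1 h2.
have -> : - (tau + e) * ln T = - (tau * ln T) - e * ln T by ring.
have -> : - (tau - e) * ln T = - (tau * ln T) + e * ln T by ring.
move: n1 n2 lc h1 h2; move: (ln c) `|ln c| (e * ln T) (tau * ln T) (ln (psi T)) => *.
by apply/andP; split; lra.
Qed.

Lemma dim_scaled_pow tau c : regular_exponents R m n tau -> 0 < c ->
  hausdorff_dim (uniform_approx A (fun T => c * psi_pow tau T)) = dim_formula A tau.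
Proof.
move=> tau_reg c0; apply: dim_log_equivalent => //.
  by move=> T T0; rewrite powR_gt0.
move=> e e0; exists 1 => T T1; have T0 : 0 < T by exact: lt_trans T1.
have l0 : 0 <= ln T by rewrite ln_ge0// ltW.
by rewrite lnV ?posrE ?powR_gt0// ln_powR mulNr opprK subrr normr0 mulr_ge0// ltW.
Qed.

(** Continuity at each regular exponent in the full topology of the line; restriction to a connected
    component is then immediate. *)
Lemma dim_scaled_pow_continuous tau c : regular_exponents R m n tau -> 0 < c ->
  {for tau, continuous (fun tau' => hausdorff_dim (uniform_approx A (fun T => c * psi_pow tau' T)))}.
Proof.
move=> tau_reg c0; have tau0 := ltW (tau_gt0 tau_reg).
have [x [Ex _ _]] := dim_formulaP A hm hn tau0.
have [e1 e10 reg1] := regular_exponents_open hm tau_reg.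
have val tau' : `|tau' - tau| <= e1 -> exists x', 
    hausdorff_dim (uniform_approx A (fun T => c * psi_pow tau' T)) = x'%:E /\ dim_formula A tau' = x'%:E.
  move=> /reg1 r'; have [x' [Ex' _ _]] := dim_formulaP A hm hn (ltW (tau_gt0 r')).
  by exists x'; rewrite dim_scaled_pow.
rewrite /prop_for /continuous_at dim_scaled_pow// Ex; apply: cvg_EFin.
  exists e1 => //= tau' te; have te' : `|tau' - tau| <= e1 by rewrite distrC; exact: ltW te.
  by have [x' [-> _]] := val _ te'.
apply/cvgrPdist_le => eps eps0.
have [e2 e20 Hdim] := dim_formula_near A hm hn tau_reg eps0.
exists (Num.min e1 e2); first by rewrite /= lt_min e10.
move=> tau' /=; rewrite lt_min distrC => /andP[t1 t2].
have [x' [E1 E2]] := val _ (ltW t1); rewrite E1 /= distrC.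
apply: (Hdim tau' (ltW t2) _ x x' Ex E2); exact/ltW/(tau_gt0 (reg1 _ (ltW t1))).
Qed.

End Final.

Theorem theorem1p4 (R : realType) (m n : nat) (hm : (0 < m)%N) (hn : (0 < n)%N)
    (A : 'M[R]_(m, n)) :
  [/\ (forall tau c : R, regular_exponents R m n tau -> 0 < c ->
         hausdorff_dim (uniform_approx A (fun T => c * psi_pow tau T))
         = dim_formula A tau),
      (forall tau c c' : R, regular_exponents R m n tau -> 0 < c -> 0 < c' ->
         hausdorff_dim (uniform_approx A (fun T => c * psi_pow tau T))
         = hausdorff_dim (uniform_approx A (fun T => c' * psi_pow tau T))),
      (forall tau0 c : R, regular_exponents R m n tau0 -> 0 < c ->
         {within connected_component (regular_exponents R m n) tau0,
           continuous (fun tau : R =>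
             hausdorff_dim (uniform_approx A (fun T => c * psi_pow tau T)))})
    & (forall (tau : R) (psi : R -> R), regular_exponents R m n tau ->
         (forall T, 0 < T -> 0 < psi T) ->
         {within `]0, +oo[, continuous psi} ->
         (forall S T, 0 < S -> S < T -> psi T < psi S) ->
         psi T @[T --> +oo] --> 0 ->
         ln (psi T)^-1 / ln T @[T --> +oo] --> tau ->
         forall c : R, 0 < c ->
           hausdorff_dim (uniform_approx A (fun T => c * psi T))
           = hausdorff_dim (uniform_approx A (psi_pow tau))
           /\ hausdorff_dim (uniform_approx A (fun T => c * psi T))
              = dim_formula A tau)].
Proof.
split.
- by move=> tau c tau_reg c0; exact: dim_scaled_pow.
- by move=> tau c c' tau_reg c0 c'0; rewrite !dim_scaled_pow.
- move=> tau0 c tau_reg c0; apply: continuous_in_subspaceT => tau /set_mem ct.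
  by apply: dim_scaled_pow_continuous => //; exact: connected_component_sub ct.
- move=> tau psi tau_reg psi0 _ _ _ lim c c0.
  have E : hausdorff_dim (uniform_approx A (fun T => c * psi T)) = dim_formula A tau.
    apply: dim_log_equivalent => // e e0.
    move/cvgrPdist_le: lim => /(_ _ e0)[T0 [_ HT]]; exists (Num.max 1 T0) => T.
    rewrite gt_max => /andP[T1 /HT /= h].
    have l0 : 0 < ln T by rewrite ln_gt0.
    rewrite -[ln (psi T)^-1](divfK (lt0r_neq0 l0)) -mulrBl normrM (gtr0_norm l0).
    by rewrite ler_wpM2r ?(ltW l0)// distrC.
  by rewrite E dim_psi_pow.
Qed.
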